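(* Let $n=2k+1$ with $k\ge2$. In the random subgraph process on $K(n,k)$, with high probability (as $n\to\infty$) $\tau_\alpha=\tau_{\mathrm{super}}$.
   Context: For integers $k\ge 2$ and $n\ge 2k+1$, the Kneser graph $K(n,k)$ has vertex set $\binom{[n]}{k}$ (the $k$-subsets of $[n]=\{1,\dots,n\}$), two sets being adjacent exactly when they are disjoint. For $x\in[n]$, the star based at $x$ is $\mathcal K_x=\{S\in\binom{[n]}{k}:x\in S\}$, of size $\binom{n-1}{k-1}$. A superstar based at $x$ is a family of the form $\{A\}\cup\mathcal K_x$ with $A\in\binom{[n]}{k}$, $A\notin\mathcal K_x$. $\alpha(G)$ denotes the maximum size of an independent set of $G$. Random subgraph process: let $m=|E(K(n,k))|$ and choose a bijection $\pi:E(K(n,k))\to[m]$ uniformly at random; $K_i(n,k)$ is the spanning subgraph of $K(n,k)$ whose edges are the $e$ with $\pi(e)\le i$. Define the random variables $$\tau_{\mathrm{super}}=\min\{i: K_i(n,k)\text{ has no independent superstars}\},\qquad \tau_\alpha=\min\left\{i:\alpha(K_i(n,k))=\binom{n-1}{k-1}\right\},$$ where a superstar is independent in $K_i(n,k)$ if it spans no edge of $K_i(n,k)$. ''With high probability'' means with probability (over $\pi$) tending to $1$ as $n\to\infty$. *)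

(* Defs.v *)
From HB Require Import structures.
From mathcomp Require Import all_boot all_order all_algebra.

Set Implicit Arguments.
Unset Strict Implicit.
Unset Printing Implicit Defensive.

(* A spanning subgraph on a vertex type V is given by its edge set, the edges
   being unordered pairs of vertices. *)
Definition independent (V : finType) (G : {set {set V}}) (F : {set V}) : bool :=
  [forall e in G, ~~ (e \subset F)].

Definition alpha (V : finType) (G : {set {set V}}) : nat :=
  \max_(F : {set V} | independent G F) #|F|.

Definition ksubset (n k : nat) := {S : {set 'I_n} | #|S| == k}.

(* Disjoint k-subsets are distinct when 0 < k, so there are no loops. *)
Definition kneser_edges (n k : nat) : {set {set ksubset n k}} :=
  [set e | [exists A : ksubset n k, exists B : ksubset n k,
              (e == [set A; B]) && [disjoint val A & val B]]].

Definition num_edges (n k : nat) : nat := #|kneser_edges n k|.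

Definition edge (n k : nat) := {e : {set ksubset n k} | e \in kneser_edges n k}.

Definition star (n k : nat) (x : 'I_n) : {set ksubset n k} :=
  [set S : ksubset n k | x \in val S].

Definition superstar (n k : nat) (F : {set ksubset n k}) : bool :=
  [exists x : 'I_n, exists A : ksubset n k,
     (A \notin star k x) && (F == A |: star k x)].

Definition labelling (n k : nat) := {ffun edge n k -> 'I_(num_edges n k)}.

Definition edge_orders (n k : nat) : {set labelling n k} :=
  [set pi : labelling n k | injectiveb pi && [forall i, exists e : edge n k, pi e == i]].

(* Labels are 0-based in 'I_m, so the edge e has label (pi e).+1 in {1..m}. *)
Definition process (n k : nat) (pi : labelling n k) (i : nat) :
    {set {set ksubset n k}} :=
  [set val e | e : edge n k & (pi e).+1 <= i].

Definition is_first (P : pred nat) (t : nat) : bool :=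
  P t && [forall s : 'I_t, ~~ P s].

(* The two hitting times are defined by their graphs, so that no default value
   is needed for the minimum of a set that could a priori be empty. *)
Definition is_tau_super (n k : nat) (pi : labelling n k) : pred nat :=
  is_first (fun i =>
    [forall F : {set ksubset n k}, superstar F ==> ~~ independent (process pi i) F]).

Definition is_tau_alpha (n k : nat) (pi : labelling n k) : pred nat :=
  is_first (fun i => alpha (process pi i) == 'C(n.-1, k.-1)).

(* The event that both minima exist and are equal; times beyond m need not be
   considered since the process is constant from time m on. *)
Definition tau_alpha_eq_tau_super (n k : nat) : {set labelling n k} :=
  [set pi : labelling n k | [exists t : 'I_(num_edges n k).+1,
               is_tau_alpha pi t && is_tau_super pi t]].

Definition unif_prob (R : numFieldType) (T : finType) (Omega E : {set T}) : R :=
  (#|E :&: Omega|%:R / #|Omega|%:R)%R.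

(* Main.v *)
(* Write M = C(2k, k-1) for the size of a star and L = C(2k, k) for the number of
   sets outside it. While an independent superstar survives, the independence
   number exceeds M, so tau_super <= tau_alpha; one must exclude an independent
   F with |F| = M + 1 at time tau_super. The vertices outside a star K_x send
   disjoint sets of k edges into K_x, so by the second moment method an
   independent superstar still exists at a time with a third of the edges left;
   there, a set of d edges of the Kneser graph is entirely absent with
   probability at most (2/5)^d.

   If F is far from all stars, it spans at least L/1024 edges: few edges make
   the indicator of F nearly an affine function of the elements, and comparing the
   indicator with its image under many disjoint transpositions (the fourth
   moment of a linear form being controlled) makes one coefficient large. If F is
   close to K_x, then A = F \ K_x violates Hall's condition for the present edges
   between A and K_x. A minimal violator is either a single vertex, and so
   yields an independent superstar, or a connected pair (A, B), where B is the set of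
   present neighbours and |B| < |A|; the spectrum of the Kneser graph shows that at
   least |A|/30 edges leave A outside B.

   Union bounds finish both cases: a pair (A, B) losing d edges is determined
   by few small sets up to errors, so the number of such pairs is
   exp(o(d)) up to a polynomial in the number of vertices. *)
Require Import Defs.
From mathcomp Require Import all_classical all_reals all_analysis.
From mathcomp Require Import all_boot all_order all_algebra fingroup perm.
From mathcomp Require Import zify ring lra.
Set Implicit Arguments.
Unset Strict Implicit.
Unset Printing Implicit Defensive.
Import Order.TTheory GRing.Theory Num.Theory.

(** * Up and down operators *)

(** The missing fraction, one third, is taken from a window. About 4^k vertices lie outside a star,
    each with k edges into it, so superstars survive at missing fraction p as soon as 4 p > 1. A
    linked violator of Hall's condition with at least two vertices loses at least 2 k - 2 edges and
    has about 4^k places to start, so such violators vanish as soon as 4 p^2 < 1. Thus 1/4 < p < 1/2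
    is wanted; around 1/3, the values 3/10 and 2/5 leave room for sampling without replacement and
    for the entropy of the encodings.

    That entropy is the obstacle. A pair may lose only |A| / 30 edges, too few to pay a factor that
    is a power of k for each vertex of A. The encoding therefore uses O(|A| / s) vertices, plus
    errors of that order, with s about the fourth root of k; the cost per lost edge is then of order
    (log k) / s, which tends to 0.

    Since absent edges only become fewer, every union bound is made at one deterministic time
    instead of the random hitting time. *)

Section UpDown.
Local Open Scope ring_scope.
Variables (R : realFieldType) (T : finType) (G : {set T}).
Implicit Types (f g h : {set T} -> R) (S P : {set T}) (i j : nat).

Definition up f S : R := \sum_(y in S) f (S :\ y).
Definition down f S : R := \sum_(y in G :\: S) f (y |: S).
Definition dot i f g : R :=
  \sum_(S : {set T} | (S \subset G) && (#|S| == i)) f S * g S.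

Lemma dot_up_down i f g : dot i.+1 (up f) g = dot i f (down g).
Proof.
rewrite /dot; under eq_bigr do rewrite mulr_suml.
under [RHS]eq_bigr do rewrite mulr_sumr.
rewrite (exchange_big_dep xpredT) //= [RHS](exchange_big_dep xpredT) //=.
apply: eq_bigr => y _.
rewrite (reindex_onto (fun S => y |: S) (fun S => S :\ y)) /=; last first.
  by move=> S /andP[_ yS]; rewrite setD1K.
apply: eq_big => [S|S /andP[/andP[_ yS] /eqP ->] //].
rewrite !inE eqxx /= andbT.
have [yS|yS] := boolP (y \in S); last first.
  rewrite setU1K // eqxx andbT cardsU1 yS /= add1n eqSS.
  by rewrite subUset sub1set; case: (y \in G); rewrite /= ?andbT ?andbF.
rewrite andbF; apply/negbTE; rewrite negb_and; apply/orP; right.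
by apply/eqP => /setP /(_ y); rewrite !inE eqxx yS.
Qed.

Lemma dotC i f g : dot i f g = dot i g f.
Proof. by apply: eq_bigr => S _; rewrite mulrC. Qed.

Lemma dot_ge0 i f : 0 <= dot i f f.
Proof. by apply: sumr_ge0 => S _; rewrite -expr2 sqr_ge0. Qed.

Lemma eq_dot i f f' g g' :
    (forall S, S \subset G -> #|S| = i -> f S = f' S) ->
    (forall S, S \subset G -> #|S| = i -> g S = g' S) ->
  dot i f g = dot i f' g'.
Proof.
by move=> ff' gg'; apply: eq_bigr => S /andP[SG /eqP Si]; rewrite ff' ?gg'.
Qed.

Lemma dotDl i f g h : dot i (fun S => f S + g S) h = dot i f h + dot i g h.
Proof. by rewrite -big_split; apply: eq_bigr => S _; rewrite /= mulrDl. Qed.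

Lemma dotZl i a f h : dot i (fun S => a * f S) h = a * dot i f h.
Proof. by rewrite mulr_sumr; apply: eq_bigr => S _; rewrite mulrA. Qed.

Lemma dotDr i f g h : dot i h (fun S => f S + g S) = dot i h f + dot i h g.
Proof. by rewrite dotC dotDl !(dotC i h). Qed.

Lemma dotZr i a f h : dot i h (fun S => a * f S) = a * dot i h f.
Proof. by rewrite dotC dotZl (dotC i h). Qed.

(** Adding and removing distinct elements commute; the terms where the same element is added and
    removed contribute |G| - |S| on one side and |S| on the other. *)
Lemma down_up f S : S \subset G ->
  down (up f) S = up (down f) S + (#|G|%:R - 2 * #|S|%:R) * f S.
Proof.
move=> SG.
have ->: down (up f) S =
    #|G :\: S|%:R * f S + \sum_(y in G :\: S) \sum_(z in S) f (y |: (S :\ z)).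
  rewrite /down /up mulr_natl -sumr_const -big_split /=.
  apply: eq_bigr => y; rewrite inE => /andP[yS yG].
  rewrite (big_setU1 _ yS) /= setU1K //; congr (_ + _).
  apply: eq_bigr => z zS; congr f; apply/setP => w; rewrite !inE.
  by case: (eqVneq w z) => // ->; case: eqP => // zy; rewrite -zy zS in yS.
have ->: up (down f) S =
    #|S|%:R * f S + \sum_(z in S) \sum_(y in G :\: S) f (y |: (S :\ z)).
  rewrite /down /up mulr_natl -sumr_const -big_split /=.
  apply: eq_bigr => z zS.
  have -> : G :\: (S :\ z) = z |: (G :\: S).
    apply/setP => w; rewrite !inE negb_and negbK.
    by case: eqVneq => // ->; rewrite (subsetP SG).
  rewrite big_setU1 ?inE ?zS //= setD1K //.
rewrite exchange_big /= cardsD (setIidPr SG) natrB ?subset_leq_card //.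
ring.
Qed.

Lemma norm_up i f :
  dot i.+2 (up f) (up f) =
  dot i (down f) (down f) + (#|G|%:R - 2 * i.+1%:R) * dot i.+1 f f.
Proof.
rewrite dot_up_down dotC -(dot_up_down i (down f)) -dotZl -dotDl.
by apply: eq_dot => // S SG Si; rewrite down_up // Si.
Qed.

(** Orthogonality to [above P] for all P of size j - 1 stands for having only components of degree
    at least j in the Johnson scheme. [down] preserves it, by [dot_above_down], so no eigenbasis has
    to be built. *)
Definition above P S : R := (P \subset S)%:R.

Lemma dot_above_down P i f :
  dot i (above P) (down f) = (i.+1%:R - #|P|%:R) * dot i.+1 (above P) f.
Proof.
rewrite -dot_up_down -dotZl; apply: eq_dot => // S SG Si; rewrite /up /above.
have [PS|PS] := boolP (P \subset S); last first.
  rewrite mulr0 big1 // => y yS; case: (boolP (P \subset S :\ y)) => // PSy.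
  by case/negP: PS; apply: (subset_trans PSy); apply: subD1set.
rewrite mulr1 -Si -natrB ?subset_leq_card // -(setIidPr PS) -cardsD -sumr_const.
rewrite (setIidPr PS).
rewrite [RHS]big_mkcond [LHS]big_mkcond; apply: eq_bigr => y _; rewrite inE.
rewrite subsetD1 PS /=; case: (y \in S) => //=; last by rewrite andbF.
by case: (y \in P).
Qed.

Lemma dot_above_self P f : P \subset G -> dot #|P| (above P) f = f P.
Proof.
move=> PG; rewrite /dot (bigD1 P) /= ?PG ?eqxx // /above subxx mul1r.
rewrite big1 ?addr0 // => S /andP[/andP[SG /eqP SP] nSP].
case: (boolP (P \subset S)) => [PS|_]; last by rewrite mul0r.
by case/negP: nSP; rewrite eq_sym eqEcard PS SP leqnn.
Qed.

Lemma down_vanish i f :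
    (forall P, P \subset G -> #|P| = i -> dot i.+1 (above P) f = 0) ->
  dot i (down f) (down f) = 0.
Proof.
move=> f0; rewrite /dot big1 // => P /andP[PG /eqP Pi].
have -> : down f P = 0; last by rewrite mul0r.
by rewrite -dot_above_self // Pi dot_above_down (f0 P) ?mulr0.
Qed.

(* Expanding [0 <= |up (down f) - c f|^2] turns the bound for [down f], one
   level below, into the bound for [f]. *)
Lemma down_gap j i f : (0 < j)%N -> (i.+1 + j <= #|G|)%N -> (j <= i.+1)%N ->
    (forall P, P \subset G -> #|P|.+1 = j -> dot i.+1 (above P) f = 0) ->
  dot i (down f) (down f) <=
    (i.+1%:R - j%:R) * (#|G|%:R - i%:R - j%:R) * dot i.+1 f f.
Proof.
move=> j_gt0; elim: i f => [|i IH] f ijG; rewrite leq_eqVlt => /predU1P[ji|ji] f0.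
- rewrite ji subrr !mul0r down_vanish // => P PG P0; apply: f0 => //.
  by rewrite P0.
- by move: ji; rewrite ltnS leqNgt j_gt0.
- rewrite ji subrr !mul0r down_vanish // => P PG P0; apply: f0 => //.
  by rewrite P0.
(* [c] is the eigenvalue of [up] after [down] on the component of degree exactly j at level i +
   2. *)
set c := (_ - _) * _; set g := down f.
have c_gt0 : 0 < c.
  apply: mulr_gt0; first by rewrite subr_gt0 ltr_nat; lia.
  by rewrite -addrA -opprD -natrD subr_gt0 ltr_nat; lia.
have {}IH : dot i (down g) (down g) <=
    (i.+1%:R - j%:R) * (#|G|%:R - i%:R - j%:R) * dot i.+1 g g.
  apply: IH => //; first by lia.
  by move=> P PG Pj; rewrite dot_above_down f0 ?mulr0.
have gg : dot i.+2 (up g) f = dot i.+1 g g by rewrite dot_up_down.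
have := dot_ge0 i.+2 (fun S => up g S + (- c) * f S).
rewrite dotDl dotZl !dotDr !dotZr (dotC _ f) gg.
rewrite norm_up -/g => key.
rewrite -subr_ge0 -(pmulr_rge0 _ c_gt0).
move: IH key; rewrite /c -!natr1.
nra.
Qed.

Lemma dot_cst i a b : dot i (fun=> a) (fun=> b) = 'C(#|G|, i)%:R * (a * b).
Proof.
rewrite /dot sumr_const -(cards_draws G i) mulr_natl; congr (_ *+ _).
by apply: eq_card => S; rewrite !inE.
Qed.

Lemma dot_cstl i a f : dot i (fun=> a) f = a * dot i (fun=> 1) f.
Proof. by rewrite -dotZl; apply: eq_dot => // S _ _; rewrite mulr1. Qed.

Lemma dot_above0 i f : dot i (above set0) f = dot i (fun=> 1) f.
Proof. by apply: eq_dot => // S _ _; rewrite /above sub0set. Qed.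

Definition ind (F : {set {set T}}) S : R := (S \in F)%:R.

Lemma dot_ind i (F : {set {set T}}) f : {in F, forall S, (S \subset G) && (#|S| == i)} ->
  dot i (ind F) f = \sum_(S in F) f S.
Proof.
move=> Fi; rewrite /dot /ind big_mkcond [RHS]big_mkcond; apply: eq_bigr => S _.
case: (boolP (S \in F)) => [/Fi ->|_]; first by rewrite mul1r.
by rewrite mul0r if_same.
Qed.

Lemma up_ind (F : {set {set T}}) i S : {in F, forall S, #|S| = i} -> #|S| = i.+1 ->
  up (ind F) S = #|[set v in F | v \subset S]|%:R.
Proof.
move=> Fi Si; rewrite /up /ind.
have -> : [set v in F | v \subset S] =
    (fun y => S :\ y) @: [set y in S | S :\ y \in F].
  apply/setP => v; apply/idP/imsetP => [|[y]]; last first.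
    by rewrite !inE => /andP[_ SF] ->; rewrite SF subD1set.
  rewrite inE => /andP[vF vS].
  have /cards1P[y Sy] : #|S :\: v| == 1%N.
    by rewrite cardsD (setIidPr vS) Si (Fi v vF) subSnn.
  have vE : v = S :\ y.
    by rewrite -Sy setDDr setDv set0U (setIidPr vS).
  exists y => //; rewrite inE -vE vF andbT.
  by have : y \in S :\: v by [rewrite Sy set11]; rewrite inE => /andP[].
rewrite card_in_imset => [|y z]; last first.
  rewrite !inE => /andP[yS _] /andP[zS _] /setP /(_ y).
  by rewrite !inE eqxx yS andbT /=; case: eqP.
rewrite -sum1_card natr_sum big_mkcond [RHS]big_mkcond.
by apply: eq_bigr => y _; rewrite inE; case: (y \in S); case: (_ \in F).
Qed.
End UpDown.


(** * Edge isoperimetry between layers k and k + 1 of a 2k-set *)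

Section MiddleLayers.
Local Open Scope ring_scope.
Variables (R : realFieldType) (T : finType) (G : {set T}) (k : nat).
Hypotheses (cardG : #|G| = (2 * k)%N) (k_gt0 : (0 < k)%N).

(** On level k, [up] after [down] has eigenvalue k (k + 1) on constants and at most k (k - 1) on
    their orthogonal complement. Of the squared norm |A| of the indicator, the constant part carries
    |A|^2 / L. *)
Lemma down_ind_le (A : {set {set T}}) :
    {in A, forall S : {set T}, (S \subset G) && (#|S| == k)} ->
  dot G k.-1 (down G (@ind R T A)) (down G (ind R A)) <=
    #|A|%:R * (k%:R ^+ 2 - k%:R + 2 * k%:R * (#|A|%:R / 'C(2 * k, k)%:R)).
Proof.
move=> Ak; case: k k_gt0 cardG Ak => // i _ cG Ak /=.
set f := ind R A; set L : R := 'C(_, _)%:R; set a : R := #|A|%:R.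
have L_gt0 : 0 < L by rewrite ltr0n bin_gt0; lia.
set al := a / L; pose f' S := f S + (- al).
have dff : dot G i.+1 f f = a.
  rewrite dot_ind // /a -sum1_card natr_sum; apply: eq_bigr => S SA.
  by rewrite /f /ind SA.
have d1f : dot G i.+1 (fun=> 1) f = a.
  by rewrite dotC dot_ind // sumr_const.
have d1f' : dot G i.+1 (fun=> 1) f' = 0.
  rewrite dotDr d1f dot_cst cG -/L /al mul1r mulrN mulrCA divff ?gt_eqF //.
  by rewrite mulr1 subrr.
have df'f' : dot G i.+1 f' f' = a - a * al.
  rewrite {1}/f' dotDl dot_cstl d1f' mulr0 addr0 /f' dotDr dff dotC dot_cstl d1f.
  by ring.
have gap := @down_gap R T G 1 i f' isT _ isT _.
have {}gap : dot G i (down G f') (down G f') <= i%:R * i.+1%:R * (a - a * al).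
  apply: le_trans (gap _ _) _; first by rewrite cG; lia.
    by move=> P PG [] /cards0_eq ->; rewrite dot_above0.
  by rewrite df'f' cG; set N := (2 * _)%N; 
    rewrite -(natr1 i) addrK (_ : N%:R = i%:R + i%:R + 2) /N;
    [lra | rewrite -!natrD; congr _%:R; lia].
have fE : dot G i (down G f) (down G f) = 
    dot G i (fun S => (i.+2%:R * al) * 1 + down G f' S)
            (fun S => (i.+2%:R * al) * 1 + down G f' S).
  suff E (S : {set T}) : S \subset G -> #|S| = i ->
      down G f S = i.+2%:R * al * 1 + down G f' S by apply: eq_dot.
  move=> SG Si; rewrite /down /f' big_split /= sumr_const.
  rewrite (_ : #|G :\: S| = i.+2); last by rewrite cardsD (setIidPr SG); lia.
  by rewrite -mulr_natl; ring.
have d1d : dot G i (fun=> 1) (down G f') = 0.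
  rewrite -dot_above0 dot_above_down dot_above0 d1f' mulr0 //.
rewrite {}fE !dotDl !dotDr !dotZl !dotZr (dotC _ _ (down G f') (fun=> 1)) d1d dot_cst.
have binE : 'C(#|G|, i)%:R * i.+2%:R = L * i.+1%:R.
  rewrite /L cG -!natrM; congr _%:R.
  by rewrite [LHS]mulnC [RHS]mulnC mul_bin_left; congr (_ * _)%N; lia.
have aL : a = al * L by rewrite /al divfK ?gt_eqF.
rewrite !mulr0 add0r addr0 mulr1.
rewrite (_ : _ * _ = i.+2%:R * al * al * ('C(#|G|, i)%:R * i.+2%:R)); last by ring.
rewrite binE; move: gap; rewrite aL -(natr1 i) (_ : i.+2%:R = i%:R + 2).
  by nra.
by rewrite -natrD addn2.
Qed.

(** Expand the sum over b in B of (d b - k)^2 >= 0, using |B| <= |A|. In the middle of a 2k-set [up]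
    and [down] have equal norms, so [down_ind_le] bounds the sum of the squares. The gain over the
    trivial bound k |A| comes from the spectral gap. *)
Lemma incidence_le (A B : {set {set T}}) :
    {in A, forall S : {set T}, (S \subset G) && (#|S| == k)} ->
    {in B, forall S : {set T}, (S \subset G) && (#|S| == k.+1)} ->
    (#|B| <= #|A|)%N ->
  (\sum_(b in B) #|[set v in A | v \subset b]|)%:R <=
    #|A|%:R * (k%:R - 2^-1 + #|A|%:R / 'C(2 * k, k)%:R) :> R.
Proof.
move=> Ak Bk BA; set f := ind R A.
set d := fun b : {set T} => #|[set v in A | v \subset b]|.
have fd b : b \in B -> up f b = (d b)%:R.
  by move=> /Bk /andP[_ /eqP bk]; apply: (up_ind _ _ bk) => v /Ak/andP[_ /eqP].
have sq : \sum_(b in B) (d b)%:R ^+ 2 <= dot G k.+1 (up f) (up f).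
  rewrite /dot big_mkcond [leRHS]big_mkcond; apply: ler_sum => b _.
  case: (boolP (b \in B)) => [bB|_]; first by rewrite Bk // fd.
  by case: ifP => // _; rewrite -expr2 sqr_ge0.
have nn : dot G k.+1 (up f) (up f) = dot G k.-1 (down G f) (down G f).
  by case: k k_gt0 cardG => // i _ cG; rewrite norm_up cG natrM subrr mul0r addr0.
have := down_ind_le Ak; rewrite -/f -{}nn => /(le_trans sq) {}sq.
have pos : 0 <= \sum_(b in B) ((d b)%:R - k%:R) ^+ 2 :> R.
  by apply: sumr_ge0 => b _; apply: sqr_ge0.
have E : \sum_(b in B) ((d b)%:R - k%:R) ^+ 2 = 
    \sum_(b in B) (d b)%:R ^+ 2 - 2 * k%:R * (\sum_(b in B) d b)%:R
    + #|B|%:R * k%:R ^+ 2 :> R.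
  rewrite natr_sum mulr_sumr [#|B|%:R * _]mulr_natl -sumr_const -sumrB -big_split /=.
  by apply: eq_bigr => b _; ring.
have k0 : 0 < k%:R :> R by rewrite ltr0n.
have BA' : #|B|%:R <= #|A|%:R :> R by rewrite ler_nat.
rewrite -subr_ge0 -(pmulr_rge0 _ k0).
move: pos; rewrite {}E.
have := ler_wpM2r (sqr_ge0 k%:R) BA'.
by nra.
Qed.
End MiddleLayers.

Lemma central_bin_half k : (0 < k)%N -> 'C(2 * k, k) = (2 * 'C((2 * k).-1, k.-1))%N.
Proof.
case: k => // i _; rewrite [(2 * i.+1)%N](_ : _ = (2 * i).+2) //; last by lia.
rewrite binS /= -(bin_sub (n := (2 * i).+1) (m := i.+1)); last by lia.
rewrite (_ : (2 * i).+1 - i.+1 = i)%N; lia.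
Qed.

(** * Families of k-subsets of a (2k+1)-set with few disjoint pairs *)

Section OddSlice.
Local Open Scope ring_scope.
Variables (R : realFieldType) (T : finType) (k : nat) (F : {set {set T}}).
Hypotheses (cardT : #|T| = (2 * k).+1) (k_gt1 : (1 < k)%N).
Hypothesis Fk : {in F, forall S : {set T}, #|S| = k}.
Hypothesis cardF : #|F| = 'C(2 * k, k.-1).
Implicit Types (S : {set T}) (x y : T) (f g : {set T} -> R).

Local Notation dotT := (@dot R T setT).
Local Notation downT := (@down R T setT).
Let N : R := 'C((2 * k).+1, k)%:R.
Let M : R := 'C(2 * k, k.-1)%:R.
Let L : R := 'C(2 * k, k)%:R.
Let phi : R := k%:R / (2 * k).+1%:R.

Let n_gt0 : 0 < (2 * k).+1%:R :> R. Proof. by rewrite ltr0n. Qed.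

Lemma card_sets_has x : #|[set S : {set T} | (#|S| == k) && (x \in S)]| = 'C(2 * k, k.-1).
Proof.
have -> : 'C(2 * k, k.-1) = 'C(#|[set~ x]|, k.-1) by rewrite cardsC1 cardT.
rewrite -cards_draws.
rewrite -(card_in_imset (f := fun S => S :\ x)); last first.
  move=> S S'; rewrite !inE => /andP[_ xS] /andP[_ xS'] E.
  by rewrite -(setD1K xS) -(setD1K xS') E.
apply: eq_card => S; apply/imsetP/idP => [[S']|].
  rewrite !inE => /andP[/eqP Sk xS'] ->; rewrite subsetC setCD.
  rewrite sub1set !inE eqxx orbT /=; apply/eqP.
  by move: (cardsD1 x S'); rewrite xS' Sk; lia.
rewrite inE => /andP[]; rewrite subsetC sub1set inE => xS /eqP Sk.
exists (x |: S); last by rewrite setU1K.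
by rewrite !inE eqxx andbT cardsU1 xS Sk; apply/eqP; lia.
Qed.

Lemma card_sets_has_hasnt x y : x != y ->
  #|[set S : {set T} | (#|S| == k) && (x \in S) && (y \notin S)]| = 'C((2 * k).-1, k.-1).
Proof.
move=> xy.
have -> : 'C((2 * k).-1, k.-1) = 'C(#|~: [set x; y]|, k.-1).
  by rewrite cardsCs setCK cardT cards2 xy; congr binomial; lia.
rewrite -cards_draws.
rewrite -(card_in_imset (f := fun S => S :\ x)); last first.
  move=> S S'; rewrite !inE => /andP[/andP[_ xS] _] /andP[/andP[_ xS'] _] E.
  by rewrite -(setD1K xS) -(setD1K xS') E.
apply: eq_card => S; apply/imsetP/idP => [[S']|].
  rewrite !inE => /andP[/andP[/eqP Sk xS'] yS'] ->; rewrite subsetC setCD.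
  rewrite subUset !sub1set !inE eqxx (negPf yS') orbT /=; apply/eqP.
  by move: (cardsD1 x S'); rewrite xS' Sk; lia.
rewrite inE => /andP[]; rewrite subsetC subUset !sub1set !inE => /andP[xS yS] /eqP Sk.
exists (x |: S); last by rewrite setU1K.
rewrite !inE eqxx andbT (negPf yS) (eq_sym y x) (negPf xy) andbT cardsU1 xS Sk.
by apply/eqP; lia.
Qed.

Lemma mul_k_N : k%:R * N = (2 * k).+1%:R * M.
Proof.
rewrite /N /M -!natrM; congr _%:R.
by case: k k_gt1 => // i _; rewrite [LHS]mulnC mulnC -mul_bin_diag mulnC.
Qed.
(** This is also C(2k - 1, k - 1), the number of k-sets that contain a given point and miss another
    one. *)
Let q : R := L / 2.
Let q_gt0 : 0 < q.
Proof. by rewrite divr_gt0 // ltr0n bin_gt0; lia. Qed.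

Let qE x y : x != y ->
  \sum_(S : {set T} | #|S| == k) ((x \in S) && (y \notin S))%:R = q.
Proof.
move=> xy; rewrite /q /L (central_bin_half (ltnW k_gt1)) -(card_sets_has_hasnt xy) natrM mulrAC divff.
  rewrite mul1r -sum1_card natr_sum big_mkcond [RHS]big_mkcond.
  by apply: eq_bigr => S _; rewrite inE -andbA; case: ifP => //=; case: ifP.
by rewrite pnatr_eq0.
Qed.

Let hasE x : \sum_(S : {set T} | #|S| == k) (x \in S)%:R = M.
Proof.
rewrite /M -(card_sets_has x) -sum1_card natr_sum big_mkcond [RHS]big_mkcond.
by apply: eq_bigr => S _; rewrite inE; case: ifP => //=; case: ifP.
Qed.

Definition lin (c : T -> R) S : R := \sum_(x in S) c x.

Lemma up_lin c i S : #|S| = i.+1 -> up (lin c) S = i%:R * lin c S.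
Proof.
move=> Si; rewrite /up /lin.
transitivity (\sum_(y in S) (\sum_(x in S) c x - c y)).
  by apply: eq_bigr => y yS; rewrite [in RHS](big_setD1 y) //= addrC addrK.
by rewrite sumrB sumr_const Si mulrS -[_ *+ i]mulr_natl; ring.
Qed.

Lemma down_lin c S : \sum_x c x = 0 ->
  downT (lin c) S = (#|T|%:R - #|S|%:R - 1) * lin c S.
Proof.
move=> c0; rewrite /down /lin.
transitivity (\sum_(y in setT :\: S) (\sum_(x in S) c x + c y)).
  apply: eq_bigr => y; rewrite inE => /andP[yS _].
  by rewrite big_setU1 //= addrC.
rewrite big_split /= sumr_const cardsD setTI cardsT -[_ *+ (_ - _)]mulr_natl natrB ?max_card //.
have -> : \sum_(i in setT :\: S) c i = - \sum_(x in S) c x; last by ring.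
apply/eqP; rewrite -addr_eq0 addrC; move: c0; rewrite (bigID (mem S)) /= => c0.
rewrite -[X in _ == X]c0; apply/eqP; congr (_ + _).
by apply: eq_bigl => x; rewrite !inE // andbT.
Qed.

Lemma dot1_lin c : \sum_x c x = 0 -> dotT k (fun=> 1) (lin c) = 0.
Proof.
move=> c0; rewrite /dot /lin.
transitivity (\sum_(S : {set T} | #|S| == k) \sum_x c x * (x \in S)%:R).
  apply: eq_big => [S|S _]; first by rewrite subsetT.
  rewrite mul1r big_mkcond; apply: eq_bigr => x _.
  by case: ifP; rewrite ?mulr1 ?mulr0.
rewrite exchange_big /=.
under eq_bigr => x _ do rewrite -mulr_sumr hasE.
by rewrite -mulr_suml c0 mul0r.
Qed.

(** For y other than x, the sets containing both x and y number M - q, for y = x they number M; as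
    the coefficients sum to 0, only q c(x) survives. *)
Lemma dot_above1_lin c x : \sum_x c x = 0 ->
  dotT k (above R [set x]) (lin c) = q * c x.
Proof.
move=> c0; rewrite /dot /lin.
transitivity (\sum_(S : {set T} | #|S| == k)
    \sum_y c y * ((x \in S)%:R - ((x \in S) && (y \notin S))%:R)).
  apply: eq_big => [S|S _]; first by rewrite subsetT.
  rewrite mulr_sumr big_mkcond; apply: eq_bigr => y _.
  by rewrite /above sub1set; case: (x \in S); case: (y \in S) => /=; ring.
rewrite exchange_big /=.
transitivity (\sum_y (c y * M - (if y == x then 0 else c y * q))).
  apply: eq_bigr => y _; rewrite -mulr_sumr sumrB hasE mulrBr; congr (_ - _).
  case: eqVneq => [->|yx]; last by rewrite qE // eq_sym.
  by rewrite big1 ?mulr0 // => S _; case: (x \in S).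
rewrite sumrB -mulr_suml c0 mul0r sub0r; apply/eqP; rewrite eqr_oppLR; apply/eqP.
have := c0; rewrite (bigD1 x) //= => /eqP; rewrite addr_eq0 => /eqP ->.
rewrite mulrN opprK mulr_sumr (bigD1 x) //= eqxx add0r.
by apply: eq_bigr => y yx; rewrite (negPf yx) mulrC.
Qed.

Lemma norm_lin c : \sum_x c x = 0 -> dotT k (lin c) (lin c) = q * \sum_x c x ^+ 2.
Proof.
move=> c0; transitivity (\sum_x c x * dotT k (above R [set x]) (lin c)).
  rewrite /dot; under [RHS]eq_bigr do rewrite mulr_sumr.
  rewrite exchange_big; apply: eq_bigr => S _.
  rewrite {1}/lin mulr_suml [LHS]big_mkcond; apply: eq_bigr => x _ /=.
  by rewrite /above sub1set; case: (x \in S); rewrite ?mul1r ?mul0r ?mulr0.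
rewrite mulr_sumr; apply: eq_bigr => x _.
by rewrite dot_above1_lin //; ring.
Qed.

(** Normalised so that [lin bias] is the projection of the indicator of F onto the linear functions
    with coefficient sum 0. For a star it equals 2k / (2k + 1) at the base point. *)
Definition bias x : R :=
  (#|[set S in F | x \in S]|%:R - phi * M) / q.

Lemma sum_bias : \sum_x bias x = 0.
Proof.
rewrite -mulr_suml sumrB sumr_const cardT -[_ *+ _.+1]mulr_natl.
have -> : \sum_x #|[set S in F | x \in S]|%:R = k%:R * M :> R.
  transitivity (\sum_(S in F) \sum_x (x \in S)%:R : R).
    rewrite exchange_big; apply: eq_bigr => x _.
    rewrite -sum1_card natr_sum big_mkcond [RHS]big_mkcond; apply: eq_bigr => S _.
    by rewrite inE; case: (S \in F); case: (x \in S).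
  rewrite -natrM -cardF mulnC -sum_nat_const natr_sum.
  apply: eq_bigr => S SF; rewrite -(Fk SF) -sum1_card natr_sum [RHS]big_mkcond.
  by apply: eq_bigr => x _; case: (x \in S).
by rewrite /phi mulrA [_ * (_ / _)]mulrC divfK ?gt_eqF // subrr mul0r.
Qed.

Definition rest S : R := ind R F S - phi - lin bias S.
Let f := ind R F.

Lemma dot1_f : dotT k (fun=> 1) f = M.
Proof.
rewrite dotC dot_ind ?sumr_const ?cardF // => S /Fk ->.
by rewrite subsetT eqxx.
Qed.

Lemma phiN : phi * N = M.
Proof. by rewrite /phi mulrAC mul_k_N mulrAC divff ?mul1r ?gt_eqF. Qed.

Lemma dot1_1 : dotT k (fun=> 1) (fun=> 1) = N.
Proof. by rewrite dot_cst cardsT cardT !mulr1. Qed.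

Lemma restE : rest =1 fun S => f S + (- phi) * 1 + (-1) * lin bias S.
Proof. by move=> S; rewrite /rest -/f; ring. Qed.

Lemma dot_rest g : dotT k g rest = 
  dotT k g f + (- phi) * dotT k g (fun=> 1) + (-1) * dotT k g (lin bias).
Proof.
rewrite -!dotZr -!dotDr; apply: eq_dot => // S _ _.
by rewrite restE.
Qed.

Lemma dot1_rest : dotT k (fun=> 1) rest = 0.
Proof.
by rewrite dot_rest dot1_f dot1_1 dot1_lin ?sum_bias // -{1}phiN; ring.
Qed.

Lemma dot_above1_rest x : dotT k (above R [set x]) rest = 0.
Proof.
rewrite dot_rest dot_above1_lin ?sum_bias //.
have -> : dotT k (above R [set x]) f = #|[set S in F | x \in S]|%:R.
  rewrite dotC dot_ind => [|S /Fk ->]; last by rewrite subsetT eqxx.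
  rewrite -sum1_card natr_sum big_mkcond [RHS]big_mkcond; apply: eq_bigr => S _.
  by rewrite inE /above sub1set; case: (S \in F); case: (x \in S).
have -> : dotT k (above R [set x]) (fun=> 1) = M.
  rewrite -(hasE x) /dot; apply: eq_big => [S|S _].
    by rewrite subsetT.
  by rewrite /above sub1set mulr1.
rewrite /bias [q * _]mulrC divfK ?gt_eqF //; ring.
Qed.

Lemma dot_lin_rest c : dotT k (lin c) rest = 0.
Proof.
transitivity (\sum_x c x * dotT k (above R [set x]) rest); last first.
  by rewrite big1 // => x _; rewrite dot_above1_rest mulr0.
rewrite /dot; under [RHS]eq_bigr do rewrite mulr_sumr.
rewrite exchange_big; apply: eq_bigr => S _.
rewrite {1}/lin mulr_suml [LHS]big_mkcond; apply: eq_bigr => x _ /=.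
by rewrite /above sub1set; case: (x \in S); rewrite ?mul1r ?mul0r ?mulr0.
Qed.

Let cst_lin S := phi * 1 + lin bias S.

Lemma fE : f =1 fun S => cst_lin S + rest S.
Proof. by move=> S; rewrite /cst_lin /rest -/f; ring. Qed.

Lemma dot_cst_lin_rest : dotT k cst_lin rest = 0.
Proof.
rewrite (_ : dotT k _ _ = phi * dotT k (fun=> 1) rest + dotT k (lin bias) rest).
  by rewrite dot1_rest dot_lin_rest mulr0 addr0.
by rewrite -dotZl -dotDl.
Qed.

Lemma dot_cst_lin : dotT k cst_lin cst_lin = phi * M + dotT k (lin bias) (lin bias).
Proof.
rewrite /cst_lin !dotDl !dotDr !dotZl !dotZr (dotC _ _ (lin bias) (fun=> 1)).
by rewrite dot1_lin ?sum_bias // dot1_1 phiN; ring.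
Qed.

Lemma dot_rest_rest :
  dotT k rest rest = M - phi * M - dotT k (lin bias) (lin bias).
Proof.
have : dotT k f f = M.
  rewrite dot_ind => [|S /Fk ->]; last by rewrite subsetT eqxx.
  by rewrite /M -cardF -sum1_card natr_sum; apply: eq_bigr => S SF; rewrite /f /ind SF.
rewrite (eq_dot (f' := fun S => cst_lin S + rest S)
  (g' := fun S => cst_lin S + rest S)) => [|S _ _|S _ _]; try exact: fE.
rewrite (dotDl _ _ cst_lin rest) !(dotDr _ _ cst_lin rest) (dotC _ _ rest cst_lin) dot_cst_lin_rest dot_cst_lin.
by move=> E; rewrite -[X in _ = X - _ - _]E; ring.
Qed.

Lemma up_cst_lin S : #|S| = k.+1 ->
  up cst_lin S = k.+1%:R * phi + k%:R * lin bias S.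
Proof.
move=> Sk; rewrite -up_lin // /up /cst_lin big_split /= sumr_const Sk.
by rewrite mulr1 mulr_natl.
Qed.

Lemma down_up_cst_lin S : #|S| = k ->
  downT (up cst_lin) S = k.+1%:R ^+ 2 * phi + k%:R ^+ 2 * lin bias S.
Proof.
move=> Sk; have := down_lin S sum_bias; rewrite cardT Sk => dl.
have -> : downT (up cst_lin) S =
    \sum_(y in setT :\: S) (k.+1%:R * phi) + k%:R * downT (lin bias) S.
  rewrite /down mulr_sumr -big_split; apply: eq_bigr => y.
  by rewrite inE => /andP[yS _]; rewrite /= up_cst_lin // cardsU1 yS Sk.
rewrite sumr_const cardsD setTI cardsT cardT Sk dl.
rewrite (_ : ((2 * k).+1 - k = k.+1)%N); last by lia.
ring.
Qed.

(** [rest] has only components of degree at least 2, where the gap for [down] gives k (k - 2).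
    Passing from [down] to [up] adds (2k + 1) - 2k = 1. *)
Lemma norm_up_rest :
  dotT k.+1 (up rest) (up rest) <= (k%:R - 1) ^+ 2 * dotT k rest rest.
Proof.
have gap := @down_gap R T setT 2 k.-1 rest isT.
rewrite prednK in gap; last by lia.
have {}gap := gap _ _ _; rewrite cardsT cardT in gap.
have : dotT k.-1 (downT rest) (downT rest) <= (k%:R - 2) * k%:R * dotT k rest rest.
  have -> : (k%:R - 2) * k%:R = (k%:R - 2) * ((2 * k).+1%:R - k.-1%:R - 2) :> R.
    by case: k k_gt1 => // i _; rewrite /=; ring.
  apply: gap; [by lia | by [] |].
  move=> P _ [] /eqP/cards1P[x ->]; exact: dot_above1_rest.
have := norm_up setT k.-1 rest; rewrite cardsT cardT prednK => [->|]; last by lia.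
by rewrite -(natr1 (2 * k)) natrM => le; nra.
Qed.

(* Summing [(deg b - k)^2 >= 0] over the complements [b] of the sets outside F. *)
Lemma norm_rest_le :
  (2 * k%:R - 1) * dotT k rest rest <=
    2 * k%:R * (\sum_(u in F) #|[set v in F | v \subset ~: u]|)%:R.
Proof.
set e2 := \sum_(u in F) _.
have upf (b : {set T}) : #|b| = k.+1 -> up f b = #|[set v in F | v \subset b]|%:R.
  by move=> bk; apply: (up_ind _ _ bk) => v /Fk.
(* [up] multiplies squared norms by k^2 on the linear part but by at most (k - 1)^2 on [rest]; the
   difference 2k - 1 is the factor in the conclusion. *)
have nE : dotT k.+1 (up f) (up f) = 
    k%:R * k.+1%:R * M - (k%:R ^+ 2 * dotT k rest rest - dotT k.+1 (up rest) (up rest)).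
  have -> : dotT k.+1 (up f) (up f) = dotT k cst_lin (downT (up cst_lin))
      + dotT k.+1 (up rest) (up rest).
    have fE' (S : {set T}) : S \subset setT -> #|S| = k.+1 -> up f S = up cst_lin S + up rest S.
      by move=> _ _; rewrite /up -big_split; apply: eq_bigr => y _; rewrite fE.
    rewrite (eq_dot fE' fE') (dotDl _ _ (up cst_lin)) !(dotDr _ _ (up cst_lin)).
    have cross : dotT k.+1 (up rest) (up cst_lin) = 0.
      rewrite dot_up_down.
      transitivity (k.+1%:R ^+ 2 * phi * dotT k (fun=> 1) rest
         + k%:R ^+ 2 * dotT k (lin bias) rest).
        rewrite -!dotZl -dotDl dotC; apply: eq_dot => // S _ Sk.
        by rewrite down_up_cst_lin // mulr1.
      by rewrite dot1_rest dot_lin_rest; ring.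
    by rewrite (dotC _ _ (up cst_lin) (up rest)) cross addr0 add0r dot_up_down.
  have -> : dotT k cst_lin (downT (up cst_lin)) =
      k.+1%:R ^+ 2 * phi * M + k%:R ^+ 2 * dotT k (lin bias) (lin bias).
    transitivity (dotT k cst_lin (fun S => k.+1%:R ^+ 2 * (phi * 1) + k%:R ^+ 2 * lin bias S)).
      by apply: eq_dot => // S _ Sk; rewrite down_up_cst_lin // mulr1.
    rewrite dotDr !dotZr /cst_lin !dotDl !dotZl (dotC _ _ (lin bias) (fun=> 1)).
    by rewrite dot1_lin ?sum_bias // dot1_1 phiN; ring.
  rewrite dot_rest_rest.
  have -> : k%:R * k.+1%:R * M = (2 * k).+1%:R * phi * M + k%:R ^+ 2 * M.
    by rewrite /phi [_ * (_ / _)]mulrC divfK ?gt_eqF //; ring.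
  by rewrite -(natr1 (2 * k)) natrM -(natr1 k); ring.
have sq : 0 <= \sum_(S : {set T} | (#|S| == k.+1) && (~: S \notin F)) (up f S - k%:R) ^+ 2.
  by apply: sumr_ge0 => S _; apply: sqr_ge0.
have reF (g : {set T} -> R) :
    \sum_(S : {set T} | (#|S| == k.+1) && (~: S \in F)) g S = \sum_(u in F) g (~: u).
  rewrite (reindex_inj (inv_inj (@setCK T))); apply: eq_bigl => u /=.
  rewrite setCK; case: (boolP (u \in F)) => [/Fk uk|_]; last by rewrite andbF.
  by rewrite cardsCs setCK cardT uk andbT; apply/eqP; lia.
have upper : \sum_(S : {set T} | (#|S| == k.+1) && (~: S \notin F)) (up f S) ^+ 2 <=
    dotT k.+1 (up f) (up f).
  rewrite /dot big_mkcond [leRHS]big_mkcond; apply: ler_sum => S _.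
  rewrite subsetT /= -expr2; case: eqP => //= _; case: ifP => // _.
  exact: sqr_ge0.
have total : \sum_(S : {set T} | #|S| == k.+1) (up f S) = k.+1%:R * M.
  transitivity (dotT k.+1 (up f) (fun=> 1)).
    by apply: eq_big => [S|S _]; rewrite ?subsetT ?mulr1.
  rewrite dot_up_down (eq_dot (f' := f) (g' := fun=> k.+1%:R * 1)) //.
    by rewrite dotZr dotC dot1_f.
  move=> S _ Sk; rewrite /down sumr_const cardsD setTI cardsT cardT Sk mulr1.
  by congr _%:R; lia.
have cardk1 : \sum_(S : {set T} | #|S| == k.+1) 1 = N :> R.
  transitivity (dotT k.+1 (fun=> 1) (fun=> 1)).
    by apply: eq_big => [S|S _]; rewrite ?subsetT ?mulr1.
  rewrite dot_cst cardsT cardT !mulr1 /N -bin_sub; last by lia.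
  by congr ('C(_, _)%:R); lia.
have lower : \sum_(S : {set T} | (#|S| == k.+1) && (~: S \notin F)) (up f S - k%:R) ^+ 2 =
    \sum_(S : {set T} | (#|S| == k.+1) && (~: S \notin F)) (up f S) ^+ 2
    - 2 * k%:R * (k.+1%:R * M - e2%:R) + k%:R ^+ 2 * (N - M).
  have e2E : e2%:R = \sum_(S : {set T} | (#|S| == k.+1) && (~: S \in F)) up f S.
    rewrite reF natr_sum; apply: eq_bigr => u /Fk uk; rewrite upf //.
    by rewrite cardsCs setCK cardT uk; lia.
  have ME : M = \sum_(S : {set T} | (#|S| == k.+1) && (~: S \in F)) 1.
    by rewrite reF sumr_const cardF.
  rewrite -total -cardk1 ME e2E.
  rewrite (bigID (fun S => ~: S \in F) _ (fun S => up f S)) /= addrC addrK.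
  rewrite (bigID (fun S => ~: S \in F) _ (fun S => 1)) /= addrC addrK.
  rewrite !mulr_sumr -sumrB -big_split; apply: eq_bigr => S _ /=; ring.
(* Thanks to k N = (2k + 1) M, all terms in k (k + 1) M cancel and only [rest] and [e2] remain. *)
have := mul_k_N; rewrite -(natr1 (2 * k)) natrM => kN.
have := norm_up_rest; move: sq upper; rewrite lower nE -(natr1 k) => sq upper le.
have kN2 : k%:R ^+ 2 * N = k%:R * ((2 * k%:R + 1) * M) by rewrite -kN; ring.
by lra.
Qed.

(** * Variation of a family under disjoint transpositions *)

Definition pair_diff (c : T -> R) (p : T * T) : R := c p.1 - c p.2.
Definition pair_sign (p : T * T) S : R := (p.1 \in S)%:R - (p.2 \in S)%:R.
Definition pair_lin c (ps : seq (T * T)) S : R :=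
  \sum_(p <- ps) pair_diff c p * pair_sign p S.
Definition disjoint_pairs (ps : seq (T * T)) : bool :=
  uniq (flatten [seq [:: p.1; p.2] | p <- ps]).
Definition swap_pairs (ps : seq (T * T)) : {perm T} :=
  (\prod_(p <- ps) tperm p.1 p.2)%g.

Lemma sum_perm (s : {perm T}) g :
  \sum_(S : {set T} | #|S| == k) g (s @: S) = \sum_(S : {set T} | #|S| == k) g S.
Proof.
rewrite [RHS](reindex_inj (imset_inj (@perm_inj _ s))).
by apply: eq_bigl => S; rewrite card_imset //; apply: perm_inj.
Qed.

Lemma sum_pair_sign2 p : p.1 != p.2 ->
  \sum_(S : {set T} | #|S| == k) pair_sign p S ^+ 2 = L.
Proof.
move=> p12; rewrite [RHS](_ : L = q + q); last by rewrite /q; lra.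
rewrite -{1}(qE p12) -(qE (x := p.2) (y := p.1)) 1?eq_sym // -big_split /=.
apply: eq_bigr => S _; rewrite /pair_sign.
by case: (p.1 \in S); case: (p.2 \in S) => /=; ring.
Qed.

Lemma pair_sign_tperm x y S :
  pair_sign (x, y) (tperm x y @: S) = - pair_sign (x, y) S.
Proof.
have E z : (tperm x y z \in tperm x y @: S) = (z \in S).
  by rewrite mem_imset //; apply: perm_inj.
have := E y; have := E x; rewrite tpermL tpermR /pair_sign /= => -> ->.
by rewrite opprB.
Qed.

Lemma pair_lin_tperm c x y ps S : disjoint_pairs ((x, y) :: ps) ->
  pair_lin c ps (tperm x y @: S) = pair_lin c ps S.
Proof.
rewrite /disjoint_pairs /= inE negb_or => /andP[/andP[_ xps] /andP[yps _]].
apply: eq_big_seq => p pps; congr (_ * _).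
have inps z : z \in [:: p.1; p.2] -> z \in flatten [seq [:: p.1; p.2] | p <- ps].
  by move=> zp; apply/flatten_mapP; exists p.
have fix_mem z : z \in [:: p.1; p.2] -> (z \in tperm x y @: S) = (z \in S).
  move=> /inps zps; have {1}<- : tperm x y z = z.
    by rewrite tpermD //; [apply: contraNneq xps | apply: contraNneq yps] => ->.
  by rewrite mem_imset //; apply: perm_inj.
by rewrite /pair_sign !fix_mem // !inE eqxx ?orbT.
Qed.

Lemma pair_lin_moments c ps : disjoint_pairs ps ->
  let D := \sum_(p <- ps) pair_diff c p ^+ 2 in
  \sum_(S : {set T} | #|S| == k) pair_lin c ps S ^+ 2 = L * D /\
  \sum_(S : {set T} | #|S| == k) pair_lin c ps S ^+ 4 <= 3 * L * D ^+ 2.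
Proof.
elim: ps => [|[x y] ps IH] dps /=.
  rewrite big_nil !expr2 !mulr0.
  by split; rewrite big1 // => S _; rewrite /pair_lin big_nil expr0n.
have /IH[/=] : disjoint_pairs ps.
  by move: dps; rewrite /disjoint_pairs /= => /and3P[].
set D := \sum_(p <- ps) _ => m2 m4; rewrite big_cons -/D.
set d := pair_diff c (x, y); pose t S := pair_sign (x, y) S; pose g S := pair_lin c ps S.
have gE S : pair_lin c ((x, y) :: ps) S = d * t S + g S by rewrite /pair_lin big_cons.
have xy : x != y.
  by move: dps; rewrite /disjoint_pairs /= inE negb_or => /andP[/andP[]].
have t2 : \sum_(S : {set T} | #|S| == k) t S ^+ 2 = L by apply: sum_pair_sign2.
have symm n : \sum_(S : {set T} | #|S| == k) pair_lin c ((x, y) :: ps) S ^+ n =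
    \sum_(S : {set T} | #|S| == k) (g S - d * t S) ^+ n.
  rewrite -(sum_perm (tperm x y)); apply: eq_bigr => S _; rewrite gE.
  by rewrite /t pair_sign_tperm /g pair_lin_tperm // mulrN addrC.
have tt S : t S ^+ 4 = t S ^+ 2 /\ t S ^+ 2 <= 1.
  rewrite /t /pair_sign; case: (_ \in S); case: (_ \in S) => /=; split; lra.
split.
  have : 2 * \sum_(S : {set T} | #|S| == k) pair_lin c ((x, y) :: ps) S ^+ 2 = 
      2 * (L * (d ^+ 2 + D)).
    rewrite mulrDl mul1r {1}symm -big_split /=.
    rewrite (mulrDr L) -{}m2 -{}t2 mulr_suml -big_split mulr_sumr.
    by apply: eq_bigr => S _; rewrite gE -/(g S) /=; ring.
  by move=> E; lra.
have : 2 * \sum_(S : {set T} | #|S| == k) pair_lin c ((x, y) :: ps) S ^+ 4 <=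
    2 * (\sum_(S : {set T} | #|S| == k) pair_lin c ps S ^+ 4 
      + 6 * d ^+ 2 * \sum_(S : {set T} | #|S| == k) pair_lin c ps S ^+ 2
      + d ^+ 4 * \sum_(S : {set T} | #|S| == k) t S ^+ 2).
  rewrite mulrDl mul1r {1}symm -big_split /= !mulr_sumr -!big_split mulr_sumr /=.
  apply: ler_sum => S _; rewrite gE -/(g S); have [t4 t1] := tt S.
  have : g S ^+ 2 * d ^+ 2 * t S ^+ 2 <= g S ^+ 2 * d ^+ 2 * 1.
    by apply: ler_wpM2l t1; rewrite mulr_ge0 ?sqr_ge0.
  have : d ^+ 4 * t S ^+ 4 = d ^+ 4 * t S ^+ 2 by rewrite t4.
  by lra.
rewrite m2 t2 => le.
have L0 : 0 <= L by apply: ler0n.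
have d4 : 0 <= L * d ^+ 4 by rewrite mulr_ge0 // exprn_even_ge0.
by lra.
Qed.

Lemma sub_swap_pairs c ps x : disjoint_pairs ps ->
  c x - c (swap_pairs ps x) =
  \sum_(p <- ps) pair_diff c p * ((x == p.1)%:R - (x == p.2)%:R).
Proof.
rewrite /swap_pairs; elim: ps x => [|[y z] ps IH] x dps.
  by rewrite !big_nil perm1 subrr.
rewrite !big_cons permM /=.
move: dps; rewrite /disjoint_pairs /= inE negb_or => /andP[/andP[yz yps] /andP[zps dps]].
have fresh w : w \notin flatten [seq [:: p.1; p.2] | p <- ps] ->
    \sum_(p <- ps) pair_diff c p * ((w == p.1)%:R - (w == p.2)%:R) = 0.
  move=> wps; rewrite big_seq big1 // => p pps.
  have wp v : v \in [:: p.1; p.2] -> (w == v) = false.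
    move=> vp; apply: contraNF wps => /eqP ->; apply/flatten_mapP; by exists p.
  by rewrite !wp ?inE ?eqxx ?orbT // subrr mulr0.
have fixed w : w \notin flatten [seq [:: p.1; p.2] | p <- ps] ->
    c w - c ((\prod_(p <- ps) tperm p.1 p.2)%g w) = 0.
  by move=> wps; rewrite IH // fresh.
case: (tpermP y z x) => [->|->|/eqP xy /eqP xz].
- rewrite eqxx (negPf yz) fresh // -(fixed z) //= /pair_diff /=.
  by have := fixed z zps; lra.
- rewrite eqxx eq_sym (negPf yz) fresh // /pair_diff /=.
  by have := fixed y yps; lra.
- by rewrite IH // (negPf xy) (negPf xz) subrr mulr0 add0r.
Qed.

Lemma lin_swap_pairs c ps S : disjoint_pairs ps ->
  lin c S - lin c (swap_pairs ps @: S) = pair_lin c ps S.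
Proof.
move=> dps; rewrite /lin big_imset /=; last by move=> x y _ _ /perm_inj.
rewrite -sumrB; under eq_bigr do rewrite sub_swap_pairs //.
rewrite exchange_big; apply: eq_bigr => p _; rewrite -mulr_sumr; congr (_ * _).
rewrite sumrB /pair_sign.
have E z : \sum_(x in S) (x == z)%:R = (z \in S)%:R :> R.
  have [zS|zS] := boolP (z \in S).
    by rewrite (bigD1 z) //= eqxx big1 ?addr0 // => x /andP[_ /negPf ->].
  by rewrite big1 // => x xS; case: eqP => // xz; rewrite -xz xS in zS.
by rewrite !E.
Qed.

(* A [{-1, 0, 1}]-valued function [h] is at distance at least
   [g ^ 2 - 4 g ^ 4] from [g]; here [h] and [g] are the variations of the
   indicator of F and of its linear part under the swaps, and [g] has a small
   fourth moment. *)
Lemma norm_rest_ge ps : disjoint_pairs ps ->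
  let D := \sum_(p <- ps) pair_diff bias p ^+ 2 in
  L * (D - 12 * D ^+ 2) <= 4 * dotT k rest rest.
Proof.
move=> dps; set D := \sum_(p <- ps) _ => /=.
have [m2 m4] := pair_lin_moments bias dps; rewrite -/D in m2 m4.
set s := swap_pairs ps; set g := pair_lin bias ps in m2 m4 *.
have restsq : \sum_(S : {set T} | #|S| == k) rest S ^+ 2 = dotT k rest rest.
  by apply: eq_big => S; rewrite ?subsetT ?expr2.
have : \sum_(S : {set T} | #|S| == k) (g S ^+ 2 - 4 * g S ^+ 4) <=
    \sum_(S : {set T} | #|S| == k) (2 * rest S ^+ 2 + 2 * rest (s @: S) ^+ 2).
  apply: ler_sum => S _; have := lin_swap_pairs bias S dps; rewrite -/g -/s => gE.
  have : rest S - rest (s @: S) = f S - f (s @: S) - g S by rewrite -gE /rest -/f; ring.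
  set r := rest S; set r' := rest _; move: (g S) => z E.
  (* With h the variation of the indicator, h = 0 is immediate. For h = 1 the claim is 4 z^4 - 2 z +
     1 >= 0, and the left side is (2 z^2 - 1/2)^2 + 2 (z - 1/2)^2 + 1/4; h = -1 is symmetric. *)
  suff : z ^+ 2 - 4 * z ^+ 4 <= (r - r') ^+ 2.
    by have := sqr_ge0 (r + r'); lra.
  have := sqr_ge0 (2 * z ^+ 2 - 2^-1); have := sqr_ge0 (z ^+ 2).
  have := sqr_ge0 (z - 2^-1); have := sqr_ge0 (z + 2^-1).
  by rewrite E /f /ind; case: (_ \in F); case: (_ \in F) => /=; lra.
rewrite sumrB big_split /= -!mulr_sumr (sum_perm s (fun S => rest S ^+ 2)) restsq m2.
by lra.
Qed.

(** Stop at the first prefix that reaches [eps]: its last weight overshoots by at most [eps]. This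
    brings D into a range where D - 12 D^2 is bounded below. *)
Lemma prefix_sum (ps : seq (T * T)) (w : T * T -> R) (eps : R) :
    (forall p, p \in ps -> w p <= eps) -> eps <= \sum_(p <- ps) w p -> 0 <= eps ->
  exists ps1 ps2, ps = ps1 ++ ps2 /\
    eps <= \sum_(p <- ps1) w p /\ \sum_(p <- ps1) w p <= 2 * eps.
Proof.
move=> wle sle eps0; elim/last_ind: ps wle sle => [|ps p IH] wle.
  by rewrite big_nil => le0; exists [::], [::]; rewrite big_nil; split => //; split; lra.
rewrite -cats1 big_cat big_seq1 /= => sle.
have [le|lt] := lerP eps (\sum_(p <- ps) w p).
  have [|ps1 [ps2 [E le12]]] := IH _ le.
    by move=> r rps; apply: wle; rewrite mem_rcons inE rps orbT.
  by exists ps1, (ps2 ++ [:: p]); rewrite E catA.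
exists (ps ++ [:: p]), [::]; rewrite cats0 big_cat big_seq1 /=; split => //; split => //.
have := wle p; rewrite mem_rcons mem_head => /(_ isT); lra.
Qed.

(* The classes [x + y = s] of an indexing of [T] by [Z / n] split all pairs
   into [n] matchings; take the best one. *)
Lemma good_matching (c : T -> R) : \sum_x c x = 0 ->
  exists2 ps, disjoint_pairs ps & \sum_x c x ^+ 2 <= \sum_(p <- ps) pair_diff c p ^+ 2.
Proof.
move=> c0; set n := (2 * k)%N.
pose e (i : 'I_n.+1) : T := enum_val (cast_ord (esym cardT) i).
have e_inj : injective e by move=> i j /enum_val_inj/cast_ord_inj.
have sume (g : T -> R) : \sum_x g x = \sum_i g (e i).
  apply: reindex; exists (fun x => cast_ord cardT (enum_rank x)) => [i _|x _].
    by rewrite /e enum_valK cast_ordKV.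
  by rewrite /e cast_ordK enum_rankK.
have [lt ltE] : {lt : rel 'I_n.+1 | forall i j, lt i j = (i < j)%N} by exists (fun i j => i < j)%N.
have ltNlt i j : lt i j -> ~~ lt j i by rewrite !ltE -leqNgt => /ltnW.
(* Subtraction is modulo 2k + 1. The order condition keeps one orientation of each pair {i, s - i}
   and drops the index with i = s - i. *)
pose P (s : 'I_n.+1) := [seq (e i, e (s - i)) | i : 'I_n.+1 <- enum 'I_n.+1 & lt i (s - i)].
have dP s : disjoint_pairs (P s).
  rewrite /disjoint_pairs /P -map_comp.
  rewrite (_ : flatten _ = [seq e i | i <- flatten
      [seq [:: i; s - i] | i : 'I_n.+1 <- enum 'I_n.+1 & lt i (s - i)]]); last first.
    by rewrite map_flatten -map_comp.
  rewrite map_inj_uniq //.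
  have : uniq [seq i : 'I_n.+1 <- enum 'I_n.+1 | lt i (s - i)] by rewrite filter_uniq ?enum_uniq.
  have : all (fun i : 'I_n.+1 => lt i (s - i)) [seq i : 'I_n.+1 <- enum 'I_n.+1 | lt i (s - i)].
    exact: filter_all.
  elim: [seq _ <- _ | _] => //= i r IH /andP[si rs] /andP[ir ur].
  rewrite IH // andbT inE negb_or -andbA; apply/and3P; split.
  - by apply: contraTneq si => <-; rewrite ltE ltnn.
  - apply/flatten_mapP => -[j jr]; rewrite !inE => /orP[/eqP ij|/eqP ij].
      by rewrite ij jr in ir.
    by have := ltNlt _ _ (allP rs j jr); rewrite -ij; move: si; rewrite ij subKr => ->.
  - apply/flatten_mapP => -[j jr]; rewrite !inE => /orP[/eqP ij|/eqP ij].
      by have := ltNlt _ _ (allP rs j jr); rewrite -ij subKr si.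
    by rewrite (subrI _ ij) jr in ir.
(* Each unordered pair lies in exactly one class, and since c sums to 0 the squared differences over
   all pairs add up to (2k + 1) times the sum of the c(x)^2. *)
have sumP : \sum_s \sum_(p <- P s) pair_diff c p ^+ 2 = n.+1%:R * \sum_x c x ^+ 2.
  have -> : \sum_s \sum_(p <- P s) pair_diff c p ^+ 2 =
      \sum_(i : 'I_n.+1) \sum_(j : 'I_n.+1 | lt i j) (c (e i) - c (e j)) ^+ 2.
    transitivity (\sum_(s : 'I_n.+1) \sum_(i : 'I_n.+1 | lt i (s - i))
        (c (e i) - c (e (s - i))) ^+ 2).
      by apply: eq_bigr => s _; rewrite /P big_map big_filter big_enum_cond.
    rewrite (exchange_big_dep xpredT) //=; apply: eq_bigr => i _.
    by rewrite (reindex_inj (addrI i)) /=; apply: eq_big => [j|j _]; rewrite (addrC i) addrK.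
  set X := \sum_i _.
  have : X + X = 2 * (n.+1%:R * \sum_x c x ^+ 2); last by lra.
  have -> : X + X = \sum_(i : 'I_n.+1) \sum_(j : 'I_n.+1) (c (e i) - c (e j)) ^+ 2.
    rewrite {2}/X (exchange_big_dep xpredT) //= -big_split; apply: eq_bigr => i _ /=.
    rewrite [RHS](bigID (lt i)) /=; congr (_ + _).
    rewrite [RHS](bigD1 i) ?ltE ?ltnn //= subrr expr0n add0r.
    apply: eq_big => [j|j _]; last by rewrite -sqrrN opprB.
    by rewrite !ltE -leqNgt ltn_neqAle andbC.
  transitivity (\sum_(i : 'I_n.+1) (n.+1%:R * c (e i) ^+ 2 + \sum_j c (e j) ^+ 2)).
    apply: eq_bigr => i _; transitivity (\sum_(j : 'I_n.+1) (c (e i) ^+ 2 + c (e j) ^+ 2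
      + (- 2 * c (e i)) * c (e j))); first by apply: eq_bigr => j _; ring.
    have z : \sum_(j : 'I_n.+1) (- 2 * c (e i)) * c (e j) = 0.
      by rewrite -mulr_sumr -sume c0 mulr0.
    by rewrite !big_split /= z addr0 sumr_const card_ord mulr_natl.
  rewrite big_split /= -mulr_sumr sumr_const card_ord -(sume (fun x => c x ^+ 2)).
  by rewrite -mulr_natl; ring.
have [s sP|no] := pickP (fun s => \sum_x c x ^+ 2 <= \sum_(p <- P s) pair_diff c p ^+ 2).
  by exists (P s).
have : \sum_s \sum_(p <- P s) pair_diff c p ^+ 2 < \sum_(s < n.+1) \sum_x c x ^+ 2.
  apply: ltr_sum => [|s _]; last by rewrite ltNge no.
  by apply/hasP; exists ord0; rewrite ?mem_index_enum.
by rewrite sumP sumr_const card_ord mulr_natl ltxx.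
Qed.

(** If every |bias| is at most 1/14, squared differences are at most 1/49 < 1/48, so pairs can be
    selected with D between 1/48 and 1/24. There D - 12 D^2 >= 1/64, hence L / 64 <= 4 |rest|^2 <= 8
    e2, against 512 e2 < L. *)
Lemma large_bias :
  512 * (\sum_(u in F) #|[set v in F | v \subset ~: u]|)%:R < L ->
  exists x, 14^-1 < `|bias x|.
Proof.
set e2 := (\sum_(u in F) _)%:R => e2lt.
have [x xb|no] := pickP (fun x => 14^-1 < `|bias x|); first by exists x.
have L_gt0 : 0 < L by rewrite ltr0n bin_gt0; lia.
have k2 : 2 <= k%:R :> R by rewrite ler_nat.
have restle : dotT k rest rest <= 2 * e2.
  have := norm_rest_le; rewrite -/e2 => le.
  have e20 : 0 <= e2 by apply: ler0n.
  rewrite -(ler_pM2l (x := 2 * k%:R - 1)); last by lra.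
  apply: le_trans le _; rewrite -subr_ge0 in k2.
  have := mulr_ge0 e20 k2; lra.
have [ps dps] := good_matching sum_bias.
have sq : \sum_x bias x ^+ 2 = (M - phi * M - dotT k rest rest) / q.
  by rewrite dot_rest_rest norm_lin ?sum_bias // opprB addrC subrK mulrC mulKf ?gt_eqF.
have sq_ge : 48^-1 <= \sum_x bias x ^+ 2.
  have kL : k%:R * L = k.+1%:R * M.
    rewrite /L /M -!natrM; congr _%:R; case: k k_gt1 => // i _.
    by rewrite mul_bin_left /=; congr (_ * _)%N; lia.
  have phiE : phi * (2 * k%:R + 1) = k%:R.
    by rewrite /phi -(natr1 (2 * k)) natrM divfK // -natrM natr1 gt_eqF.
  rewrite sq ler_pdivlMr // /q.
  have E : (2 * k%:R + 1) * (M - phi * M) = k%:R * L.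
    transitivity ((2 * k%:R + 1) * M - (phi * (2 * k%:R + 1)) * M); first by ring.
    by rewrite phiE kL -(natr1 k); ring.
  have : (2 / 5) * L <= M - phi * M; last by lra.
  by rewrite -(ler_pM2l (x := 2 * k%:R + 1)) ?E; nra.
move=> /(le_trans sq_ge) D_ge.
have small p : p \in ps -> pair_diff bias p ^+ 2 <= 48^-1.
  move=> _; rewrite /pair_diff.
  have := no p.1; have := no p.2; rewrite !ltNge => /negbFE + /negbFE.
  rewrite !ler_norml => /andP[a1 a2] /andP[b1 b2].
  set z := _ - _; have z1 : z <= 7^-1 by rewrite /z; lra.
  have z2 : - 7^-1 <= z by rewrite /z; lra.
  nra.
have eps0 : 0 <= 48^-1 :> R by rewrite invr_ge0 ler0n.
have [ps1 [ps2 [psE [D1 D2]]]] := prefix_sum small D_ge eps0.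
have dps1 : disjoint_pairs ps1.
  by move: dps; rewrite /disjoint_pairs psE map_cat flatten_cat cat_uniq => /andP[].
have := norm_rest_ge dps1 => /=; set D := \sum_(p <- ps1) _ in D1 D2 *.
have D12 : 64^-1 <= D - 12 * D ^+ 2.
  have := mulr_ge0 (_ : 0 <= D - 48^-1) (_ : 0 <= 24^-1 - D).
  rewrite !subr_ge0 => /(_ D1) H; have {}H := H ltac:(lra); lra.
have := ler_wpM2l (ltW L_gt0) D12; lra.
Qed.

End OddSlice.

Lemma mul_bin_central k : (0 < k)%N -> (k * 'C(2 * k, k) = k.+1 * 'C(2 * k, k.-1))%N.
Proof. by case: k => // i _; rewrite mul_bin_left /=; congr (_ * _)%N; lia. Qed.

(** The constant is 1/30 = 1/2 - 7/15. *)
Lemma loss_arith (R : realFieldType) (k a s l L : nat) :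
    (0 < L)%N -> (15 * a <= 7 * L)%N -> (s + l = k * a)%N ->
    (s%:R <= a%:R * (k%:R - 2^-1 + a%:R / L%:R) :> R)%R -> (a <= 30 * l)%N.
Proof.
move=> L0 small sl.
have L_gt0 : (0 < L%:R :> R)%R by rewrite ltr0n.
have frac : (a%:R / L%:R <= 7 / 15 :> R)%R.
  by rewrite ler_pdivrMr // mulrAC ler_pdivlMr // -!natrM ler_nat mulnC.
have {}sl : (s%:R = k%:R * a%:R - l%:R :> R)%R by rewrite -natrM -sl natrD addrK.
rewrite sl => le.
have := ler_wpM2l (ler0n R a) frac => le'.
by rewrite -(ler_nat R) natrM; lra.
Qed.

(** [a] and [b] count the members of F inside and outside the star. A positive bias gives b / L <=
    1/2 - 1/28 = 13/28. A negative one would give b / L > 14/29 + 1/28, which exceeds 513/1024; k >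
    13 serves to get k / (2k + 1) >= 14/29. *)
Lemma bias_arith (R : realFieldType) (k a b L M : nat) :
    (13 < k)%N -> (a + b = M)%N -> (1024 * b <= 513 * L)%N ->
    (k * L = k.+1 * M)%N -> (0 < L)%N ->
    (14^-1 < `|(a%:R - k%:R / (2 * k).+1%:R * M%:R) / (L%:R / 2)| :> R)%R ->
  (28 * b <= 13 * L)%N.
Proof.
move=> k13 FA i2 kML L_gt0 xb.
have {}L_gt0 : (0 < L%:R :> R)%R by rewrite ltr0n.
have k14 : (14 <= k%:R :> R)%R by rewrite ler_nat.
have {}FA : (a%:R + b%:R = M%:R :> R)%R by rewrite -natrD FA.
have {}i2 : (1024 * b%:R <= 513 * L%:R :> R)%R by rewrite -!natrM ler_nat.
have {}kML : (k%:R * L%:R = (k%:R + 1) * M%:R :> R)%R by rewrite natr1 -!natrM kML.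
rewrite -(ler_nat R) !natrM; move: xb; rewrite -(natr1 (2 * k)%N) natrM => xb.
set y := ((_ - _) / _)%R in xb.
have yE : (y * (L%:R / 2) = a%:R - k%:R / (2 * k%:R + 1) * M%:R)%R.
  by rewrite /y divfK // gt_eqF // divr_gt0.
set z := (k%:R / (2 * k%:R + 1))%R in yE.
have zE : (z * (2 * k%:R + 1) = k%:R)%R by rewrite /z divfK // gt_eqF //; lra.
have zM : (M%:R - z * M%:R = z * L%:R)%R.
  have p : (k%:R + 1 != 0 :> R)%R by rewrite gt_eqF //; lra.
  apply: (mulfI p).
  transitivity (k%:R * L%:R - z * (k%:R * L%:R))%R; first by rewrite kML; ring.
  by transitivity (z * (2 * k%:R + 1) * L%:R - z * (k%:R * L%:R))%R; [rewrite zE | ring].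
have zb : (z <= 2^-1)%R by nra.
have zb2 : (29^-1 * 14 <= z)%R by nra.
have [y0|y0] := lerP 0%R y.
  move: xb; rewrite ger0_norm // => xb.
  have : (14^-1 * (L%:R / 2) < y * (L%:R / 2))%R by rewrite ltr_pM2r // divr_gt0.
  rewrite yE; have := ler_wpM2r (ltW L_gt0) zb; lra.
move: xb; rewrite ltr0_norm // => xb.
have : (14^-1 * (L%:R / 2) < - y * (L%:R / 2))%R by rewrite ltr_pM2r // divr_gt0.
rewrite mulNr yE; have := ler_wpM2r (ltW L_gt0) zb2; lra.
Qed.

(** * Edges between a star and its complement *)

Section KneserGraph.
Variables k n : nat.
Hypothesis nE : n = (2 * k + 1)%N.
Notation V := (ksubset n k).
Implicit Types (u v w : V) (A B : {set V}) (x : 'I_n).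

Definition nbrs u : {set V} := [set v : V | [disjoint val u & val v]].

Lemma card_ksubset_val (P : pred {set 'I_n}) :
  #|[set v : V | P (val v)]| = #|[set S : {set 'I_n} | P S & #|S| == k]|.
Proof.
rewrite -(card_imset _ val_inj); apply: eq_card => S; apply/imsetP/idP.
  by case=> v; rewrite !inE => Pv ->; rewrite Pv (valP v).
rewrite inE => /andP[PS Sk]; exists (Sub S Sk : V); rewrite ?inE SubK //.
Qed.

Lemma card_val u : #|val u| = k. Proof. exact/eqP/(valP u). Qed.

Lemma card_valC u : #|~: val u| = k.+1.
Proof. by rewrite cardsCs setCK card_ord card_val nE; lia. Qed.

Lemma nbrs_sym u v : (u \in nbrs v) = (v \in nbrs u).
Proof. by rewrite !inE disjoint_sym. Qed.

Lemma card_nbrs u : #|nbrs u| = k.+1.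
Proof.
rewrite /nbrs (card_ksubset_val (fun S => [disjoint val u & S])) -[RHS]binSn -(card_valC u) -cards_draws.
by apply: eq_card => S; rewrite !inE disjoint_sym disjoints_subset.
Qed.

Lemma card_nbrs_star x u : u \notin star k x -> #|nbrs u :&: star k x| = k.
Proof.
rewrite inE => xu; apply/eqP.
rewrite -(eqn_add2r #|nbrs u :\: star k x|) cardsID card_nbrs.
have -> : nbrs u :\: star k x =
    [set v : V | (val v \subset ~: val u :\ x)].
  apply/setP => v; rewrite !inE disjoint_sym disjoints_subset subsetD1.
  by rewrite andbC.
rewrite (card_ksubset_val (fun S => S \subset ~: val u :\ x)).
have -> : #|[set S : {set 'I_n} | S \subset ~: val u :\ x & #|S| == k]| = 1%N.
  rewrite cards_draws -(binn k); congr binomial.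
  by have := cardsD1 x (~: val u); rewrite card_valC inE xu add1n => -[<-].
by rewrite addn1.
Qed.

Lemma nbrs_star x u : u \in star k x -> nbrs u \subset ~: star k x.
Proof.
rewrite inE => xu; apply/subsetP => v; rewrite !inE => uv.
by apply/negP => xv; move: (disjointFr uv xu); rewrite xv.
Qed.

(** Two distinct k-sets cover at least k + 1 of the 2k + 1 points, leaving room for at most one
    k-set. *)
Lemma card_nbrs_common u v : u != v -> (#|nbrs u :&: nbrs v| <= 1)%N.
Proof.
move=> uv; have -> : nbrs u :&: nbrs v = [set w : V | val w \subset ~: (val u :|: val v)].
  apply/setP => w; rewrite !inE ![[disjoint _ & val w]]disjoint_sym.
  by rewrite !disjoints_subset setCU subsetI.
rewrite (card_ksubset_val (fun S => S \subset ~: (val u :|: val v))) cards_draws.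
have lt : (k < #|val u :|: val v|)%N.
  rewrite -{1}(card_val u) proper_card // properE subsetUl /=.
  apply: contraNN uv => /(subset_trans (subsetUr _ _)) vu.
  by rewrite -val_eqE eq_sym eqEcard vu !card_val /=.
rewrite cardsCs setCK card_ord.
have le : (n - #|val u :|: val v| <= k)%N by lia.
move: le; rewrite leq_eqVlt => /predU1P[->|?]; first by rewrite binn.
by rewrite bin_small.
Qed.

Lemma card_ksubset : #|{: V}| = 'C((2 * k).+1, k).
Proof.
rewrite -cardsT -[setT](_ : [set v : V | true] = _).
  rewrite (card_ksubset_val xpredT) -(addn1 (2 * k)) -nE -[X in 'C(X, k)]card_ord.
  by rewrite -cardsT -cards_draws; apply: eq_card => S; rewrite !inE subsetT.
by apply/setP => v; rewrite !inE.
Qed.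

Lemma card_starC x : #|~: star k x| = 'C(2 * k, k).
Proof.
have -> : ~: star k x = [set v : V | val v \subset [set~ x]].
  by apply/setP => v; rewrite !inE subsetC sub1set inE.
rewrite (card_ksubset_val (fun S => S \subset [set~ x])) cards_draws cardsC1.
by rewrite card_ord nE addn1.
Qed.

Lemma card_star x : (0 < k)%N -> #|star k x| = 'C(2 * k, k.-1).
Proof.
move=> k_gt0; apply/eqP; rewrite -(eqn_add2r #|~: star k x|) cardsC card_ksubset.
by rewrite card_starC; case: k k_gt0 => // i _; rewrite binS addnC.
Qed.

(** The Kneser edges that must be absent when all present neighbours of A in the star lie in B. *)
Definition lost x A B : nat := \sum_(v in A) #|nbrs v :&: star k x :\: B|.

Lemma sum_nbrs_lost x A B : A \subset ~: star k x -> B \subset star k x ->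
  (\sum_(v in A) #|nbrs v :&: B| + lost x A B = k * #|A|)%N.
Proof.
move=> AL BR; rewrite mulnC -sum_nat_const -big_split; apply: eq_bigr => v vA /=.
have vx : v \notin star k x by move: (subsetP AL v vA); rewrite inE.
rewrite -[RHS](card_nbrs_star vx) -(cardsID B (nbrs v :&: star k x)).
by rewrite -setIA (setIidPr BR).
Qed.

Lemma sum_nbrs_swap A B :
  (\sum_(v in A) #|nbrs v :&: B| = \sum_(u in B) #|nbrs u :&: A|)%N.
Proof.
transitivity (\sum_(v in A) \sum_(u in B) (u \in nbrs v))%N.
  apply: eq_bigr => v _; rewrite -sum1_card big_mkcond [RHS]big_mkcond.
  by apply: eq_bigr => u _; rewrite !inE andbC; case: (u \in B); case: [disjoint _ & _].
rewrite exchange_big; apply: eq_bigr => u _.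
rewrite -sum1_card big_mkcond [RHS]big_mkcond; apply: eq_bigr => v _.
rewrite nbrs_sym !inE andbC; by case: (v \in A); case: [disjoint _ & _].
Qed.

Lemma card_val_image (F : {set V}) : #|val @: F| = #|F|.
Proof. by rewrite card_imset //; apply: val_inj. Qed.

(** Complementing the members of B turns disjointness into inclusion, so A and B become families in
    layers k and k + 1 of the 2k points other than x. *)
Lemma lost_ge_isop x A B : (0 < k)%N -> A \subset ~: star k x -> B \subset star k x ->
  (#|B| <= #|A|)%N -> (15 * #|A| <= 7 * 'C(2 * k, k))%N -> (#|A| <= 30 * lost x A B)%N.
Proof.
move=> k_gt0 AL BR BA small.
have cG : #|[set~ x]| = (2 * k)%N by rewrite cardsC1 card_ord nE; lia.
pose B' := [set ~: val r | r in B].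
have cB' : #|B'| = #|B| by rewrite card_imset //; apply: inj_comp; [apply: setC_inj | apply: val_inj].
have A'k : {in val @: A, forall S : {set 'I_n}, (S \subset [set~ x]) && (#|S| == k)}.
  move=> _ /imsetP[v vA ->]; rewrite card_val eqxx andbT subsetC sub1set inE.
  by have := subsetP AL v vA; rewrite !inE.
have B'k : {in B', forall S : {set 'I_n}, (S \subset [set~ x]) && (#|S| == k.+1)}.
  move=> _ /imsetP[r rB ->]; rewrite card_valC eqxx andbT setCS sub1set.
  by have := subsetP BR r rB; rewrite !inE.
have := @incidence_le rat _ [set~ x] k cG k_gt0 _ B' A'k B'k.
rewrite card_val_image cB' => /(_ BA).
have -> : (\sum_(b in B') #|[set v in val @: A | v \subset b]| =
    \sum_(v in A) #|nbrs v :&: B|)%N.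
  rewrite sum_nbrs_swap big_imset /=; last first.
    by move=> r r' _ _ /setC_inj/val_inj.
  apply: eq_bigr => r _; rewrite -(card_val_image (nbrs r :&: A)); apply: eq_card => S.
  rewrite inE; apply/andP/imsetP => [[/imsetP[v vA ->] vr]|[v]].
    by exists v; rewrite // !inE vA andbT disjoint_sym disjoints_subset.
  rewrite !inE => /andP[rv vA] ->; split; first by apply/imsetP; exists v.
  by rewrite -disjoints_subset disjoint_sym.
have := sum_nbrs_lost AL BR; set s := (\sum_(v in A) _)%N; set l := lost _ _ _ => sl.
have L_gt0 : (0 < 'C(2 * k, k))%N by rewrite bin_gt0; lia.
exact: (loss_arith L_gt0 small sl).
Qed.

Lemma lost_ge_degree x A B b : A \subset ~: star k x -> (#|B| <= b)%N ->
  (#|A| * (k - b) <= lost x A B)%N.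
Proof.
move=> AL Bb; rewrite -sum_nat_const; apply: leq_sum => v vA.
have vx : v \notin star k x by move: (subsetP AL v vA); rewrite inE.
rewrite cardsD card_nbrs_star // leq_sub2l //.
by apply: leq_trans Bb; apply/subset_leq_card/subsetIr.
Qed.

(** The squares count pairs of vertices of A with a common neighbour in B, and distinct vertices
    share at most one neighbour. *)
Lemma sum_sq_nbrs A B :
  (\sum_(u in B) #|nbrs u :&: A| ^ 2 <= \sum_(u in B) #|nbrs u :&: A| + #|A| ^ 2)%N.
Proof.
have -> : (\sum_(u in B) #|nbrs u :&: A| ^ 2 =
    \sum_(v in A) \sum_(w in A) #|nbrs v :&: nbrs w :&: B|)%N.
  transitivity (\sum_(u in B) \sum_(v in A) \sum_(w in A) (u \in nbrs v :&: nbrs w))%N.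
    apply: eq_bigr => u _.
    have E : #|nbrs u :&: A| = (\sum_(v in A) (u \in nbrs v))%N.
      rewrite -sum1_card big_mkcond [RHS]big_mkcond; apply: eq_bigr => v _.
      by rewrite nbrs_sym !inE; case: (v \in A); case: [disjoint _ & _].
    rewrite expnS expn1 {1}E big_distrl; apply: eq_bigr => v _; rewrite E big_distrr.
    apply: eq_bigr => w _; rewrite [in RHS]inE.
    by case: (u \in nbrs v); case: (u \in nbrs w).
  rewrite exchange_big; apply: eq_bigr => v _; rewrite exchange_big.
  apply: eq_bigr => w _; rewrite -sum1_card big_mkcond [RHS]big_mkcond.
  by apply: eq_bigr => u _; rewrite [in RHS]inE andbC; case: (u \in B); case: (u \in _ :&: _).
rewrite -sum_nbrs_swap -mulnn -[X in (_ + X)%N]sum_nat_const -big_split /=.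
apply: leq_sum => v vA; rewrite (bigD1 v) //= setIid leq_add2l.
apply: leq_trans (_ : \sum_(w in A | w != v) 1 <= _)%N.
  apply: leq_sum => w /andP[_ wv]; apply: leq_trans (card_nbrs_common wv).
  by apply: subset_leq_card; rewrite (setIC (nbrs v)) subsetIl.
by rewrite sum1_card; apply/subset_leq_card/subsetP => w /andP[].
Qed.

Lemma lost_ge_two_stars x A B : (300 <= k)%N -> A \subset ~: star k x ->
  B \subset star k x -> (#|B| < #|A|)%N -> (1 < #|A|)%N ->
  (15 * #|A| <= 7 * 'C(2 * k, k))%N -> (2 * k - 2 <= lost x A B)%N.
Proof.
move=> k300 AL BR BA A2 small.
have [Ak|kA] := ltnP #|A| k.
  apply: leq_trans (lost_ge_degree (b := #|A|.-1) AL _); [nia|lia].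
have [Ak|kA'] := leqP (60 * k) #|A|.
  have := lost_ge_isop _ AL BR (ltnW BA) small; lia.
have sl := sum_nbrs_lost AL BR; have := sum_sq_nbrs A B.
rewrite -sum_nbrs_swap; rewrite sum_nbrs_swap in sl *.
set s := (\sum_(u in B) _)%N in sl *; set l := lost _ _ _ in sl *; set s2 := (\sum_(u in B) _)%N.
move=> s2le.
(* Sum of (2 d - k)^2 >= 0 over the degrees d of the members of B. *)
have cs : (4 * k * s <= 4 * s2 + k ^ 2 * #|B|)%N.
  have -> : (k ^ 2 * #|B| = \sum_(u in B) k ^ 2)%N by rewrite sum_nat_const mulnC.
  rewrite /s /s2 !big_distrr -big_split /=; apply: leq_sum => u _.
  move: #|_| => d; have [dk|kd] := leqP (2 * d) k.
    have [j ->] : exists j, k = (2 * d + j)%N by exists (k - 2 * d)%N; lia.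
    nia.
  have [j jE] : exists j, (2 * d = k + j)%N by exists (2 * d - k)%N; lia.
  nia.
have s4 : (2 * s <= k * #|A|)%N.
  have : (4 * (k * s) <= 4 * s + 4 * #|A| ^ 2 + k ^ 2 * #|A|)%N.
    have : (k ^ 2 * #|B| <= k ^ 2 * #|A|)%N by rewrite leq_mul2l ltnW ?orbT.
    by lia.
  have : (#|A| ^ 2 <= 60 * k * #|A|)%N by rewrite -mulnn leq_mul2r ltnW ?orbT.
  by nia.
by nia.
Qed.

Definition inner_degrees (F : {set V}) : nat := \sum_(u in F) #|nbrs u :&: F|.

(* The graph induced on the complement of a star is a perfect matching. *)
Lemma inner_degrees_antistar x A : A \subset ~: star k x ->
  (2 * #|A| <= inner_degrees A + 'C(2 * k, k))%N.
Proof.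
move=> AL.
have nb1 v : v \notin star k x -> #|nbrs v :&: ~: star k x| = 1%N.
  move=> vx; apply/eqP; rewrite -setDE -(eqn_add2l #|nbrs v :&: star k x|).
  by rewrite cardsID card_nbrs card_nbrs_star // addn1.
have : (\sum_(v in A) #|nbrs v :&: ~: star k x| = #|A|)%N.
  rewrite -sum1_card; apply: eq_bigr => v vA; rewrite nb1 //.
  by have := subsetP AL v vA; rewrite inE.
have -> : (\sum_(v in A) #|nbrs v :&: ~: star k x| =
    inner_degrees A + \sum_(v in A) #|nbrs v :&: (~: star k x :\: A)|)%N.
  rewrite -big_split; apply: eq_bigr => v _ /=.
  rewrite -(cardsID A (nbrs v :&: ~: star k x)) -setIA (setIidPr AL); congr (_ + _)%N.
  by rewrite setIDA.
rewrite sum_nbrs_swap => eA.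
have : (\sum_(u in ~: star k x :\: A) #|nbrs u :&: A| <= #|~: star k x :\: A|)%N.
  rewrite -sum1_card; apply: leq_sum => u; rewrite inE => /andP[_ uL].
  rewrite inE in uL; rewrite -(nb1 u uL); apply/subset_leq_card/setIS/AL.
have := cardsID A (~: star k x); rewrite (setIidPr AL) card_starC; lia.
Qed.

(** A large bias could also be negative. This is excluded because the complement of a star induces a
    perfect matching: with few edges, F contains at most 513/1024 of it. *)
Lemma near_some_star (F : {set V}) : (13 < k)%N -> #|F| = 'C(2 * k, k.-1) ->
    (512 * inner_degrees F < 'C(2 * k, k))%N ->
  exists x, (28 * #|F :\: star k x| <= 13 * 'C(2 * k, k))%N.
Proof.
move=> k13 cardF e2lt; have k_gt1 : (1 < k)%N by lia.
have cT : #|'I_n| = (2 * k).+1 by rewrite card_ord nE addn1.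
have Fk : {in val @: F, forall S : {set 'I_n}, #|S| = k}.
  by move=> _ /imsetP[v _ ->]; rewrite card_val.
have cF : #|val @: F| = 'C(2 * k, k.-1) by rewrite card_val_image.
have hasE x : [set S in val @: F | x \in S] = val @: (F :&: star k x).
  apply/setP => S; rewrite inE; apply/andP/imsetP => [[/imsetP[v vF ->] xv]|[v]].
    by exists v; rewrite // !inE vF.
  by rewrite !inE => /andP[vF xv] ->; split=> //; apply/imsetP; exists v.
have e2E : (\sum_(u in val @: F) #|[set v in val @: F | v \subset ~: u]| = inner_degrees F)%N.
  rewrite big_imset /=; last by move=> u v _ _ /val_inj.
  apply: eq_bigr => u _; rewrite -(card_val_image (nbrs u :&: F)); apply: eq_card => S.
  rewrite inE; apply/andP/imsetP => [[/imsetP[v vF ->] vu]|[v]].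
    by exists v; rewrite // !inE vF andbT disjoint_sym disjoints_subset.
  rewrite !inE => /andP[uv vF] ->; split; first by apply/imsetP; exists v.
  by rewrite -disjoints_subset disjoint_sym.
have [] := @large_bias rat _ k (val @: F) cT k_gt1 Fk cF.
  by rewrite e2E -natrM ltr_nat.
move=> x xb0; exists x; move: xb0.
have FA := cardsID (star k x) F; rewrite cardF in FA.
have kML : (k * 'C(2 * k, k) = k.+1 * 'C(2 * k, k.-1))%N.
  exact: mul_bin_central (ltnW k_gt1).
have := @inner_degrees_antistar x (F :\: star k x).
have -> : F :\: star k x \subset ~: star k x by rewrite setDE subsetIr.
have : (inner_degrees (F :\: star k x) <= inner_degrees F)%N.
  rewrite /inner_degrees [leqRHS](big_setID (star k x)) /=; apply: leq_trans (leq_addl _ _).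
  by apply: leq_sum => v _; apply/subset_leq_card/setIS/subsetDl.
move=> i1 /(_ isT) i2.
have {}i2 : (1024 * #|F :\: star k x| <= 513 * 'C(2 * k, k))%N by lia.
move=> xb; apply: (bias_arith k13 FA i2 kML); first by rewrite bin_gt0; lia.
by move: xb; rewrite -(card_val_image (F :&: _)) -hasE; apply.
Qed.
End KneserGraph.

(** Division-free form of: if q vertices each send (1 - 2/s) k edges into at most a vertices of
    degree k + 1, then q <= (1 + 4/s) a. *)
Lemma rich_upper_arith s k q a : (8 <= s)%N -> (s * s <= k)%N ->
  (s * k * q <= 2 * k * q + s * (k.+1 * a))%N -> (s * q <= (s + 4) * a)%N.
Proof.
move=> s8 sk le; have [r rE] : exists r, s = (r + 8)%N by exists (s - 8)%N; lia.
have {}le : ((r + 6) * k * q <= s * (k.+1 * a))%N by subst s; nia.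
have pos : (0 < (r + 6) * k)%N by subst s; nia.
rewrite -(leq_pmul2l pos).
apply: leq_trans (_ : s * (s * (k.+1 * a)) <= _)%N.
  by rewrite mulnCA leq_mul2l le orbT.
suff : (s * s * k.+1 <= (r + 6) * k * (s + 4))%N.
  by move=> H; have := leq_mul H (leqnn a); nia.
subst s; nia.
Qed.

(** Here [p] and [z] count the rich and poor vertices of A, [b1] and [b2] the covered and uncovered
    members of B. The rich vertices force [b1] to be nearly [p]; as b1 + b2 <= p + z with [z] small,
    little is left for [b2]. *)
Lemma rich_lower_arith s k p z a b1 b2 l : (s <= k)%N ->
  (s * k * p <= 2 * k * p + s * (k.+1 * b1))%N -> (p + z = a)%N -> (s * z <= l)%N ->
  (b1 + b2 <= a)%N -> (s * b2 <= 4 * a + l)%N.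
Proof.
move=> sk le <- zl b12; rewrite -(leq_pmul2l (ltn0Sn k)).
have h1 : (s * (k.+1 * b1) + s * (k.+1 * b2) <= s * (k.+1 * (p + z)))%N.
  by rewrite -!mulnDr !leq_mul2l b12 !orbT.
have h2 : (k.+1 * (s * z) <= k.+1 * l)%N by rewrite leq_mul2l zl orbT.
have h3 : (s * p <= k * p)%N by rewrite leq_mul2r sk orbT.
by nia.
Qed.

Lemma few_poor_arith s k z l : (0 < s)%N -> (s * s * (s * s) <= k)%N ->
  (k * z <= s * s * l)%N -> (s * z <= l)%N.
Proof.
move=> s0 sk kz; apply: leq_trans (_ : s * s * z <= _)%N.
  by rewrite leq_mul2r leq_pmulr ?orbT.
rewrite -(leq_pmul2l (m := s * s)) ?muln_gt0 ?s0 //.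
by apply: leq_trans kz; rewrite mulnA leq_mul2r sk orbT.
Qed.

(** * Encoding a pair with few lost edges *)

Section Container.
Variables k n : nat.
Hypothesis nE : n = (2 * k + 1)%N.
Notation V := (ksubset n k).
Implicit Types (u v w : V) (A B T : {set V}) (x : 'I_n).

Definition nbh T : {set V} := \bigcup_(v in T) nbrs v.

Lemma leq_card_bigcup (I J : finType) (P : {set I}) (D : I -> {set J}) :
  (#|\bigcup_(i in P) D i| <= \sum_(i in P) #|D i|)%N.
Proof.
elim/big_rec2: _ => [|i m X _ le]; first by rewrite cards0.
by apply: leq_trans (leq_card_setU _ _) _; rewrite leq_add2l.
Qed.

Lemma nbrs_sub_nbh v T : v \in T -> nbrs v \subset nbh T.
Proof. by move=> vT; apply: bigcup_sup. Qed.

Lemma nbhS T T' : T \subset T' -> nbh T \subset nbh T'.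
Proof.
by move=> /subsetP sT; apply/bigcupsP => v /sT; apply: nbrs_sub_nbh.
Qed.

(** At most 2k / s of the k neighbours in the star may be outside B: a share k / s is allowed for
    neighbours that the cover misses and k / s for lost edges. *)
Definition rich (s : nat) x B : {set V} :=
  [set v in ~: star k x | s * k <= 2 * k + s * #|nbrs v :&: B|].

Lemma card_rich s x A B : A \subset rich s x B ->
  (s * k * #|A| <= 2 * k * #|A| + s * (k.+1 * #|B|))%N.
Proof.
move=> AB; have : (\sum_(v in A) #|nbrs v :&: B| <= k.+1 * #|B|)%N.
  rewrite sum_nbrs_swap [leqRHS]mulnC -sum_nat_const; apply: leq_sum => u _.
  by rewrite -(card_nbrs nE u); apply/subset_leq_card/subsetIl.
suff : (s * k * #|A| <= 2 * k * #|A| + s * \sum_(v in A) #|nbrs v :&: B|)%N by nia.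
rewrite [(s * k * _)%N]mulnC [(2 * k * _)%N]mulnC -!sum_nat_const big_distrr -big_split.
by apply: leq_sum => v /(subsetP AB); rewrite inE => /andP[].
Qed.

Variables (s : nat) (x : 'I_n).
Hypotheses (s_ge8 : (8 <= s)%N) (s4k : (s ^ 4 <= k)%N).

Definition core T X : {set V} := nbh T :&: star k x :\: X.
Definition decodeA T X Y Z : {set V} := (rich s x (core T X) :\: Y) :|: Z.
Definition decodeB T X B2 : {set V} := core T X :|: B2.

(* [T] is a maximal set of vertices of [A] that lose few edges and whose
   neighbourhoods cover B efficiently. It covers most of the edges at every
   vertex that loses few edges, so that [T] nearly determines [(A, B)]; the other
   sets in the code record the errors. *)
Lemma container A B : A \subset ~: star k x -> B \subset star k x ->
    (#|B| <= #|A|)%N ->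
  exists T X Y Z B2, [/\ A = decodeA T X Y Z, B = decodeB T X B2,
    [/\ T \subset A, X \subset nbh T, Y \subset nbh (nbh T), Z \subset A & B2 \subset B],
    A \subset Z :|: nbh (nbh T) &
    let m := (4 * #|A| + lost x A B)%N in
    [/\ s * #|T| <= m, s * #|X| <= m, s * #|Y| <= m, s * #|Z| <= m & s * #|B2| <= m]%N].
Proof.
move=> AL BR BA.
have s_gt0 : (0 < s)%N by apply: leq_trans s_ge8.
have s_le2 : (s <= s * s)%N by rewrite leq_pmulr.
have sk : (s * s <= k)%N.
  by apply: leq_trans s4k; rewrite -[(s * s)%N]/(s ^ 2)%N leq_exp2l // (leq_trans _ s_ge8).
have sk1 : (s <= k)%N := leq_trans s_le2 sk.
have k_gt0 : (0 < k)%N := leq_trans s_gt0 sk1.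
pose loss v := #|nbrs v :&: star k x :\: B|.
pose good := [set v in A | s ^ 2 * loss v <= k].
(* On average each member of [T] accounts for at least k / s members of B, which bounds |T|. By
   maximality, a good vertex has at most k / s neighbours in B that [T] misses. *)
pose P T := (T \subset good) && (k * #|T| <= s * #|nbh T :&: B|).
have P0 : P set0 by rewrite /P sub0set cards0 muln0.
case: (arg_maxnP (fun T => #|T|) P0) => T /andP[Tgood Teff] Tmax.
have TA : T \subset A by apply: subset_trans Tgood _; apply/subsetP => v; rewrite inE => /andP[].
have covered v : v \in good -> s * #|nbrs v :&: B :\: nbh T| <= k.
  move=> vgood; rewrite leqNgt; apply/negP => big.
  have vT : v \notin T.
    apply/negP => vT; move: big; rewrite (_ : _ :\: _ = set0) ?cards0 ?muln0 //.
    by apply/eqP; rewrite setD_eq0; apply: subset_trans (subsetIl _ _) (nbrs_sub_nbh vT).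
  have PvT : P (v |: T); last by have := Tmax _ PvT; rewrite /= cardsU1 vT add1n ltnn.
  rewrite /P subUset sub1set vgood Tgood /= cardsU1 vT add1n mulnS.
  have -> : nbh (v |: T) :&: B = (nbrs v :&: B :\: nbh T) :|: (nbh T :&: B).
    rewrite /nbh big_setU1 //= -/(nbh T); apply/setP => w; rewrite !inE.
    by case: (w \in nbh T); case: [disjoint _ & _]; case: (w \in B).
  have E0 : (nbrs v :&: B :\: nbh T) :&: (nbh T :&: B) = set0.
    by apply/setP => w; rewrite !inE; case: (w \in nbh T); rewrite /= ?andbF.
  by rewrite cardsU E0 cards0 subn0 mulnDr leq_add // ltnW.
set X := nbh T :&: star k x :\: B.
have coreE : core T X = nbh T :&: B.
  rewrite /core /X; apply/setP => w; rewrite !inE -/(nbh T).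
  have := subsetP BR w; rewrite inE; case: (w \in nbh T); case: (w \in B) => //= xw.
    by rewrite xw.
  by case: (x \in _).
set A' := rich s x (core T X).
have goodA' : good \subset A'.
  apply/subsetP => v vgood; have := covered v vgood.
  move: (vgood); rewrite inE => /andP[vA lossv] cv.
  have vx : v \notin star k x by have := subsetP AL v vA; rewrite inE.
  rewrite inE inE vx coreE /=.
  have := card_nbrs_star nE vx; rewrite -(cardsID B (nbrs v :&: star k x)) -/(loss v).
  rewrite -setIA (setIidPr BR) -(cardsID (nbh T) (nbrs v :&: B)) -setIA [B :&: _]setIC.
  move: cv; set p := #|_ :\: nbh T|; set d := #|_ :&: _| => cv dE.
  have sl : (s * loss v <= k)%N.
    apply: leq_trans lossv; rewrite leq_mul2r (leq_exp2l 1) ?orbT //.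
    exact: leq_trans s_ge8.
  have : (s * k = s * d + s * p + s * loss v)%N by rewrite -!mulnDr dE.
  move: cv sl; clear; lia.
(* Each vertex of [T] loses at most k / s^2 edges, and |T| <= s |B| / k. *)
have XE : (s * #|X| <= #|A|)%N.
  have : (#|X| <= \sum_(v in T) loss v)%N.
    apply: leq_trans (leq_card_bigcup _ _); apply/subset_leq_card/subsetP => w.
    rewrite !inE => /andP[wB /andP[/bigcupP[v vT wv] xw]].
    by apply/bigcupP; exists v; rewrite // !inE wB xw andbT; move: wv; rewrite inE.
  have : (s ^ 2 * \sum_(v in T) loss v <= k * #|T|)%N.
    rewrite [leqRHS]mulnC -sum_nat_const big_distrr; apply: leq_sum => v /(subsetP Tgood).
    by rewrite inE => /andP[].
  have : (#|nbh T :&: B| <= #|B|)%N by apply/subset_leq_card/subsetIr.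
  rewrite expnS expn1; move: Teff s_ge8 BA; clear; nia.
have kT : (k * #|T| <= s * #|A|)%N.
  have : (#|nbh T :&: B| <= #|B|)%N by apply/subset_leq_card/subsetIr.
  move: Teff BA; clear; nia.
have TE : (s * #|T| <= #|A|)%N.
  have : (s * (s * #|T|) <= s * #|A|)%N.
    apply: leq_trans kT; rewrite mulnA leq_mul2r; apply/orP; right.
    exact: sk.
  by rewrite leq_pmul2l.
set Z := A :\: A'.
(* A vertex that is not good loses more than k / s^2 edges; s^4 <= k turns the resulting factor s^2
   / k into 1 / s. *)
have ZE : (s * #|Z| <= lost x A B)%N.
  have : (k * #|Z| <= s ^ 2 * lost x A B)%N.
    apply: leq_trans (_ : k * #|A :\: good| <= _)%N.
      by rewrite leq_mul2l subset_leq_card ?orbT // setDS.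
    rewrite mulnC -sum_nat_const big_distrr /= [leqRHS](big_setID good) /=.
    apply: leq_trans (leq_addl _ _).
    apply: leq_sum => v; rewrite !inE => /andP[+ vA]; rewrite vA /= -ltnNge; exact: ltnW.
  have s4k' : (s * s * (s * s) <= k)%N by move: s4k; rewrite !expnS muln1 !mulnA.
  by rewrite -mulnn; apply: few_poor_arith.
set Y := A' :\: A; set B2 := B :\: nbh T.
have Bsplit := cardsID (nbh T) B; rewrite setIC -/B2 in Bsplit.
have A'card := card_rich (subxx A'); rewrite coreE in A'card.
have AA'card : (s * k * #|A :&: A'| <= 2 * k * #|A :&: A'| + s * (k.+1 * #|nbh T :&: B|))%N.
  by rewrite -coreE; apply: card_rich; apply: subsetIr.
have Asplit := cardsID A' A; rewrite -/Z in Asplit.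
have A'split := cardsID A A'; rewrite -/Y setIC in A'split.
have s_leA' : (s * #|A'| <= (s + 4) * #|A|)%N.
  apply: rich_upper_arith sk _ => //; apply: leq_trans A'card _.
  rewrite leq_add2l !leq_mul2l; apply/orP; right; apply/orP; right.
  by apply: leq_trans BA; rewrite -Bsplit leq_addr.
have YE : (s * #|Y| <= 4 * #|A| + lost x A B)%N.
  move: s_leA' ZE Asplit A'split; rewrite mulnDl.
  by move: (lost _ _ _) #|Y| #|Z| #|A'| #|A| #|_ :&: _|; clear; nia.
have B2E : (s * #|B2| <= 4 * #|A| + lost x A B)%N.
  by apply: rich_lower_arith sk1 AA'card Asplit ZE _; rewrite Bsplit.
exists T, X, Y, Z, B2; split.
- by rewrite /decodeA -/A' setDDr setDv set0U setIC setID.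
- by rewrite /decodeB coreE setIC setID.
- split; rewrite ?subsetDl //.
    by rewrite /X setDE -setIA subsetIl.
  apply/subsetP => v; rewrite 3!inE => /andP[_ /andP[_]].
  have [->|[w]] := set_0Vmem (nbrs v :&: core T X).
    rewrite cards0 muln0 addn0 leq_pmul2r // => s2.
    by have := leq_trans s_ge8 s2.
  rewrite coreE inE => /andP[vw /setIP[wT _]] _.
  by apply/bigcupP; exists w; rewrite // nbrs_sym.
- apply/subsetP => v vA; rewrite inE.
  have [//|vZ] := boolP (v \in Z); rewrite /=.
  have : v \in A' by move: vZ; rewrite inE vA andbT negbK.
  rewrite 2!inE => /andP[_].
  have [->|[w]] := set_0Vmem (nbrs v :&: core T X).
    rewrite cards0 muln0 addn0 leq_pmul2r // => s2.
    by have := leq_trans s_ge8 s2.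
  rewrite coreE inE => /andP[vw /setIP[wT _]] _.
  by apply/bigcupP; exists w; rewrite // nbrs_sym.
move=> m; rewrite /m YE B2E; split=> //.
- by apply: leq_trans TE _; rewrite -addnA leq_addr || (apply: leq_trans (leq_addr _ _); rewrite leq_pmull).
- by apply: leq_trans XE _; apply: leq_trans (leq_addr _ _); rewrite leq_pmull.
- by apply: leq_trans ZE _; rewrite leq_addl.
Qed.

End Container.

Lemma leq_exp2rW m n e : (m <= n)%N -> (m ^ e <= n ^ e)%N.
Proof. by case: e => [|e] mn; rewrite ?expn0 // leq_exp2r. Qed.

(** Bernoulli's inequality (1 - 1/(t + 1))^i >= 1 - i/(t + 1), cleared of denominators. *)
Lemma succ_exp_le t i : (i <= t)%N -> (t.+1 ^ i * (t.+1 - i) <= t.+1 * t ^ i)%N.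
Proof.
elim: i => [|i IH] le; first by rewrite !expn0 subn0 mul1n muln1.
have -> : (t.+1 - i.+1 = t - i)%N by lia.
apply: leq_trans (_ : t * (t.+1 ^ i * (t.+1 - i)) <= _)%N.
  rewrite expnSr -mulnA [leqRHS]mulnCA leq_mul2l; apply/orP; right.
  have [j ->] : exists j, t = (i + j)%N by exists (t - i)%N; lia.
  rewrite addKn (_ : (i + j).+1 - i = j.+1)%N; [nia|lia].
rewrite expnS [leqRHS]mulnCA leq_mul2l; apply/orP; right; apply: IH; lia.
Qed.

Lemma succ_exp_half t i : (2 * i <= t.+1)%N -> (i <= t)%N -> (t.+1 ^ i <= 2 * t ^ i)%N.
Proof.
move=> i2 it; have := succ_exp_le it => le.
rewrite -(leq_pmul2l (ltn0Sn t)).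
have : (t.+1 <= 2 * (t.+1 - i))%N by lia.
move: le; move: (t.+1 - i)%N (t.+1 ^ i)%N (t ^ i)%N => d x y; nia.
Qed.

(** This is (1 + 1/t)^t <= 4, each half of the exponent contributing a factor of at most 2. *)
Lemma succ_exp_self t : (t.+1 ^ t <= 4 * t ^ t)%N.
Proof.
have h1 : (t.+1 ^ uphalf t <= 2 * t ^ uphalf t)%N by apply: succ_exp_half; lia.
have h2 : (t.+1 ^ t./2 <= 2 * t ^ t./2)%N by apply: succ_exp_half; lia.
have E : t = (uphalf t + t./2)%N by lia.
rewrite {2 4}E !expnD; move: (leq_mul h1 h2); rewrite mulnACA; exact.
Qed.

(** * Counting encoded pairs *)

Section SubsetCount.
Variable V : finType.
Implicit Types U X : {set V}.

Lemma sum_powerset t U :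
  (\sum_(X : {set V} | X \subset U) t ^ (#|U| - #|X|) = t.+1 ^ #|U|)%N.
Proof.
rewrite -addn1 expnDn (partition_big (fun X => inord #|X| : 'I_#|U|.+1) xpredT) //=.
apply: eq_bigr => i _; rewrite exp1n muln1.
transitivity (\sum_(X in [set X : {set V} | X \subset U & #|X| == i]) t ^ (#|U| - i))%N.
  apply: eq_big => [X|X /andP[XU /eqP <-]].
    rewrite inE; case XU: (X \subset U) => //=.
    by rewrite -val_eqE /= inordK // ltnS subset_leq_card.
  by rewrite inordK // ltnS subset_leq_card.
by rewrite sum_nat_const cards_draws.
Qed.

(** Give X the weight t^(|U| - |X|): the total is (t + 1)^|U|, while each small set weighs at least
    t^(|U| - m). The factor 4^j pays for (1 + 1/t)^(t j). *)
Lemma card_small_subsets t m j U : (0 < t)%N -> (#|U| <= t * j)%N ->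
  (#|[set X : {set V} | (X \subset U) && (#|X| <= m)]| <= t ^ m * 4 ^ j)%N.
Proof.
move=> t_gt0 Utj; set c := #|_|; set u := #|U| in Utj *.
have cu : (c * t ^ u <= t ^ m * t.+1 ^ u)%N.
  rewrite -sum_powerset big_distrr /= -sum_nat_const big_mkcond [leqRHS]big_mkcond.
  apply: leq_sum => X _; rewrite inE; case: (X \subset U) => //=.
  by case: (leqP #|X| m) => //= Xm; rewrite -expnD leq_pexp2l //; lia.
rewrite -(leq_pmul2r (m := t ^ (t * j))) ?expn_gt0 ?t_gt0 //.
have [d dE] : exists d, (t * j = u + d)%N by exists (t * j - u)%N; lia.
apply: leq_trans (_ : t ^ m * t.+1 ^ (t * j) <= _)%N.
  rewrite dE !expnD !mulnA; apply: leq_mul cu _.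
  by rewrite leq_exp2rW.
by rewrite -mulnA leq_mul2l !expnM -expnMn leq_exp2rW ?succ_exp_self ?orbT.
Qed.
End SubsetCount.

(** * Connected sets in a graph of bounded degree *)

Section ConnectedSets.
Variables (V : finType) (e : rel V) (D : nat).
Hypotheses (e_sym : symmetric e) (e_refl : reflexive e).
Hypothesis e_deg : forall u, (#|[set v | e u v]| <= D)%N.
Implicit Types A : {set V}.

(** Stated through cuts rather than paths: minimality of a violator yields this form directly, and a
    skeleton inherits it. *)
Definition connected A : bool :=
  [forall A1 : {set V}, (A1 \subset A) && (A1 != set0) && (A1 != A) ==>
     [exists u in A1, [exists v in A :\: A1, e u v]]].

Fixpoint walks j v : seq (seq V) :=
  if j is j'.+1 then flatten [seq [seq v :: p | p <- walks j' w] | w <- enum [set w | e v w]]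
  else [:: [:: v]].

Lemma size_walks j v : (size (walks j v) <= D ^ j)%N.
Proof.
elim: j v => [//|j IH] v /=.
rewrite size_flatten /shape -map_comp sumnE big_map big_enum /=.
apply: leq_trans (_ : \sum_(w in [set w | e v w]) D ^ j <= _)%N.
  by apply: leq_sum => w _; rewrite size_map.
by rewrite sum_nat_const expnS leq_mul2r e_deg orbT.
Qed.

Lemma mem_walks v p : path e v p -> v :: p \in walks (size p) v.
Proof.
elim: p v => [|w p IH] v /=; first by rewrite inE.
move=> /andP[vw wp]; apply/flatten_mapP; exists w; first by rewrite mem_enum inE.
by apply/map_f/IH.
Qed.

(* A connected set is covered by a closed-up walk: each new vertex is inserted as
   a detour at one of its neighbours. *)
Lemma covering_walk A v i : connected A -> v \in A ->
  exists p, [/\ path e v p, size p = (2 * i)%N, [set y in v :: p] \subset A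
    & (minn i.+1 #|A| <= #|[set y in v :: p]|)%N].
Proof.
move=> cA vA; elim: i => [|i [p [pp sp pA card_p]]].
  exists [::]; split=> //; first by apply/subsetP => y; rewrite !inE => /eqP ->.
  rewrite (_ : [set y in [:: v]] = [set v]) ?cards1 ?geq_minl //.
  by apply/setP => y; rewrite !inE.
have [E|nE] := eqVneq [set y in v :: p] A.
  exists (v :: v :: p); split=> //=; first by rewrite !e_refl.
  - by rewrite sp; lia.
  - by rewrite -E; apply/subsetP => y; rewrite !inE => /or3P[] ->; rewrite ?orbT.
  rewrite (_ : [set y in [:: v, v, v & p]] = [set y in v :: p]); first by rewrite E geq_minr.
  by apply/setP => y; rewrite !inE !orbA !orbb.
have /existsP[u /andP[up /existsP[w /andP[wA uw]]]] :
    [exists u in [set y in v :: p], [exists w in A :\: [set y in v :: p], e u w]].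
  apply: (implyP (forallP cA _)); rewrite pA nE !andbT.
  by apply/set0Pn; exists v; rewrite !inE eqxx.
move: up wA; rewrite inE => up; rewrite in_setD => /andP[wp wA].
case/splitPl: up pp sp pA card_p wp nE => p1 p2 lastp.
rewrite cat_path => /andP[pp1 pp2] sp pA card_p wp nE.
have E : [set y in v :: (p1 ++ [:: w, u & p2])] = w |: [set y in v :: p1 ++ p2].
  apply/setP => y; rewrite !inE !mem_cat !inE.
  case: (y =P w) => [->|_]; rewrite ?orbT //=.
  case: (y =P u) => [->|_] //=.
  have : u \in v :: p1 by rewrite -lastp mem_last.
  by rewrite inE => /orP[]->; rewrite ?orbT.
exists (p1 ++ [:: w, u & p2]); rewrite E; split.
- by rewrite cat_path pp1 /= lastp uw e_sym uw -lastp.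
- by move: sp; rewrite !size_cat /=; lia.
- by rewrite subUset sub1set wA.
- by rewrite cardsU1 wp; move: card_p; lia.
Qed.

Lemma card_connected m :
  (#|[set A | connected A && (0 < #|A| <= m)]| <= #|V| * D ^ (2 * m))%N.
Proof.
pose all_walks := flatten [seq walks (2 * m) v | v <- enum V].
apply: leq_trans (_ : size all_walks <= _)%N; last first.
  rewrite size_flatten /shape -map_comp sumnE big_map big_enum /= -sum_nat_const.
  by apply: leq_sum => v _; apply: size_walks.
apply: leq_trans (_ : #|[pred A in [seq [set y in p] | p <- all_walks]]| <= _)%N.
  apply/subset_leq_card/subsetP => A; rewrite !inE => /and3P[cA /card_gt0P[v vA] Am].
  have [p [pp sp pA card_p]] := covering_walk m cA vA.
  have <- : [set y in v :: p] = A.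
    by apply/eqP; rewrite eqEcard pA (leq_trans _ card_p) // leq_min leqnn leqW.
  apply/map_f/flatten_mapP; exists v; rewrite ?mem_enum //.
  by rewrite -sp; apply: mem_walks.
by apply: leq_trans (card_size _) _; rewrite size_map.
Qed.
End ConnectedSets.

(** * Number of pairs with a given loss *)

Section PairCount.
Variables k n : nat.
Hypothesis nE : n = (2 * k + 1)%N.
Notation V := (ksubset n k).
Implicit Types (u v w : V) (A B T W : {set V}) (x : 'I_n).

Definition ball W : {set V} := W :|: nbh W.

Lemma mem_ball v W : (v \in ball W) = (v \in W) || (v \in nbh W).
Proof. by rewrite inE. Qed.

Lemma ballS W W' : W \subset W' -> ball W \subset ball W'.
Proof. by move=> sW; apply: setUSS => //; apply: nbhS. Qed.

Lemma sub_ball W : W \subset ball W. Proof. exact: subsetUl. Qed.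

Lemma card_ball W : (#|ball W| <= (k + 2) * #|W|)%N.
Proof.
apply: leq_trans (leq_card_setU _ _) _; rewrite addn2 mulSn leq_add2l.
apply: leq_trans (leq_card_bigcup _ _) _; rewrite mulnC -sum_nat_const.
by apply: leq_sum => v _; rewrite card_nbrs.
Qed.

Lemma card_iter_ball i W : (#|iter i ball W| <= (k + 2) ^ i * #|W|)%N.
Proof.
elim: i => [|i IH] /=; first by rewrite mul1n.
by apply: leq_trans (card_ball _) _; rewrite expnS -mulnA leq_mul2l IH orbT.
Qed.

Lemma iter_ballS i W W' : W \subset W' -> iter i ball W \subset iter i ball W'.
Proof. by move=> sW; elim: i => //= i IH; apply: ballS. Qed.

Lemma sub_iter_ball i W : W \subset iter i ball W.
Proof. by elim: i => //= i IH; apply: subset_trans IH (sub_ball _). Qed.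

Lemma iter_ball_leq i j W : i <= j -> iter i ball W \subset iter j ball W.
Proof. by move=> /subnK <-; rewrite iterD; apply: sub_iter_ball. Qed.

Lemma mem_ball1 u v : (u \in ball [set v]) = (u == v) || (u \in nbrs v).
Proof. by rewrite mem_ball inE /nbh big_set1. Qed.

Lemma mem_iter_ball i v W : v \in iter i ball W -> exists2 w, w \in W & v \in iter i ball [set w].
Proof.
elim: i v => [|i IH] v /=; first by move=> vW; exists v; rewrite ?inE.
rewrite mem_ball => /orP[/IH[w wW vw]|/bigcupP[u /IH[w wW uw] vu]]; exists w => //.
  exact: (subsetP (sub_ball _)).
by rewrite mem_ball; apply/orP; right; apply/bigcupP; exists u.
Qed.

Lemma iter_ball_sym i u v : u \in iter i ball [set v] -> v \in iter i ball [set u].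
Proof.
elim: i u v => [|i IH] u v; first by rewrite /= !inE eq_sym.
rewrite [iter i.+1 ball [set v]]/= mem_ball => uv.
have [w wv uw] : exists2 w, w \in iter i ball [set v] & w \in ball [set u].
  case/orP: uv => [uv|/bigcupP[w wv uw]]; [exists u | exists w] => //; rewrite mem_ball1.
    by rewrite eqxx.
  by rewrite nbrs_sym uw orbT.
rewrite iterSr; apply: subsetP (IH _ _ wv); apply: iter_ballS.
by rewrite sub1set.
Qed.

Lemma iter_ball_trans i j u v w :
  u \in iter i ball [set v] -> w \in iter j ball [set u] -> w \in iter (i + j) ball [set v].
Proof.
move=> uv; apply/subsetP; rewrite addnC iterD; apply: iter_ballS.
by rewrite sub1set.
Qed.

Definition common_in x : rel V := fun u v => nbrs u :&: nbrs v :&: star k x != set0.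
Definition linked x A : bool := connected (common_in x) A.
Definition near6 : rel V := fun u v => v \in iter 6 ball [set u].

Lemma common_in_ball x u v : common_in x u v -> v \in iter 2 ball [set u].
Proof.
case/set0Pn => w; rewrite 2!in_setI => /andP[/andP[uw vw] _].
rewrite /= mem_ball; apply/orP; right; apply/bigcupP; exists w; last by rewrite nbrs_sym.
by rewrite mem_ball1 uw orbT.
Qed.

(** Linked vertices are at distance at most 2, and each vertex of A is within 2 of W, so W is
    connected by jumps of length 2 + 2 + 2 = 6. *)
Lemma connected_skeleton x A W : linked x A -> W \subset A -> A \subset iter 2 ball W ->
  connected near6 W.
Proof.
move=> /forallP cA WA AW; apply/forallP => W1; apply/implyP => /andP[/andP[W1W W10] W1n].
pose A1 := A :&: iter 2 ball W1.
have W1A1 : W1 \subset A1 by rewrite subsetI (subset_trans W1W WA) sub_iter_ball.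
have conv u v w1 w2 : u \in iter 2 ball [set w1] -> v \in iter 2 ball [set u] ->
    v \in iter 2 ball [set w2] -> near6 w1 w2.
  move=> uw1 vu /iter_ball_sym w2v; rewrite /near6.
  exact: (iter_ball_trans (iter_ball_trans uw1 vu) w2v).
have [A1A|A1A] := eqVneq A1 A.
  have [w2 w2W w2W1] : exists2 w, w \in W & w \notin W1.
    by apply/subsetPn; apply: contraNN W1n => WW1; rewrite eqEsubset W1W.
  have : w2 \in A1 by rewrite A1A (subsetP WA).
  rewrite inE => /andP[_ /mem_iter_ball[w1 w1W1 w2w1]].
  apply/existsP; exists w1; rewrite w1W1; apply/existsP; exists w2.
  rewrite inE w2W w2W1; apply: (conv w2 w2) => //; apply: (subsetP (sub_iter_ball _ _)); exact: set11.
have /existsP[u /andP[uA1 /existsP[v /andP[vA uv]]]] :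
    [exists u in A1, [exists v in A :\: A1, common_in x u v]].
  apply: (implyP (cA A1)); rewrite subsetIl A1A andbT /=.
  by apply: contraNneq W10 => A10; rewrite -subset0 -A10.
move: vA; rewrite inE => /andP[vA1 vA].
move: uA1; rewrite inE => /andP[uA /mem_iter_ball[w1 w1W1 uw1]].
have [w2 w2W vw2] := mem_iter_ball (subsetP AW v vA).
apply/existsP; exists w1; rewrite w1W1; apply/existsP; exists w2.
rewrite inE w2W andbT (conv u v) // ?andbT; last exact: common_in_ball uv.
apply: contra vA1 => w2W1; rewrite inE vA; apply: subsetP vw2.
by apply: iter_ballS; rewrite sub1set.
Qed.

Lemma near6_sym : symmetric near6.
Proof. by move=> u v; rewrite /near6; apply/idP/idP => /iter_ball_sym. Qed.

Lemma near6_refl : reflexive near6.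
Proof. by move=> u; rewrite /near6; apply: (subsetP (sub_iter_ball _ _)); apply: set11. Qed.

Lemma card_near6 u : (#|[set v | near6 u v]| <= (k + 2) ^ 6)%N.
Proof.
have := card_iter_ball 6 [set u]; rewrite cards1 muln1.
by apply: leq_trans; apply/subset_leq_card/subsetP => v; rewrite inE.
Qed.

Lemma card_skeletons m :
  (#|[set W | connected near6 W && (0 < #|W| <= m)%N]| <= #|{: V}| * (k + 2) ^ (12 * m))%N.
Proof.
apply: leq_trans (card_connected near6_sym near6_refl card_near6 m) _.
by rewrite -expnM mulnA.
Qed.

Variables (s : nat) (x : 'I_n).
Hypotheses (s_ge8 : (8 <= s)%N) (s4k : (s ^ 4 <= k)%N).

Definition near_pairs l : {set {set V} * {set V}} :=
  [set AB : {set V} * {set V} |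
    [&& AB.1 \subset ~: star k x, AB.2 \subset star k x :&: nbh AB.1,
        (#|AB.2| <= #|AB.1|)%N, (0 < #|AB.1| <= 30 * l)%N, linked x AB.1
      & lost x AB.1 AB.2 == l]].

Definition decode (c : {set V} * {set V} * ({set V} * {set V} * {set V})) :=
  let: (T, Z, (X, Y, B2)) := c in (decodeA s x T X Y Z, decodeB x T X B2).

(** As |A| <= 30 l, each set of the code has at most (4 * 30 + 1) l / s <= m elements. The skeleton
    [T :|: Z], connected by jumps of length 6, costs 24 m in the exponent; X, Y and B2, lying in its
    third ball, cost 9 m; the remaining factor 2^(16 m) is absorbed into (k + 2)^(16 m). *)
Lemma card_near_pairs l m : (121 * l <= s * m)%N ->
  (#|near_pairs l| <= #|{: V}| * (k + 2) ^ (49 * m))%N.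
Proof.
move=> lm; have s_gt0 : (0 < s)%N by apply: leq_trans s_ge8.
pose skeletons := [set W | connected near6 W && (0 < #|W| <= 2 * m)%N].
pose small W := [set X : {set V} | (X \subset iter 3 ball W) && (#|X| <= m)%N].
pose codes W := setX (setX (powerset W) (powerset W)) (setX (setX (small W) (small W)) (small W)).
have sub : near_pairs l \subset \bigcup_(W in skeletons) decode @: codes W.
  apply/subsetP => -[A B]; rewrite inE /= subsetI.
  case/and5P => AL /andP[BR BN] BA /andP[A0 Al] /andP[lA /eqP lAB].
  have [T [X [Y [Z [B2 [AE BE [TA XN YN ZA B2B] Acov /= [sT sX sY sZ sB2]]]]]]] :=
    container nE s_ge8 s4k AL BR BA.
  have le_m (X' : {set V}) : (s * #|X'| <= 4 * #|A| + lost x A B)%N -> (#|X'| <= m)%N.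
    rewrite lAB => le; rewrite -(leq_pmul2l s_gt0); apply: leq_trans lm.
    apply: leq_trans le _; move: #|A| Al => a; clear; lia.
  have TW : T \subset T :|: Z := subsetUl _ _.
  have ZW : Z \subset T :|: Z := subsetUr _ _.
  have nbh2 : nbh (nbh T) \subset iter 2 ball (T :|: Z).
    apply: subset_trans (subsetUr _ _); apply: nbhS; apply: subset_trans (subsetUr _ _).
    exact: nbhS.
  have AW : A \subset iter 2 ball (T :|: Z).
    apply: subset_trans Acov _; rewrite subUset nbh2 andbT.
    exact: subset_trans ZW (sub_iter_ball _ _).
  have WA : T :|: Z \subset A by rewrite subUset TA.
  apply/bigcupP; exists (T :|: Z).
    rewrite inE (connected_skeleton lA WA AW) /=; apply/andP; split.
      rewrite card_gt0; apply: contraL A0 => /eqP W0; rewrite -leqNgt leqn0 cards_eq0 -subset0.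
      by move: AW; rewrite W0 /= /ball /nbh !(big_set0, setU0).
    by apply: leq_trans (leq_card_setU _ _) _; rewrite mul2n -addnn leq_add ?le_m.
  apply/imsetP; exists (T, Z, (X, Y, B2)); last by rewrite /= -AE -BE.
  rewrite !in_setX !powersetE TW ZW !inE !le_m // !andbT /=.
  apply/andP; split; first (apply/andP; split).
  - have i13 := iter_ball_leq (T :|: Z) (isT : 1 <= 3).
    exact: subset_trans XN (subset_trans (nbhS TW) (subset_trans (subsetUr _ _) i13)).
  - exact: subset_trans YN (subset_trans nbh2 (iter_ball_leq (T :|: Z) (isT : 2 <= 3))).
  - apply: subset_trans B2B (subset_trans BN _).
    by apply: subset_trans (nbhS AW) (subsetUr _ _).
apply: leq_trans (subset_leq_card sub) _.
apply: leq_trans (leq_card_bigcup _ _) _.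
have small_card W : W \in skeletons -> (#|small W| <= ((k + 2) ^ 3) ^ m * 4 ^ (2 * m))%N.
  rewrite inE => /andP[_ /andP[_ Wm]]; apply: card_small_subsets; first by rewrite expn_gt0 addn2.
  by apply: leq_trans (card_iter_ball _ _) _; rewrite leq_mul2l Wm orbT.
pose c := (2 ^ (2 * m) * 2 ^ (2 * m) * (((k + 2) ^ 3) ^ m * 4 ^ (2 * m)) ^ 3)%N.
apply: leq_trans (_ : #|skeletons| * c <= _)%N.
  rewrite -sum_nat_const; apply: leq_sum => W Wsk; apply: leq_trans (leq_imset_card _ _) _.
  have sm := small_card W Wsk.
  have Wm : (2 ^ #|W| <= 2 ^ (2 * m))%N.
    by rewrite leq_exp2l //; move: Wsk; rewrite inE => /andP[_ /andP[]].
  rewrite !cardsX !card_powerset /c; apply: leq_mul; first exact: leq_mul.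
  move: (_ * 4 ^ _)%N sm => y sm.
  by rewrite !expnS expn0 muln1 mulnA; apply: leq_mul => //; apply: leq_mul.
apply: leq_trans (_ : #|{: V}| * (k + 2) ^ (12 * (2 * m)) * c <= _)%N.
  by rewrite leq_mul2r card_skeletons orbT.
rewrite -mulnA leq_mul2l; apply/orP; right.
have -> : (49 * m = 12 * (2 * m) + (9 * m + 16 * m))%N by lia.
rewrite expnD leq_mul2l; apply/orP; right.
have -> : c = ((k + 2) ^ (9 * m) * 2 ^ (16 * m))%N.
  rewrite /c expnMn -!expnM -[4]/(2 ^ 2)%N -!expnM -!expnD mulnCA -expnD.
  by congr (_ ^ _ * _ ^ _)%N; lia.
by rewrite expnD leq_mul2l leq_exp2rW ?orbT // addn2.
Qed.

Definition far_pairs l : {set {set V} * {set V}} :=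
  [set AB : {set V} * {set V} |
    [&& AB.1 \subset ~: star k x, AB.2 \subset star k x,
        (#|AB.2| <= #|AB.1|)%N & (lost x AB.1 AB.2 <= l)%N]].

(** Without connectedness the sets of the code range over all vertices. This is affordable because
    in the application the loss is of the order of the number of vertices. *)
Lemma card_far_pairs l m j : (4 * #|{: V}| + l <= s * m)%N -> (#|{: V}| <= (k + 2) * j)%N ->
  (#|far_pairs l| <= ((k + 2) ^ m * 4 ^ j) ^ 5)%N.
Proof.
move=> lm Vj; have s_gt0 : (0 < s)%N by apply: leq_trans s_ge8.
pose small := [set X : {set V} | (X \subset setT) && (#|X| <= m)%N].
have small_card : (#|small| <= (k + 2) ^ m * 4 ^ j)%N.
  by apply: card_small_subsets; rewrite ?cardsT // addn2.
pose codes := setX (setX small small) (setX (setX small small) small).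
have sub : far_pairs l \subset decode @: codes.
  apply/subsetP => -[A B]; rewrite inE /= => /and4P[AL BR BA lAB].
  have [T [X [Y [Z [B2 [AE BE _ _ /= [sT sX sY sZ sB2]]]]]]] :=
    container nE s_ge8 s4k AL BR BA.
  have le_m (X' : {set V}) : (s * #|X'| <= 4 * #|A| + lost x A B)%N -> (#|X'| <= m)%N.
    move=> le; rewrite -(leq_pmul2l s_gt0); apply: leq_trans lm.
    apply: leq_trans le _; apply: leq_add lAB.
    by rewrite leq_mul2l max_card orbT.
  apply/imsetP; exists (T, Z, (X, Y, B2)); last by rewrite /= -AE -BE.
  by rewrite !in_setX !inE !subsetT !le_m.
apply: leq_trans (subset_leq_card sub) (leq_trans (leq_imset_card _ _) _).
rewrite !cardsX -/small; apply: leq_trans (leq_exp2rW 5 small_card).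
by rewrite !expnS expn0 muln1 !mulnA.
Qed.
End PairCount.

(** * Random labellings *)

Section RandomLabelling.
Local Open Scope ring_scope.
Variables (E : finType) (m : nat).
Hypothesis cardE : #|E| = m.
Implicit Types (I J : {set E}) (pi : {ffun E -> 'I_m}).

Definition bijections : {set {ffun E -> 'I_m}} :=
  [set pi : {ffun E -> 'I_m} | injectiveb pi && [forall i, exists e : E, pi e == i]].

Lemma card_bijections_gt0 : (0 < #|bijections|)%N.
Proof.
apply/card_gt0P; exists [ffun e => cast_ord cardE (enum_rank e)]; rewrite inE.
apply/andP; split; first by apply/injectiveP => e e'; rewrite !ffunE => /cast_ord_inj/enum_rank_inj.
apply/forallP => i; apply/existsP; exists (enum_val (cast_ord (esym cardE) i)).
by rewrite ffunE enum_valK cast_ordKV.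
Qed.

Variable S : {set 'I_m}.

Definition late I : {set {ffun E -> 'I_m}} :=
  [set pi : {ffun E -> 'I_m} in bijections | I \subset pi @^-1: S].

Lemma card_late_labels pi : pi \in bijections -> #|pi @^-1: S| = #|S|.
Proof.
rewrite inE => /andP[/injectiveP pi_inj /forallP pi_surj].
rewrite -(card_imset _ pi_inj); apply: eq_card => i; apply/imsetP/idP => [[e]|iS].
  by rewrite inE => eS ->.
by have /existsP[e /eqP ei] := pi_surj i; exists e; rewrite ?inE ei.
Qed.

Lemma card_late_swap I e e' : e \notin I -> e' \notin I ->
  #|late (e' |: I)| = #|late (e |: I)|.
Proof.
move=> eI e'I; pose h pi : {ffun E -> 'I_m} := [ffun d => pi (tperm e e' d)].
have hK : involutive h by move=> pi; apply/ffunP => d; rewrite !ffunE tpermK.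
rewrite -(card_imset _ (inv_inj hK)); apply: eq_card => pi.
rewrite -[in RHS](hK pi) -[LHS](_ : (h pi \in late (e' |: I)) = _); last first.
  by apply/idP/imsetP => [hpi|[pi' pi'l ->]]; [exists (h pi); rewrite ?hK | rewrite hK].
move: (h pi) => {}pi; rewrite !inE.
have -> : injectiveb (h pi) = injectiveb pi.
  apply/injectiveP/injectiveP => inj d d'.
    move=> dd'; apply: (@perm_inj _ (tperm e e')); apply: inj.
    by rewrite !ffunE !tpermK.
  by rewrite !ffunE => /inj/perm_inj.
have -> : [forall i, exists d, h pi d == i] = [forall i, exists d, pi d == i].
  apply: eq_forallb => i; apply/existsP/existsP => -[d di]; exists (tperm e e' d).
    by move: di; rewrite ffunE.
  by rewrite ffunE tpermK.
congr (_ && _); rewrite !subUset !sub1set !inE ffunE tpermL; congr (_ && _).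
apply/subsetP/subsetP => sub d dI; have := sub d dI; rewrite !inE ffunE tpermD //;
by apply: contraTneq dI => <-.
Qed.

(** Sum over all e' outside I: by symmetry they have equal counts, and each labelling in [late I]
    has exactly |S| - |I| further edges with labels in S. *)
Lemma card_late_step I e : e \notin I ->
  (#|late (e |: I)| * (m - #|I|) = #|late I| * (#|S| - #|I|))%N.
Proof.
move=> eI.
have <- : (\sum_(e' in ~: I) #|late (e' |: I)| = #|late (e |: I)| * (m - #|I|))%N.
  have -> : (m - #|I| = #|~: I|)%N by rewrite [in RHS]cardsCs setCK cardE.
  rewrite mulnC -sum_nat_const; apply: eq_bigr => e'.
  by rewrite inE => e'I; apply: card_late_swap.
transitivity (\sum_(e' in ~: I) \sum_(pi in late I) (pi e' \in S))%N.
  apply: eq_bigr => e' _; rewrite -sum1_card big_mkcond [RHS]big_mkcond.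
  apply: eq_bigr => pi _; rewrite !inE subUset sub1set inE.
  by case: (pi e' \in S); case: (I \subset _); rewrite /= ?andbT ?andbF ?if_same.
rewrite exchange_big -sum_nat_const; apply: eq_bigr => pi; rewrite inE => /andP[piB Ipi].
rewrite -(card_late_labels piB) -(cardsID I (pi @^-1: S)) (setIidPr Ipi) addKn.
rewrite -sum1_card big_mkcond [RHS]big_mkcond; apply: eq_bigr => e' _.
by rewrite !inE; case: (e' \in I) => //=; case: (pi e' \in S).
Qed.

Lemma card_late I : (#|late I| * m ^_ #|I| = #|bijections| * #|S| ^_ #|I|)%N.
Proof.
move: {2}#|I| (erefl #|I|) => d; elim: d I => [|d IH] I Id.
  move/eqP: Id; rewrite cards_eq0 => /eqP ->; rewrite cards0 !ffactn0 !muln1.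
  by congr #|pred_of_set _|; apply/setP => pi; rewrite !inE sub0set andbT.
have /card_gt0P[e eI] : (0 < #|I|)%N by rewrite Id.
have cI := cardsD1 e I; rewrite eI Id add1n in cI; case: cI => cI.
have := @card_late_step (I :\ e) e; rewrite setD1K // !inE eqxx /= -cI => /(_ isT) step.
have {IH} := IH (I :\ e) (esym cI); rewrite -cI Id !ffactnSr => IH.
by rewrite [(m ^_ d * _)%N]mulnC mulnA step mulnAC IH mulnA.
Qed.

Lemma card_late_le (R : realFieldType) (q : R) I : 0 <= q <= 1 -> #|S|%:R <= q * m%:R ->
  #|late I|%:R <= q ^+ #|I| * #|bijections|%:R.
Proof.
move=> /andP[q0 q1] Sq.
move: {2}#|I| (erefl #|I|) => d; elim: d I => [|d IH] I Id.
  rewrite Id expr0 mul1r ler_nat; apply/subset_leq_card/subsetP => pi.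
  by rewrite inE => /andP[].
have /card_gt0P[e eI] : (0 < #|I|)%N by rewrite Id.
have cI := cardsD1 e I; rewrite eI Id add1n in cI; case: cI => cI.
have := @card_late_step (I :\ e) e; rewrite setD1K // !inE eqxx /= -cI => /(_ isT) step.
have {IH} := IH (I :\ e) (esym cI); rewrite -cI Id => IH.
have dm : (d < m)%N by rewrite -cardE -Id max_card.
have md : 0 < (m - d)%:R :> R by rewrite ltr0n subn_gt0.
rewrite -(ler_pM2r md) -natrM step natrM exprS.
have : (#|S| - d)%:R <= q * (m - d)%:R :> R.
  have [Sd|dS] := leqP #|S| d.
    by rewrite (eqP (_ : #|S| - d == 0)%N) ?subn_eq0 // mulr_ge0 ?ler0n.
  rewrite !natrB 1?ltnW //; have : 0 <= d%:R * (1 - q) by rewrite mulr_ge0 ?ler0n ?subr_ge0.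
  by lra.
move=> le; apply: le_trans (_ : #|late (I :\ e)|%:R * (q * (m - d)%:R) <= _).
  by rewrite ler_wpM2l ?ler0n.
have := ler_wpM2r (mulr_ge0 q0 (ltW md)) IH; lra.
Qed.

Lemma ffact_ratio (a b i d : nat) : (a <= b)%N ->
  ((a - i) ^_ d * b ^_ d <= a ^_ d * (b - i) ^_ d)%N.
Proof.
move=> ab; elim: d => [|d IH]; first by rewrite !ffactn0.
rewrite !ffactnSr mulnACA [leqRHS]mulnACA; apply: leq_mul IH _.
by clear -ab; nia.
Qed.

Lemma ffactnD (c i d : nat) : (c ^_ (i + d) = c ^_ i * (c - i) ^_ d)%N.
Proof.
elim: d => [|d IH]; first by rewrite addn0 ffactn0 muln1.
by rewrite addnS !ffactnSr IH subnDA mulnA.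
Qed.

(** Sampling without replacement gives negative correlation, which after clearing denominators is
    [ffact_ratio]. *)
Lemma card_late_indep I J : [disjoint I & J] -> #|I| = #|J| ->
  (#|late (I :|: J)| * #|bijections| <= #|late I| * #|late J|)%N.
Proof.
move=> IJ cIJ; have [Sm mE] : (#|S| <= m)%N /\ (#|I :|: J| <= m)%N.
  by rewrite -[X in (_ <= X)%N /\ _]card_ord max_card -cardE max_card.
have cU : #|I :|: J| = (#|I| + #|J|)%N by rewrite cardsU disjoint_setI0 // cards0 subn0.
have lI := card_late I; have lJ := card_late J; have lU := card_late (I :|: J).
rewrite cU -cIJ in lU mE; rewrite -cIJ in lJ; move: lI lJ lU mE.
set d := #|I|; move: #|late I| #|late J| #|late (I :|: J)| #|bijections|.
move=> lI lJ lU B hI hJ hU mE.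
have ffD c : (c ^_ (d + d) = c ^_ d * (c - d) ^_ d)%N by apply: ffactnD.
have r := ffact_ratio d d Sm.
have p1 : (0 < m ^_ d)%N by rewrite ffact_gt0; lia.
have p2 : (0 < (m - d) ^_ d)%N by rewrite ffact_gt0; lia.
rewrite !ffD in hU.
rewrite -(leq_pmul2l (m := m ^_ d * m ^_ d * (m - d) ^_ d)) ?muln_gt0 ?p1 //.
have -> : (m ^_ d * m ^_ d * (m - d) ^_ d * (lU * B) =
    m ^_ d * B * (lU * (m ^_ d * (m - d) ^_ d)))%N by clear; nia.
have -> : (m ^_ d * m ^_ d * (m - d) ^_ d * (lI * lJ) =
    (m - d) ^_ d * (lI * m ^_ d) * (lJ * m ^_ d))%N by clear; nia.
rewrite hI hJ hU.
have -> : (m ^_ d * B * (B * (#|S| ^_ d * (#|S| - d) ^_ d)) =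
    B * B * #|S| ^_ d * ((#|S| - d) ^_ d * m ^_ d))%N by clear; nia.
have -> : ((m - d) ^_ d * (B * #|S| ^_ d) * (B * #|S| ^_ d) =
    B * B * #|S| ^_ d * (#|S| ^_ d * (m - d) ^_ d))%N by clear; nia.
by rewrite leq_mul2l r orbT.
Qed.

Lemma ffact_ratio_ge (R : realFieldType) (r : R) (a b d e : nat) : 0 <= r -> 
  (d <= e)%N -> r * b%:R + e%:R <= a%:R -> r ^+ d * (b ^_ d)%:R <= (a ^_ d)%:R.
Proof.
move=> r0 + rab; elim: d => [|d IH] de; first by rewrite !ffactn0 expr0 mul1r.
have ea : e%:R <= a%:R :> R by have := mulr_ge0 r0 (ler0n R b); lra.
rewrite !ffactnSr !natrM exprSr mulrACA; apply: ler_pM.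
- by rewrite mulr_ge0 ?exprn_ge0 ?ler0n.
- by rewrite mulr_ge0 ?ler0n.
- exact: IH (ltnW de).
have da : (d <= a)%N by rewrite -(ler_nat R) (le_trans _ ea) // ler_nat ltnW.
have de' : d%:R <= e%:R :> R by rewrite ler_nat ltnW.
have : r * (b - d)%:R <= r * b%:R by rewrite ler_wpM2l // ler_nat leq_subr.
rewrite (natrB _ da); lra.
Qed.

(** Chebyshev's inequality for the number X of late sets: negative correlation makes the variance at
    most the mean, so X = 0 has probability at most the inverse of the mean. *)
Lemma second_moment (R : realFieldType) (T : finType) (D : {set T}) (F : T -> {set E})
    (d : nat) (r : R) :
    {in D, forall v, #|F v| = d} -> {in D &, forall v w, v != w -> [disjoint F v & F w]} ->
    0 <= r -> r * m%:R + d%:R <= #|S|%:R ->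
  #|[set pi in bijections | [forall v in D, pi \notin late (F v)]]|%:R * (#|D|%:R * r ^+ d)
    <= #|bijections|%:R.
Proof.
move=> Fd Fdisj r0 rm; set Z := [set _ in _ | _].
have [->|[v0 v0D]] := set_0Vmem D; first by rewrite cards0 mul0r mulr0 ler0n.
have dm : (d <= m)%N by rewrite -(Fd v0 v0D) -cardE max_card.
have m_gt0 : 0 < (m ^_ d)%:R :> R by rewrite ltr0n ffact_gt0.
have [B0|B_gt0] := posnP #|bijections|.
  rewrite B0 (_ : #|Z| = 0%N) ?mul0r //; apply/eqP; rewrite -leqn0 -B0.
  by apply/subset_leq_card/subsetP => pi; rewrite inE => /andP[].
set B : R := #|bijections|%:R; have {}B_gt0 : 0 < B by rewrite ltr0n.
set rho : R := (#|S| ^_ d)%:R / (m ^_ d)%:R.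
have lateE v : v \in D -> #|late (F v)|%:R = B * rho.
  move=> vD; rewrite /rho mulrA; apply/eqP; rewrite eq_sym; apply/eqP.
  apply: (mulIf (lt0r_neq0 m_gt0)); rewrite divfK ?gt_eqF // -!natrM.
  by rewrite -(Fd v vD) -card_late.
have rho_ge : r ^+ d <= rho.
  by rewrite ler_pdivlMr //; apply: ffact_ratio_ge rm.
have rho0 : 0 <= rho by apply: le_trans rho_ge; apply: exprn_ge0.
set mu : R := #|D|%:R * rho.
have mu_ge : #|D|%:R * r ^+ d <= mu by rewrite ler_wpM2l ?ler0n.
apply: le_trans (ler_wpM2l (ler0n R #|Z|) mu_ge) _.
pose X pi : R := \sum_(v in D) (pi \in late (F v))%:R.
have sumX : \sum_(pi in bijections) X pi = B * mu.
  rewrite exchange_big /= /mu mulrCA mulr_natl -sumr_const; apply: eq_bigr => v vD.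
  rewrite -(lateE v vD) -sum1_card natr_sum big_mkcond [RHS]big_mkcond.
  by apply: eq_bigr => pi _; rewrite [pi \in late _]inE; case: (pi \in bijections); case: (_ \subset _).
have sumX2 : \sum_(pi in bijections) X pi ^+ 2 <= B * mu + B * mu ^+ 2.
  have -> : \sum_(pi in bijections) X pi ^+ 2 =
      \sum_(v in D) \sum_(w in D) #|late (F v :|: F w)|%:R.
    transitivity (\sum_(pi in bijections) \sum_(v in D) \sum_(w in D)
        (pi \in late (F v :|: F w))%:R : R).
      apply: eq_bigr => pi _; rewrite expr2 {1}/X mulr_suml; apply: eq_bigr => v _.
      rewrite mulr_sumr; apply: eq_bigr => w _; rewrite !inE subUset.
      by case: (injectiveb pi && _); case: (F v \subset _); case: (F w \subset _); rewrite /= ?mul1r ?mul0r.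
    rewrite exchange_big; apply: eq_bigr => v _; rewrite exchange_big; apply: eq_bigr => w _.
    rewrite -sum1_card natr_sum big_mkcond [RHS]big_mkcond.
    by apply: eq_bigr => pi _; rewrite [pi \in late _]inE; case: (pi \in bijections); case: (_ \subset _).
  have -> : B * mu + B * mu ^+ 2 = \sum_(v in D) (B * rho + \sum_(w in D) B * rho ^+ 2).
    rewrite !sumr_const /mu; ring.
  apply: ler_sum => v vD; rewrite (bigD1 v) //= setUid lateE // lerD2l.
  apply: le_trans (_ : \sum_(w in D | w != v) B * rho ^+ 2 <= _).
    apply: ler_sum => w /andP[wD wv].
    rewrite -(ler_pM2r B_gt0) -natrM.
    have -> : B * rho ^+ 2 * B = (#|late (F v)| * #|late (F w)|)%:R.
      by rewrite natrM !lateE //; ring.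
    rewrite ler_nat; apply: card_late_indep; last by rewrite !Fd.
    by apply: Fdisj; rewrite // eq_sym.
  rewrite [leRHS](bigD1 v) //= lerDr mulr_ge0 ?(ltW B_gt0) // sqr_ge0 //.
have sumZ : #|Z|%:R * mu ^+ 2 <= \sum_(pi in bijections) (X pi - mu) ^+ 2.
  rewrite mulr_natl -sumr_const big_mkcond [leRHS]big_mkcond; apply: ler_sum => pi _.
  rewrite [pi \in Z]inE; case: (pi \in bijections) => //=.
  case: (boolP [forall _ in _, _]) => [/forall_inP noF|_]; last exact: sqr_ge0.
  rewrite (_ : X pi = 0) ?sub0r ?sqrrN // /X big1 // => v vD.
  by rewrite (negPf (noF v vD)).
have sumE : \sum_(pi in bijections) (X pi - mu) ^+ 2 =
    \sum_(pi in bijections) X pi ^+ 2 - 2 * mu * (B * mu) + B * mu ^+ 2.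
  rewrite -sumX mulr_sumr /B [_ * mu ^+ 2]mulr_natl -sumr_const -sumrB -big_split.
  by apply: eq_bigr => pi _ /=; ring.
have mu0 : 0 <= mu by rewrite mulr_ge0 ?ler0n.
have [mu_eq0|mu_neq0] := eqVneq mu 0; first by rewrite mu_eq0 mulr0 ltW.
have mu_gt0 : 0 < mu by rewrite lt_neqAle eq_sym mu_neq0.
by rewrite -(ler_pM2r mu_gt0) -mulrA -expr2; move: sumZ; rewrite sumE; lra.
Qed.
End RandomLabelling.

(** * Reduction to three bad events *)

Section Reduction.
Variables k n : nat.
Hypothesis nE : n = (2 * k + 1)%N.
Notation V := (ksubset n k).
Notation edge := (edge n k).
Notation m := (num_edges n k).
Implicit Types (u v w : V) (A B F : {set V}) (x : 'I_n) (pi : labelling n k) (e : edge).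

Lemma card_edge : #|{: edge}| = m.
Proof. by rewrite card_sig; apply: eq_card => e; rewrite inE. Qed.

Lemma edge_orders_bijections : edge_orders n k = bijections edge m.
Proof. by apply/setP => pi; rewrite !inE. Qed.

Lemma mem_kneser_edges u v : v \in nbrs u -> [set u; v] \in kneser_edges n k.
Proof.
rewrite !inE => uv; apply/existsP; exists u; apply/existsP; exists v.
by rewrite eqxx uv.
Qed.

Lemma kneser_edgeP (d : {set V}) : d \in kneser_edges n k ->
  exists u v, d = [set u; v] /\ v \in nbrs u.
Proof.
rewrite inE => /existsP[u /existsP[v /andP[/eqP -> uv]]].
by exists u, v; rewrite inE.
Qed.

(** Labels being 0-based, the edges absent at time [i] are exactly those labelled at least [i]. *)
Definition labels_from i : {set 'I_m} := [set j : 'I_m | i <= j].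
Definition edges_in F : {set edge} := [set e : edge | val e \subset F].

Lemma independentE pi i F :
  independent (process pi i) F = (edges_in F \subset pi @^-1: labels_from i).
Proof.
apply/forall_inP/subsetP => [ind e|ind d /imsetP[e]].
  rewrite !inE => eF; rewrite leqNgt; apply/negP => ei.
  have /ind : val e \in process pi i by apply/imsetP; exists e; rewrite ?inE.
  by rewrite eF.
rewrite inE => ei ->; apply/negP => eF; have := ind e.
by rewrite !inE leqNgt ei => /(_ eF).
Qed.

Lemma independent_anti pi i j F : i <= j ->
  independent (process pi j) F -> independent (process pi i) F.
Proof.
rewrite !independentE => ij /subset_trans; apply; apply/subsetP => e.
by rewrite !inE; apply: leq_trans.
Qed.

Lemma edges_inS F F' : F \subset F' -> edges_in F \subset edges_in F'.
Proof. by move=> FF'; apply/subsetP => e; rewrite !inE => /subset_trans; apply. Qed.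

Lemma independentS pi i F F' : F \subset F' ->
  independent (process pi i) F' -> independent (process pi i) F.
Proof. by rewrite !independentE => FF'; apply/subset_trans/edges_inS. Qed.

Lemma inner_degrees_le F : inner_degrees F <= 2 * #|edges_in F|.
Proof.
pose P := [set p : V * V | [&& p.1 \in F, p.2 \in F & p.2 \in nbrs p.1]].
have -> : inner_degrees F = #|P|.
  rewrite /inner_degrees -[RHS]sum1_card.
  rewrite (eq_bigl (fun p : V * V => (p.1 \in F) && (p.2 \in nbrs p.1 :&: F))).
    rewrite -(pair_big_dep (fun u => u \in F) (fun u v => v \in nbrs u :&: F) (fun _ _ => 1)) /=.
    by apply: eq_bigr => u _; rewrite sum1_card.
  by move=> p; rewrite !inE; case: (p.1 \in F); case: (p.2 \in F); rewrite /= ?andbT ?andbF.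
pose Q (d : {set V}) := [set p in P | [set p.1; p.2] == d].
have sub : P \subset \bigcup_(e in edges_in F) Q (val e).
  apply/subsetP => p pP; move: (pP); rewrite inE => /and3P[p1 p2 p12].
  apply/bigcupP; exists (Sub [set p.1; p.2] (mem_kneser_edges p12) : edge).
    by rewrite inE /= subUset !sub1set p1.
  by rewrite inE pP /=.
apply: leq_trans (subset_leq_card sub) (leq_trans (leq_card_bigcup _ _) _).
rewrite mulnC -sum_nat_const; apply: leq_sum => e _.
have [a [b [eab _]]] := kneser_edgeP (valP e).
apply: leq_trans (_ : #|[set (a, b); (b, a)]| <= 2); last by rewrite cards2; case: eqP.
apply/subset_leq_card/subsetP => -[c d]; rewrite !inE /= eab => /andP[_ /eqP E].
have /setP Ec := E; move: (Ec a) (Ec b) (Ec c) (Ec d).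
rewrite !inE !eqxx !orbT /= !xpair_eqE ![a == _]eq_sym ![b == _]eq_sym.
by case: (c == a) / eqP => [->|_]; case: (d == a) / eqP => [->|_];
   case: eqP => //= [<-|_]; rewrite ?eqxx ?orbT //=; case: eqP => //= ->; rewrite ?eqxx.
Qed.

Definition lost_edges x A B : {set edge} :=
  [set e : edge | [exists u in A, [exists v in star k x :\: B, val e == [set u; v]]]].

Lemma card_lost_edges x A B : A \subset ~: star k x ->
  lost x A B <= #|lost_edges x A B|.
Proof.
move=> AL.
pose P := [set p : V * V | (p.1 \in A) && (p.2 \in nbrs p.1 :&: star k x :\: B)].
have -> : lost x A B = #|P|.
  rewrite /lost -[RHS]sum1_card.
  rewrite (eq_bigl (fun p : V * V => (p.1 \in A) && (p.2 \in nbrs p.1 :&: star k x :\: B))).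
    rewrite -(pair_big_dep (fun u => u \in A) (fun u v => v \in nbrs u :&: star k x :\: B) (fun _ _ => 1)) /=.
    by apply: eq_bigr => u _; rewrite sum1_card.
  by move=> p; rewrite inE.
pose pair (p : V * V) := [set p.1; p.2].
have inj : {in P &, injective pair}.
  move=> [u v] [u' v']; rewrite !inE /= => /andP[uA /and3P[_ _ vx]] /andP[u'A /and3P[_ _ v'x]].
  have ux := subsetP AL u uA; have u'x := subsetP AL u' u'A; rewrite !inE in ux u'x.
  rewrite /pair /= => /setP E; move: (E u) (E v); rewrite !inE !eqxx !orbT /=.
  have -> : (u == v') = false by apply: contraNF ux => /eqP ->.
  have -> : (v == u') = false by apply: contraNF u'x => /eqP <-.
  by rewrite orbF /= => /esym/eqP -> /esym/eqP ->.
rewrite -(card_in_imset inj) -[leqRHS](card_imset _ val_inj).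
apply/subset_leq_card/subsetP => d /imsetP[[u v]]; rewrite inE => /andP[/= uA].
rewrite !inE => /andP[vB /andP[uv vx]] ->.
have uv' : v \in nbrs u by rewrite inE.
apply/imsetP; exists (Sub [set u; v] (mem_kneser_edges uv') : edge) => //.
rewrite inE; apply/existsP; exists u; rewrite uA; apply/existsP; exists v.
by rewrite !inE vB vx /=.
Qed.

Lemma lost_edges_in x F :
  lost_edges x (F :\: star k x) (star k x :\: F) \subset edges_in F.
Proof.
apply/subsetP => e; rewrite !inE => /existsP[u /andP[uF /existsP[v /andP[vF /eqP ->]]]].
rewrite subUset !sub1set; move: uF vF; rewrite !inE => /andP[_ ->] /=.
by rewrite negb_and negbK; case: (x \in val v); rewrite /= ?andbF ?orbF ?andbT.
Qed.

Lemma card_lost_star x v : v \notin star k x -> k <= #|lost_edges x [set v] set0|.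
Proof.
move=> vx; apply: leq_trans (card_lost_edges _ _); last by rewrite sub1set inE.
by rewrite /lost big_set1 setD0 card_nbrs_star.
Qed.

Lemma disjoint_lost_star x v w : v \notin star k x -> w \notin star k x -> v != w ->
  [disjoint lost_edges x [set v] set0 & lost_edges x [set w] set0].
Proof.
move=> vx wx vw; rewrite -setI_eq0; apply/eqP/setP => e; rewrite !inE; apply/negP.
case/andP => /existsP[v' /andP[/set1P -> /existsP[r /andP[rx /eqP ->]]]].
move=> /existsP[w' /andP[/set1P -> /existsP[r' /andP[r'x /eqP /setP /(_ v)]]]].
rewrite !inE eqxx (negPf vw) /= => /esym/eqP vr'.
by move: r'x vx; rewrite -vr' !inE /= => ->.
Qed.

Lemma not_nbrs_self u : 0 < k -> u \notin nbrs u.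
Proof.
by move=> k_gt0; rewrite inE -setI_eq0 setIid -cards_eq0 card_val -lt0n.
Qed.

Lemma not_nbrs_star x u v : u \in star k x -> v \in star k x -> v \notin nbrs u.
Proof.
move=> ux vx; apply/negP => uv.
by have := subsetP (nbrs_star ux) v uv; rewrite inE vx.
Qed.

Lemma superstar_edges x v : 0 < k ->
  edges_in (v |: star k x) \subset lost_edges x [set v] set0.
Proof.
move=> k_gt0; apply/subsetP => e; rewrite [e \in edges_in _]inE [e \in lost_edges _ _ _]inE.
have [a [b [-> ab]]] := kneser_edgeP (valP e).
rewrite subUset !sub1set !in_setU1 => /andP[a_in b_in].
apply/existsP; exists v; rewrite set11 setD0 /=; apply/existsP.
case/predU1P: a_in => [av|ax]; case/predU1P: b_in => [bv|bx].
- by move: ab; rewrite av bv (negPf (not_nbrs_self v k_gt0)).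
- by exists b; rewrite bx av eqxx.
- by exists a; rewrite ax bv setUC eqxx.
- by rewrite (negPf (not_nbrs_star ax bx)) in ab.
Qed.

Lemma star_independent x pi i : independent (process pi i) (star k x).
Proof.
rewrite independentE; apply/subsetP => e; rewrite inE.
have [a [b [-> ab]]] := kneser_edgeP (valP e).
rewrite subUset !sub1set => /andP[ax bx].
by rewrite (negPf (not_nbrs_star ax bx)) in ab.
Qed.

Definition present_nbrs pi i x A : {set V} :=
  [set r in star k x | [exists v in A, [set v; r] \in process pi i]].

Lemma edge_nbrs u v : [set u; v] \in kneser_edges n k -> v \in nbrs u.
Proof.
case/kneser_edgeP => a [b [E ab]].
have : a \in [set u; v] by rewrite E set21.
have : b \in [set u; v] by rewrite E set22.
have : v \in [set a; b] by rewrite -E set22.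
have : u \in [set a; b] by rewrite -E set21.
case/set2P => ->; case/set2P => ->.
- by rewrite setUid => /set1P ba _; rewrite -{1}ba.
- by [].
- by rewrite nbrs_sym.
- by rewrite setUid => _ /set1P ab'; rewrite -{2}ab'.
Qed.

Lemma process_adj pi i u v : [set u; v] \in process pi i -> v \in nbrs u.
Proof. by case/imsetP => e _ E; apply: edge_nbrs; rewrite E; apply: valP. Qed.

Lemma card_lost_star_eq x v : v \notin star k x -> #|lost_edges x [set v] set0| = k.
Proof.
move=> vx; apply/eqP; rewrite eqn_leq card_lost_star // andbT.
rewrite -[leqRHS](card_nbrs_star nE vx) -[leqLHS](card_imset _ val_inj).
apply: leq_trans (leq_imset_card (fun r => [set v; r]) _).
apply/subset_leq_card/subsetP => _ /imsetP[e + ->].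
rewrite inE => /existsP[_ /andP[/set1P -> /existsP[r /andP[+ /eqP er]]]].
rewrite setD0 => rx; apply/imsetP; exists r; rewrite // in_setI rx andbT.
by apply: edge_nbrs; rewrite -er; apply: valP.
Qed.

Lemma present_nbrs_sub pi i x A :
  present_nbrs pi i x A \subset star k x :&: nbh A.
Proof.
apply/subsetP => r; rewrite inE => /andP[rx /existsP[v /andP[vA vr]]].
rewrite inE rx; apply/bigcupP; exists v => //; exact: process_adj vr.
Qed.

Lemma lost_present_late pi i x A :
  lost_edges x A (present_nbrs pi i x A) \subset pi @^-1: labels_from i.
Proof.
apply/subsetP => e; rewrite [e \in lost_edges _ _ _]inE.
case/existsP => u /andP[uA /existsP[v /andP[+ /eqP euv]]].
rewrite in_setD => /andP[+ vx]; rewrite inE vx /= negb_exists => /forallP/(_ u).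
rewrite uA /= !inE leqNgt; apply: contra => ei; apply/imsetP; exists e; last by rewrite euv.
by rewrite inE.
Qed.

(* A minimal violation of Hall's condition is linked: otherwise one of two parts
   without common neighbours violates it too. *)
Lemma minimal_violator pi i x A : #|present_nbrs pi i x A| < #|A| ->
  exists A0, [/\ A0 \subset A, #|present_nbrs pi i x A0| < #|A0| & linked x A0].
Proof.
move=> viol; pose P A0 := (A0 \subset A) && (#|present_nbrs pi i x A0| < #|A0|).
have PA : P A by rewrite /P subxx.
case: (arg_minnP (fun A0 => #|A0|) PA) => A0 /andP[A0A viol0] A0min.
exists A0; split=> //; apply/forallP => A1; apply/implyP => /andP[/andP[A1A0 A1n0] A1n].
apply: contraT => /existsPn no.
have noc u v : u \in A1 -> v \in A0 :\: A1 -> ~~ common_in x u v.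
  by move=> uA1 vA; have := no u; rewrite uA1 => /existsPn/(_ v); rewrite vA.
have sz : #|A1| + #|A0 :\: A1| = #|A0| by rewrite -(cardsID A1 A0) (setIidPr A1A0).
have A1lt : #|A1| < #|A0| by rewrite proper_card // properEneq A1n.
have A2lt : #|A0 :\: A1| < #|A0|.
  by rewrite -sz -[X in X < _]add0n ltn_add2r card_gt0.
have small A2 : A2 \subset A0 -> #|A2| < #|A0| -> #|A2| <= #|present_nbrs pi i x A2|.
  move=> A2A0 A2lt0; rewrite leqNgt; apply/negP => viol2.
  have /A0min : P A2 by rewrite /P viol2 (subset_trans A2A0 A0A).
  by rewrite /= leqNgt A2lt0.
have s1 := small _ A1A0 A1lt; have s2 := small _ (subsetDl A0 A1) A2lt.
have dis : present_nbrs pi i x A1 :&: present_nbrs pi i x (A0 :\: A1) = set0.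
  apply/setP => r; rewrite [RHS]inE; apply/negP => /setIP[].
  rewrite [r \in present_nbrs _ _ _ A1]inE => /andP[rx /existsP[u /andP[uA1 ur]]].
  rewrite inE rx /= => /existsP[v /andP[vA vr]].
  case/negP: (noc u v uA1 vA); apply/set0Pn; exists r.
  by rewrite 2!in_setI rx (process_adj ur) (process_adj vr).
have uni : present_nbrs pi i x A1 :|: present_nbrs pi i x (A0 :\: A1) \subset present_nbrs pi i x A0.
  apply/subsetP => r; rewrite !inE -andb_orr => /andP[-> /=].
  case/orP => /existsP[v /andP[vA vr]]; apply/existsP; exists v; rewrite vr andbT.
    exact: subsetP vA.
  by move: vA; rewrite inE => /andP[].
have := subset_leq_card uni; rewrite cardsU dis cards0 subn0 => le.
by move: viol0; rewrite ltnNge -sz (leq_trans (leq_add s1 s2)).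
Qed.

Let L := 'C(2 * k, k).
Let M := 'C(2 * k, k.-1).

(** This is the favourable event: some superstar is still independent at time [i], so [tau_super]
    has not occurred by then. *)
Definition no_early_superstar i pi : bool :=
  [exists x, exists v, (v \notin star k x) &&
     (pi \in late (labels_from i) (lost_edges x [set v] set0))].

(** The threshold 1024 is twice the 512 of [near_some_star], an edge being counted up to twice in
    [inner_degrees]. *)
Definition far_bad i F pi : bool :=
  [&& #|F| == M.+1, L <= 1024 * #|edges_in F| & pi \in late (labels_from i) (edges_in F)].

Definition near_bad i x A B pi : bool :=
  [&& [&& A \subset ~: star k x, B \subset star k x :&: nbh A & #|B| < #|A|],
      1 < #|A|, 15 * #|A| <= 7 * L, linked x A
    & pi \in late (labels_from i) (lost_edges x A B)].

Lemma superstarP F : reflect (exists x v, v \notin star k x /\ F = v |: star k x) (superstar F).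
Proof.
apply: (iffP existsP) => [[x /existsP[v /andP[vx /eqP ->]]]|[x [v [vx ->]]]].
  by exists x, v.
by exists x; apply/existsP; exists v; rewrite vx eqxx.
Qed.

Lemma exists_subset_card (T : finType) (F : {set T}) d : d <= #|F| ->
  exists2 F' : {set T}, F' \subset F & #|F'| = d.
Proof.
move=> dF; have : 0 < #|[set F' : {set T} | F' \subset F & #|F'| == d]|.
  by rewrite cards_draws bin_gt0.
by case/card_gt0P => F'; rewrite inE => /andP[F'F /eqP]; exists F'.
Qed.

Lemma inner_degreesS F F' : F \subset F' -> inner_degrees F <= inner_degrees F'.
Proof.
move=> FF'; rewrite /inner_degrees [leqRHS](big_setID F) /= (setIidPr FF').
apply: leq_trans (leq_addr _ _); apply: leq_sum => v _.
exact/subset_leq_card/setIS.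
Qed.

(** The bad events refer to the fixed time [i]. Edges absent at the random time [t] are already
    absent at [i], because i <= t. *)
Lemma hitting_times_agree i pi : 13 < k -> 420 <= L -> pi \in edge_orders n k ->
    no_early_superstar i pi -> (forall F, ~~ far_bad i F pi) ->
    (forall x A B, ~~ near_bad i x A B pi) ->
  pi \in tau_alpha_eq_tau_super n k.
Proof.
move=> k13 L420 piB early nofar nonear; have k_gt0 : 0 < k by apply: leq_trans k13.
rewrite edge_orders_bijections in piB.
pose P j := [forall F : {set V}, superstar F ==> ~~ independent (process pi j) F].
(* At time m every edge is present, so the minimum exists and is at most m. *)
have Pm : P m.
  apply/forall_inP => F /superstarP[x [v [vx ->]]].
  have /card_gt0P[r] : 0 < #|nbrs v :&: star k x| by rewrite card_nbrs_star.
  rewrite inE => /andP[vr rx]; rewrite independentE; apply/subsetPn.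
  exists (Sub [set v; r] (mem_kneser_edges vr) : edge).
    by rewrite inE /= subUset !sub1set !in_setU1 eqxx rx orbT.
  by rewrite !inE -ltnNge ltn_ord.
have Pmono j j' : j <= j' -> P j -> P j'.
  move=> jj' /forall_inP Pj; apply/forall_inP => F /Pj; apply: contra.
  exact: independent_anti.
have [t Pt tmin] := ex_minnP (ex_intro P m Pm).
have tm : t < m.+1 by rewrite ltnS tmin.
have it : i <= t.
  have [x /existsP[v /andP[vx late_v]]] := existsP early.
  rewrite leqNgt; apply/negP => ti.
  have /forall_inP/(_ (v |: star k x)) : P i by apply: Pmono Pt; apply: ltnW.
  rewrite independentE => /(_ _)/negP; apply.
    by apply/superstarP; exists x, v.
  apply: subset_trans (superstar_edges x v k_gt0) _.
  by move: late_v; rewrite inE => /andP[].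
have late_t (I : {set edge}) : I \subset pi @^-1: labels_from t -> pi \in late (labels_from i) I.
  move=> It; rewrite inE piB /=; apply: subset_trans It _.
  by apply/subsetP => e; rewrite !inE; apply: leq_trans.
rewrite inE; apply/existsP; exists (Ordinal tm) => /=; apply/andP; split; last first.
  apply/andP; split=> //; apply/forallP => j; apply/negP => /tmin.
  by rewrite leqNgt ltn_ord.
have nM : 'C(n.-1, k.-1) = M by rewrite nE addn1.
have x0 : 'I_n by rewrite nE addn1; apply: ord0.
rewrite /is_tau_alpha /is_first nM; apply/andP; split; last first.
  apply/forallP => j; apply/negP => /eqP alphaj.
  have : ~~ P j by apply/negP => /tmin; rewrite leqNgt ltn_ord.
  rewrite negb_forall => /existsP[F]; rewrite negb_imply negbK => /andP[/superstarP[x [v [vx FE]]] indF].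
  have : #|F| <= M.
    by rewrite -alphaj; apply: (@leq_bigmax_cond _ _ (fun F : {set V} => #|F|)).
  by rewrite FE cardsU1 vx card_star // ltnn.
rewrite eqn_leq; apply/andP; split; last first.
  have <- : #|star k x0| = M by apply: card_star.
  by apply: (@leq_bigmax_cond _ _ (fun F : {set V} => #|F|)); apply: star_independent.
apply/bigmax_leqP => F' indF'; rewrite leqNgt; apply/negP => /exists_subset_card[F FF' cF].
have {F' FF' indF'} indF := independentS FF' indF'.
have := indF; rewrite independentE => indF_edges.
have fewF : 1024 * #|edges_in F| < L.
  by have := nofar F; rewrite /far_bad cF eqxx late_t // andbT /= -ltnNge.
(* [near_some_star] is about families of size exactly M, so one vertex of F is dropped. *)
have [F0 F0F cF0] := @exists_subset_card _ F M (ltac:(by rewrite cF)).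
have [x xF0] : exists x, 28 * #|F0 :\: star k x| <= 13 * L.
  apply: (near_some_star nE k13 cF0).
  have := inner_degreesS F0F; have := inner_degrees_le F; move: fewF.
  by rewrite -/L; clear; lia.
set A := F :\: star k x; set B := star k x :\: F.
have AL : A \subset ~: star k x by rewrite /A setDE subsetIr.
have cA : #|A| <= #|F0 :\: star k x| + 1.
  have : #|F :\: F0| = 1 by rewrite cardsD (setIidPr F0F) cF cF0 subSnn.
  move=> <-; apply: leq_trans (leq_card_setU _ _); apply/subset_leq_card/subsetP => v.
  by rewrite !inE => /andP[-> ->]; case: (v \in F0).
(* As 7/15 - 13/28 = 1/420, the condition L >= 420 absorbs the dropped vertex. *)
have smallA : 15 * #|A| <= 7 * L.
  by move: cA xF0 L420; move: #|_ :\: star k x| #|A| L; clear; lia.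
have BA : #|B| < #|A|.
  have := cardsID (star k x) F; have := cardsID F (star k x).
  rewrite setIC card_star // cF -/A -/B -/M; clear; lia.
have NB : present_nbrs pi t x A \subset B.
  apply/subsetP => r; rewrite inE => /andP[rx /existsP[v /andP[vA vr]]].
  rewrite inE rx andbT; apply/negP => rF.
  have := forall_inP indF _ vr; rewrite subUset !sub1set rF andbT.
  by move: vA; rewrite inE => /andP[_ ->].
have [A0 [A0A viol linkA0]] := minimal_violator (leq_ltn_trans (subset_leq_card NB) BA).
have A0L := subset_trans A0A AL.
have [A01|A01] := leqP #|A0| 1; last first.
  have := nonear x A0 (present_nbrs pi t x A0); rewrite /near_bad A0L present_nbrs_sub viol A01 linkA0.
  rewrite late_t ?lost_present_late // (leq_trans _ smallA) //.
  by rewrite leq_mul2l subset_leq_card ?orbT.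
have /cards1P[v A0v] : #|A0| == 1 by rewrite eqn_leq A01 (leq_trans _ viol).
have N0 : present_nbrs pi t x A0 = set0.
  by apply/eqP; rewrite -cards_eq0 -leqn0 -ltnS (leq_trans viol).
have vx : v \notin star k x by move: A0L; rewrite A0v sub1set inE.
have := forall_inP Pt (v |: star k x); rewrite independentE => /(_ _)/negP; apply.
  by apply/superstarP; exists x, v.
apply: subset_trans (superstar_edges x v k_gt0) _.
by rewrite -A0v -N0; apply: lost_present_late.
Qed.
End Reduction.

(** * Inequalities for the union bounds *)

Lemma geometric_tail (R : realFieldType) (y : R) (a b : nat) : (0 <= y <= 2^-1)%R ->
  (\sum_(a <= i < b) y ^+ i <= 2 * y ^+ a)%R.
Proof.
move=> /andP[y0 y1]; have [ba|ab] := leqP b a.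
  by rewrite big_geq // mulr_ge0 // exprn_ge0.
have E : ((1 - y) * \sum_(a <= i < b) y ^+ i = y ^+ a - y ^+ b)%R.
  rewrite mulr_sumr; under eq_bigr do rewrite mulrBl mul1r -exprS.
  by rewrite -(opprB (y ^+ b)%R) -(telescope_sumr _ (ltnW ab)) -sumrN; apply: eq_bigr => i _; rewrite opprB.
have yb : (0 <= y ^+ b)%R by rewrite exprn_ge0.
have : (0 <= \sum_(a <= i < b) y ^+ i)%R by apply: sumr_ge0 => i _; rewrite exprn_ge0.
set S := (\sum_(_ <= _ < _) _)%R in E *; nra.
Qed.

(** Both sides are compared through their s-th powers; this turns [powC] into a bound for encodings
    of about c e / s symbols. *)
Lemma root_bound (R : realFieldType) (Y b : R) (s c e i : nat) :
    (0 < s)%N -> (1 <= Y)%R -> (0 <= b)%R -> (Y ^+ c <= b ^+ s)%R -> (s * i <= c * e)%N ->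
  (Y ^+ i <= b ^+ e)%R.
Proof.
move=> s0 Y1 b0 Yb si; have Y0 : (0 <= Y)%R by apply: le_trans Y1.
rewrite -(ler_pXn2r s0) ?nnegrE ?exprn_ge0 // -!exprM mulnC (mulnC e).
apply: le_trans (_ : Y ^+ (c * e) <= _)%R; first by rewrite ler_weXn2l.
by rewrite exprM exprM lerXn2r ?nnegrE ?exprn_ge0.
Qed.

(** The slack between 3/10 and 1/3 pays for the rounding of m / 3 and for the k labels used up by
    sampling without replacement. *)
Lemma threshold_arith (R : realFieldType) (m k c : nat) :
  (1 <= k)%N -> (60 * k <= m)%N -> (m < 3 * (c + 1))%N ->
  (3 / 10 * m%:R + k%:R <= c%:R :> R)%R.
Proof.
move=> k1 km mc; have : (3 * m + 10 * k <= 10 * c)%N by lia.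
by rewrite -(ler_nat R) natrD !natrM; lra.
Qed.

Lemma far_arith (N L e k s : nat) : (N <= 2 * L)%N -> (L <= 1024 * e)%N ->
    (k + 2 <= e)%N -> (s <= k)%N ->
  (4 * N + e + s <= (4 * 2048 + 2) * e)%N /\ (N + s <= 2049 * e)%N.
Proof. by lia. Qed.

Lemma vertices_arith (k N L M : nat) : (0 < k)%N -> N = (L + M)%N ->
  (k * L = k.+1 * M)%N -> (N <= 2 * L)%N.
Proof. by move=> k0 -> kLM; nia. Qed.

Lemma overfull_arith (i a b M : nat) : (i + b = M)%N -> (i + a = M.+1)%N -> (b <= a)%N.
Proof. by lia. Qed.

Lemma two_k_arith (k : nat) : (2 <= k)%N -> (k <= 2 * k - 2)%N.
Proof. by lia. Qed.

(** Per lost edge, 2/5 bounds the probability and 9/8 the number of pairs. The product stays below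
    1/2, and 4 (9/20)^2 < 1 as the vertex count requires. *)
Lemma rate_split (R : realFieldType) : (9 / 20 = 9 / 8 * (2 / 5) :> R)%R.
Proof. by lra. Qed.

Lemma rate_half (R : realFieldType) : (0 <= 9 / 20 :> R)%R && (9 / 20 <= 2^-1 :> R)%R.
Proof. by apply/andP; split; lra. Qed.

Lemma sum3_bound (R : realFieldType) (x1 x2 x3 a1 a2 a3 w : R) :
  (x1 <= a1 * w -> x2 <= a2 * w -> x3 <= a3 * w -> x1 + x2 + x3 <= (a1 + a2 + a3) * w)%R.
Proof. by move=> *; rewrite !mulrDl !lerD. Qed.

(** * Probability of the bad events *)

Section BadProbability.
Variables k n : nat.
Hypothesis nE : n = (2 * k + 1)%N.
Notation V := (ksubset n k).
Notation edge := (edge n k).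
Notation m := (num_edges n k).
Implicit Types (u v w : V) (A B F : {set V}) (x : 'I_n) (pi : labelling n k).
Variables (R : realFieldType) (s : nat).
Hypotheses (k300 : 300 <= k) (s_ge8 : 8 <= s) (s4k : s ^ 4 <= k).
Let L := 'C(2 * k, k).
Let M := 'C(2 * k, k.-1).
Hypothesis L_large : 1024 * (k + 2) <= L.
(** The entropy condition: C e / s symbols with k + 2 values each amount to at most (9/8)^e
    codes. *)
Variable C : nat.
Hypothesis powC : ((k + 2)%:R ^+ C <= (9 / 8) ^+ s :> R)%R.
Let i0 := m - m %/ 3.
Let Omega := bijections edge m.
Let S := labels_from k n i0.

Let k_gt0 : 0 < k. Proof. exact: leq_trans k300. Qed.
Let x0 : 'I_n. Proof. by rewrite nE addn1; apply: ord0. Qed.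

Let card_S : #|S| = m %/ 3.
Proof.
rewrite -sum1_card (eq_bigl (fun i : 'I_m => true && (i0 <= i))) => [|i]; last by rewrite inE.
by rewrite -(big_geq_mkord _ _ xpredT (fun=> 1)) sum_nat_const_nat muln1 subKn // leq_div.
Qed.

Let m_large : k * L <= m.
Proof.
have := card_lost_edges set0 (subxx (~: star k x0)).
rewrite /lost; under eq_bigr => v do rewrite setD0.
rewrite (eq_bigr (fun=> k)) => [|v]; last by rewrite inE => /(card_nbrs_star nE).
rewrite sum_nat_const card_starC // mulnC => /leq_trans; apply.
by rewrite -card_edge max_card.
Qed.

Let late_le (I : {set edge}) d : d <= #|I| ->
  (#|late S I|%:R <= (2 / 5) ^+ d * #|Omega|%:R :> R)%R.
Proof.
move=> dI; have q01 : (0 <= 2 / 5 :> R)%R && (2 / 5 <= 1 :> R)%R by apply/andP; split; lra.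
have Sq : (#|S|%:R <= 2 / 5 * m%:R :> R)%R.
  have : (3 * #|S| <= m)%N by rewrite card_S mulnC leq_divM.
  by rewrite -(ler_nat R) natrM; have := ler0n R m; lra.
apply: le_trans (card_late_le (card_edge k n) I q01 Sq) _.
rewrite ler_wpM2r ?ler0n //; case/andP: q01 => q0 q1.
exact: ler_wiXn2l.
Qed.

Lemma no_early_superstar_prob :
  (#|[set pi in Omega | ~~ no_early_superstar i0 pi]|%:R * (L%:R * (3 / 10) ^+ k)
     <= #|Omega|%:R :> R)%R.
Proof.
have := @second_moment edge m (card_edge k n) S R _ (~: star k x0)
  (fun v => lost_edges x0 [set v] set0) k (3 / 10).
rewrite card_starC // => bound; apply: le_trans (bound _ _ _ _).
- have r0 : (0 <= 3 / 10 :> R)%R by rewrite divr_ge0 ?ler0n.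
  apply: ler_wpM2r; first exact: mulr_ge0 (ler0n _ _) (exprn_ge0 _ r0).
  rewrite ler_nat; apply/subset_leq_card/subsetP => pi; rewrite !inE => /andP[-> /=].
  move=> /existsPn/(_ x0)/existsPn none; apply/forall_inP => v; rewrite inE => vx.
  by have := none v; rewrite vx.
- by move=> v; rewrite inE => vx; apply: card_lost_star_eq.
- by move=> v w; rewrite !in_setC => vx wx; apply: disjoint_lost_star.
- by rewrite divr_ge0 ?ler0n.
have L60 : 60 <= L.
  by apply: leq_trans L_large; rewrite mulnDr (leq_trans _ (leq_addl _ _)).
have : m < 3 * (#|S| + 1) by rewrite card_S addn1 mulnC -ltn_divLR.
have : 60 * k <= m by apply: leq_trans m_large; rewrite mulnC leq_mul2l L60 orbT.
by move=> km mc; apply: threshold_arith.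
Qed.

Definition far_event : {set labelling n k} :=
  \bigcup_(F : {set V} | (#|F| == M.+1) && (L <= 1024 * #|edges_in F|)) late S (edges_in F).

Lemma card_V_le : #|{: V}| <= 2 * L.
Proof.
have NLM : #|{: V}| = L + M by rewrite -(cardsC (star k x0)) addnC card_starC ?card_star.
exact: vertices_arith k_gt0 NLM (mul_bin_central k_gt0).
Qed.

(** Origin of the constant: |V| <= 2 L <= 2048 e, and the code has exponent 5 (i + j) with s i <= 4
    |V| + e + s <= (4 * 2048 + 2) e and s j <= |V| + s <= 2049 e. *)
Lemma card_far_pairs_le e : 5 * ((4 * 2048 + 2) + 2049) <= C -> L <= 1024 * e ->
  (#|far_pairs k x0 e|%:R <= (9 / 8) ^+ e :> R)%R.
Proof.
move=> Cbig Le; have s_gt0 : 0 < s by apply: leq_trans s_ge8.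
have sk : s <= k.
  by apply: leq_trans s4k; rewrite -[X in X <= _]expn1 leq_exp2l // (leq_trans _ s_ge8).
have ke : k + 2 <= e by rewrite -(leq_pmul2l (m := 1024)) // (leq_trans L_large).
have Ve := card_V_le.
pose i := (4 * #|{: V}| + e) %/ s + 1; pose j := #|{: V}| %/ (k + 2) + 1.
have si : 4 * #|{: V}| + e <= s * i.
  by rewrite [leqRHS]mulnC /i addn1 ltnW // -ltn_divLR.
have kj : #|{: V}| <= (k + 2) * j.
  by rewrite [leqRHS]mulnC /j addn1 ltnW // -ltn_divLR // addn2.
have := card_far_pairs nE x0 s_ge8 s4k si kj; rewrite -(ler_nat R) => /le_trans; apply.
apply: le_trans (_ : (k + 2)%:R ^+ (5 * (i + j)) <= _)%R.
  rewrite -natrX ler_nat [5 * _]mulnC expnM; apply: leq_exp2rW; rewrite expnD leq_mul2l.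
  apply/orP; right; apply: leq_exp2rW; apply: leq_trans (leq_addr _ _); exact: leq_trans k300.
have big1 : (1 <= (k + 2)%:R :> R)%R by rewrite ler1n addn2.
apply: (root_bound s_gt0 big1 _ powC); first by lra.
apply: leq_trans (_ : 5 * ((4 * 2048 + 2) + 2049) * e <= _); last by rewrite leq_mul2r Cbig orbT.
have [far1 far2] := far_arith Ve Le ke sk.
rewrite mulnCA -mulnA leq_mul2l /= mulnDr mulnDl; apply: leq_add.
  by apply: leq_trans far1; rewrite /i mulnDr muln1 leq_add2r mulnC leq_divM.
apply: leq_trans far2.
rewrite /j mulnDr muln1 leq_add2r mulnC.
apply: leq_trans (leq_divM #|{: V}| (k + 2)).
by rewrite leq_mul2l (leq_trans sk (leq_addr _ _)) orbT.
Qed.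

(** F is encoded relative to the arbitrary star at [x0], close or not: the pair formed by F minus
    the star and the star minus F loses at most as many edges as F spans. *)
Lemma far_event_prob : 5 * ((4 * 2048 + 2) + 2049) <= C ->
  (#|far_event|%:R <= 2 * (1024 / L%:R) * #|Omega|%:R :> R)%R.
Proof.
move=> Cbig; have L_gt0 : 0 < L by apply: leq_trans L_large; rewrite muln_gt0 addn2.
pose P F := (#|F| == M.+1) && (L <= 1024 * #|edges_in F|).
pose e0 := L %/ 1024.
have e0E : L < 1024 * (e0 + 1) by rewrite mulnC addn1 -ltn_divLR.
have step1 : (#|far_event|%:R <= \sum_(F : {set V} | P F) (2 / 5) ^+ #|edges_in F| * #|Omega|%:R :> R)%R.
  have le : #|far_event| <= \sum_(F in [set F : {set V} | P F]) #|late S (edges_in F)|.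
    rewrite /far_event (eq_bigl (fun F => F \in [set F : {set V} | P F])) => [|F]; last by rewrite inE.
    exact: leq_card_bigcup.
  rewrite -(ler_nat R) natr_sum in le; apply: le_trans le _.
  rewrite [leLHS](eq_bigl P) => [|F]; last by rewrite inE.
  by apply: ler_sum => F _; apply: late_le.
apply: le_trans step1 _; rewrite -mulr_suml ler_wpM2r ?ler0n //.
have step2 : (\sum_(F : {set V} | P F) (2 / 5) ^+ #|edges_in F| <=
    \sum_(e0 <= e < m.+1) (9 / 20) ^+ e :> R)%R.
  rewrite (partition_big (fun F => inord #|edges_in F| : 'I_m.+1) (fun e : 'I_m.+1 => true && (e0 <= e))) /=.
    rewrite (big_geq_mkord _ _ xpredT (fun e => (9 / 20) ^+ e)%R).
    apply: ler_sum => e /= e0e.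
    have PE F : P F -> (inord #|edges_in F| == e) = (#|edges_in F| == e).
      by move=> _; rewrite -val_eqE /= inordK // ltnS -(card_edge k n) max_card.
    have [Le|Le] := leqP L (1024 * e); last first.
      rewrite big_pred0 ?exprn_ge0 ?divr_ge0 ?ler0n // => F.
      apply/negP => /andP[PF]; rewrite PE // => /eqP Fe.
      by move: PF; rewrite /P Fe [L <= _]leqNgt Le andbF.
    rewrite (eq_bigr (fun=> (2 / 5) ^+ e)%R) => [|F /andP[PF]]; last first.
      by rewrite PE // => /eqP ->.
    rewrite sumr_const -[leLHS]mulr_natl.
    rewrite rate_split.
    rewrite [leRHS]exprMn; apply: ler_wpM2r; first by rewrite exprn_ge0 ?divr_ge0 ?ler0n.
    apply: le_trans (card_far_pairs_le Cbig Le); rewrite ler_nat.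
    pose split_pair F := (F :\: star k x0, star k x0 :\: F).
    have split_inj : injective split_pair.
      move=> F F' [/setP E1 /setP E2]; apply/setP => v; move: (E1 v) (E2 v).
      by rewrite !in_setD; case: (v \in star _ _); rewrite /= ?andbT // => _ /negb_inj.
    rewrite -(card_imset _ split_inj); apply/subset_leq_card/subsetP => _ /imsetP[F /andP[PF +] ->].
    rewrite PE // => /eqP Fe.
    rewrite inE /= setDE subsetIr subsetDl /=; apply/andP; split.
      have /andP[/eqP cF _] := PF.
      have := cardsID (star k x0) F; have := cardsID F (star k x0).
      rewrite setIC (card_star nE x0 k_gt0) cF -setDE; exact: overfull_arith.
    rewrite -setDE -Fe; apply: leq_trans (subset_leq_card (lost_edges_in x0 F)).
    by apply: card_lost_edges; rewrite setDE subsetIr.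
  move=> F /andP[_ LF]; rewrite inordK ?ltnS -?(card_edge k n) ?max_card //.
  by rewrite -ltnS ltn_divLR // mulnC (leq_ltn_trans LF) // mulnSr -[X in X < _]addn0 ltn_add2l.
apply: le_trans step2 _; apply: le_trans (geometric_tail _ _ (rate_half R)) _.
rewrite ler_wpM2l ?ler0n // ler_pdivlMr ?ltr0n //.
(* Uses L < 1024 (e0 + 1) and e0 + 1 <= 2^e0. *)
apply: le_trans (_ : (2^-1) ^+ e0 * (1024 * (e0 + 1)%:R) <= _)%R.
  apply: ler_pM; rewrite ?exprn_ge0 ?divr_ge0 ?ler0n //.
    by have /andP[_ h] := rate_half R; rewrite lerXn2r ?nnegrE ?divr_ge0 ?invr_ge0 ?ler0n.
  by rewrite -natrM ler_nat ltnW.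
rewrite mulrCA ler_piMr ?ler0n // exprVn ler_pdivrMl ?exprn_gt0 ?ltr0n // mulr1.
by rewrite -natrX ler_nat addn1 ltn_expl.
Qed.

Definition near_event : {set labelling n k} :=
  [set pi in Omega | [exists x, exists A, exists B, near_bad i0 x A B pi]].

(** Here 122 = 121 + 1, the extra 1 covering the rounding of [i] because s <= l. *)
Lemma card_near_pairs_le x l : 49 * 122 <= C -> s <= l ->
  (#|near_pairs k x l|%:R <= #|{: V}|%:R * (9 / 8) ^+ l :> R)%R.
Proof.
move=> Cbig sl; have s_gt0 : 0 < s by apply: leq_trans s_ge8.
pose i := (121 * l) %/ s + 1.
have si : 121 * l <= s * i by rewrite [leqRHS]mulnC /i addn1 ltnW // -ltn_divLR.
have := card_near_pairs nE x s_ge8 s4k si; rewrite -(ler_nat R) => /le_trans; apply.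
rewrite natrM ler_wpM2l ?ler0n // natrX.
have big1 : (1 <= (k + 2)%:R :> R)%R by rewrite ler1n addn2.
apply: (root_bound s_gt0 big1 _ powC); first by rewrite divr_ge0 ?ler0n.
apply: leq_trans (_ : 49 * 122 * l <= _); last by rewrite leq_mul2r Cbig orbT.
rewrite mulnCA -mulnA leq_mul2l /= /i mulnDr muln1 -[122]/(121 + 1) mulnDl mul1n.
by apply: leq_add sl; rewrite mulnC leq_divM.
Qed.

(** The factor n chooses the star and the number of vertices locates the skeleton;
    [lost_ge_two_stars] makes the geometric series start at 2k - 2. *)
Lemma near_event_prob : 49 * 122 <= C ->
  (#|near_event|%:R <= n%:R * #|{: V}|%:R * (2 * (9 / 20) ^+ (2 * k - 2)) * #|Omega|%:R :> R)%R.
Proof.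
move=> Cbig; have sk : s <= k.
  by apply: leq_trans s4k; rewrite -[X in X <= _]expn1 leq_exp2l // (leq_trans _ s_ge8).
have s2k : s <= 2 * k - 2 by apply: leq_trans sk _; apply: two_k_arith; apply: leq_trans k300.
pose Q x := [set AB : {set V} * {set V} | [&& [&& AB.1 \subset ~: star k x,
  AB.2 \subset star k x :&: nbh AB.1 & #|AB.2| < #|AB.1|], 1 < #|AB.1|,
  15 * #|AB.1| <= 7 * L & linked x AB.1]].
have sub : near_event \subset
    \bigcup_(x in [set: 'I_n]) \bigcup_(AB in Q x) late S (lost_edges x AB.1 AB.2).
  apply/subsetP => pi; rewrite inE => /andP[_ /existsP[x /existsP[A /existsP[B bad]]]].
  case/and5P: bad => AB A1 small linkA lateAB.
  apply/bigcupP; exists x; rewrite ?inE //; apply/bigcupP; exists (A, B) => //.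
  by rewrite inE AB A1 small linkA.
have step1 : (#|near_event|%:R <= \sum_(x in [set: 'I_n]) \sum_(AB in Q x)
    (2 / 5) ^+ lost x AB.1 AB.2 * #|Omega|%:R :> R)%R.
  have le : #|near_event| <= \sum_(x in [set: 'I_n]) \sum_(AB in Q x) #|late S (lost_edges x AB.1 AB.2)|.
    apply: leq_trans (subset_leq_card sub) _; apply: leq_trans (leq_card_bigcup _ _) _.
    by apply: leq_sum => x _; apply: leq_card_bigcup.
  rewrite -(ler_nat R) natr_sum in le; apply: le_trans le _; apply: ler_sum => x _.
  rewrite natr_sum; apply: ler_sum => AB; rewrite inE => /and4P[/and3P[AL _ _] _ _ _].
  exact/late_le/card_lost_edges.
apply: le_trans step1 _; under eq_bigr do rewrite -mulr_suml.
rewrite -mulr_suml ler_wpM2r ?ler0n // -mulrA.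
have nsum Y : (n%:R * Y = \sum_(x in [set: 'I_n]) Y :> R)%R.
  by rewrite sumr_const cardsT card_ord mulr_natl.
rewrite nsum; apply: ler_sum => x _.
apply: le_trans (_ : \sum_(2 * k - 2 <= l < m.+1) #|{: V}|%:R * (9 / 20) ^+ l <= _)%R; last first.
  rewrite -mulr_sumr; apply: ler_wpM2l; first exact: ler0n.
  exact: geometric_tail (rate_half R).
have lostm AB : AB \in Q x -> lost x AB.1 AB.2 < m.+1.
  rewrite inE => /and4P[/and3P[AL _ _] _ _ _]; rewrite ltnS -(card_edge k n).
  exact: leq_trans (card_lost_edges _ AL) (max_card _).
rewrite (partition_big (fun AB => inord (lost x AB.1 AB.2) : 'I_m.+1)
  (fun l : 'I_m.+1 => true && (2 * k - 2 <= l))) /=; last first.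
  move=> AB ABQ; rewrite inordK ?lostm //.
  move: ABQ; rewrite inE => /and4P[/and3P[AL BRN BA] A1 small _].
  apply: (lost_ge_two_stars nE) => //.
  by move: BRN; rewrite subsetI => /andP[].
rewrite (big_geq_mkord _ _ xpredT (fun l => #|{: V}|%:R * (9 / 20) ^+ l)%R).
apply: ler_sum => l /= l2k.
rewrite (eq_bigr (fun=> (2 / 5) ^+ l)%R) => [|AB /andP[ABQ]]; last first.
  by rewrite -val_eqE /= inordK ?lostm // => /eqP ->.
rewrite rate_split.
rewrite sumr_const -[leLHS]mulr_natl [X in (_ <= _ * X)%R]exprMn mulrA.
apply: ler_wpM2r; first by rewrite exprn_ge0 ?divr_ge0 ?ler0n.
apply: le_trans (card_near_pairs_le x Cbig (leq_trans s2k l2k)); rewrite ler_nat.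
apply/subset_leq_card/subsetP => AB /andP[ABQ].
rewrite -val_eqE /= inordK ?lostm // => /eqP ABl.
move: ABQ; rewrite inE => /and4P[/and3P[AL BRN BA] A1 small linkA].
have BR : AB.2 \subset star k x by move: BRN; rewrite subsetI => /andP[].
have := lost_ge_isop nE k_gt0 AL BR (ltnW BA) small; rewrite ABl => Al.
by rewrite inE AL BRN (ltnW BA) (ltnW A1) Al linkA ABl eqxx.
Qed.

Lemma bad_probability : 49 * 122 <= C -> 5 * ((4 * 2048 + 2) + 2049) <= C ->
  (#|edge_orders n k :\: tau_alpha_eq_tau_super n k|%:R <=
   ((L%:R * (3 / 10) ^+ k)^-1 + 2 * (1024 / L%:R)
     + n%:R * #|{: V}|%:R * (2 * (9 / 20) ^+ (2 * k - 2))) * #|edge_orders n k|%:R :> R)%R.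
Proof.
move=> C1 C2; have L_gt0 : 0 < L by apply: leq_trans L_large; rewrite muln_gt0 addn2.
have L420 : 420 <= L by apply: leq_trans L_large; rewrite mulnDr (leq_trans _ (leq_addl _ _)).
pose E1 := [set pi in Omega | ~~ no_early_superstar i0 pi].
have sub : edge_orders n k :\: tau_alpha_eq_tau_super n k \subset E1 :|: far_event :|: near_event.
  apply/subsetP => pi; rewrite in_setD => /andP[notau piO].
  apply: contraR notau; rewrite !in_setU !negb_or => /andP[/andP[nE1 nfar] nnear].
  have piB : pi \in Omega by rewrite /Omega -edge_orders_bijections.
  apply: (hitting_times_agree nE (i := i0)) => //.
  - exact: leq_trans k300.
  - by move: nE1; rewrite inE piB negbK.
  - move=> F; apply: contra nfar => /and3P[cF LF lateF]; apply/bigcupP; exists F => //.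
    by rewrite cF.
  - move=> x A B; apply: contra nnear => bad; rewrite inE piB /=.
    by apply/existsP; exists x; apply/existsP; exists A; apply/existsP; exists B.
have : #|edge_orders n k :\: tau_alpha_eq_tau_super n k| <= #|E1| + #|far_event| + #|near_event|.
  apply: leq_trans (subset_leq_card sub) _; apply: leq_trans (leq_card_setU _ _) _.
  by rewrite leq_add2r; apply: leq_card_setU.
rewrite -(ler_nat R) !natrD => /le_trans; apply.
rewrite edge_orders_bijections; apply: sum3_bound.
- have r0 : (0 < L%:R * (3 / 10) ^+ k :> R)%R.
    by rewrite mulr_gt0 ?exprn_gt0 ?divr_gt0 ?ltr0n.
  by rewrite ler_pdivlMl // mulrC; apply: no_early_superstar_prob.
- exact: far_event_prob.
- exact: near_event_prob.
Qed.
End BadProbability.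

(** * Asymptotic estimates and the limit *)

Lemma central_bin_ge k : (0 < k)%N -> (4 ^ k <= 2 * k * 'C(2 * k, k))%N.
Proof.
elim: k => // k IH _; have [->//|k_gt0] := posnP k.
have E : (k.+1 * 'C(2 * k.+1, k.+1) = 2 * (2 * k).+1 * 'C(2 * k, k))%N.
  rewrite central_bin_half // mulnCA -mulnA; congr (2 * _)%N.
  have -> : ((2 * k.+1).-1 = (2 * k).+1)%N by lia.
  have := mul_bin_down (2 * k).+1 k; rewrite /= => ->.
  by congr (_ * _)%N; lia.
rewrite expnS -mulnA E; have := IH k_gt0; move: ('C(2 * k, k)) (4 ^ k)%N => x y; clear; nia.
Qed.

Lemma bernoulli (R : realFieldType) (c : R) u : (0 <= c)%R -> (u%:R * c <= (1 + c) ^+ u)%R.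
Proof.
move=> c0; elim: u => [|u IH]; first by rewrite mul0r ler01.
have c1 : (1 <= 1 + c)%R by lra.
have := exprn_ege1 u c1; rewrite exprS -(natr1 u).
by move: IH; move: ((1 + c) ^+ u)%R => y; nra.
Qed.

(** With u about s / (D + 1), the bound (9/8)^u >= u / 8 raised to the power D + 1 has one power of
    u to spare over s^D. *)
Lemma poly_le_exp (R : realFieldType) D :
  exists K, forall s, (K <= s)%N -> (s%:R ^+ D <= (9 / 8) ^+ s :> R)%R.
Proof.
pose U := ((2 * D.+1) ^ D * 8 ^ D.+1)%N; exists (D.+1 * U.+1)%N => s sK.
pose u := (s %/ D.+1)%N.
have uU : (U < u)%N by rewrite /u leq_divRL // mulnC.
have s_le : (s <= 2 * D.+1 * u)%N.
  apply: leq_trans (ltnW (ltn_ceil s (ltn0Sn D))) _; rewrite -/u mulnC -mulnA mulnCA leq_mul2l /=.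
  by move: u uU => u; clear; lia.
have s_ge : (D.+1 * u <= s)%N by rewrite mulnC leq_divM.
have b1 : (1 <= 9 / 8 :> R)%R by lra.
have bern j : (j%:R / 8 <= (9 / 8) ^+ j :> R)%R.
  have := @bernoulli R 8^-1 j; rewrite invr_ge0 ler0n => /(_ isT).
  by rewrite (_ : 1 + 8^-1 = 9 / 8 :> R)%R //; lra.
apply: le_trans (_ : ((9 / 8) ^+ u) ^+ D.+1 <= _)%R; last first.
  by rewrite -exprM mulnC ler_weXn2l.
apply: le_trans (_ : (u%:R / 8) ^+ D.+1 <= _)%R; last first.
  apply: lerXn2r (bern u); rewrite nnegrE.
    by rewrite divr_ge0 ?ler0n.
  by rewrite exprn_ge0 ?divr_ge0 ?ler0n.
rewrite expr_div_n ler_pdivlMr ?exprn_gt0 ?ltr0n // -!natrX -natrM ler_nat.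
apply: leq_trans (_ : (2 * D.+1 * u) ^ D * 8 ^ D.+1 <= _)%N.
  by rewrite leq_mul2r leq_exp2rW ?orbT.
rewrite expnMn mulnAC -/U expnS leq_mul2r; apply/orP; right; exact: ltnW.
Qed.

Lemma fourth_root_exists k : exists s, (s ^ 4 <= k < s.+1 ^ 4)%N.
Proof.
have ex : exists s, (s ^ 4 <= k)%N by exists 0%N.
have bnd s : (s ^ 4 <= k)%N -> (s <= k)%N.
  by apply: leq_trans; case: s => // s; rewrite expnS leq_pmulr // expn_gt0.
have [s sk smax] := ex_maxnP ex bnd.
exists s; rewrite sk /= ltnNge; apply/negP => /smax; by rewrite ltnn.
Qed.

(** Take for s the integer part of the fourth root of k; then k + 2 <= s^8, so (k + 2)^C is at most
    a fixed power of s. *)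
Lemma good_root (R : realFieldType) C : exists K, forall k, (K <= k)%N ->
  exists s, [/\ (8 <= s)%N, (s ^ 4 <= k)%N & ((k + 2)%:R ^+ C <= (9 / 8) ^+ s :> R)%R].
Proof.
have [K0 K0P] := poly_le_exp R (8 * C); exists ((maxn 8 K0).+1 ^ 4)%N => k kK.
have [s /andP[sk ks]] := fourth_root_exists k; exists s.
have : (maxn 8 K0 <= s)%N.
  by move: (leq_ltn_trans kK ks); rewrite ltn_exp2r // ltnS => /ltnW.
rewrite geq_max => /andP[s8 sK]; split=> //.
apply: le_trans (K0P s sK); rewrite exprM -!natrX ler_nat; apply: leq_exp2rW.
have s2 : (2 <= s)%N by apply: leq_trans s8.
apply: leq_trans (_ : s.+1 ^ 4 + 1 <= _)%N; first by move: ks; clear; lia.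
apply: leq_trans (_ : (2 * s) ^ 4 + 1 <= _)%N.
  rewrite leq_add2r leq_exp2r //; move: s2; clear; lia.
rewrite expnMn -[(2 ^ 4)%N]/(8 + 8)%N mulnDl.
apply: leq_trans (_ : s * s ^ 4 + s * s ^ 4 + s * s ^ 4 <= _)%N.
  have : (8 * s ^ 4 <= s * s ^ 4)%N by rewrite leq_mul2r s8 orbT.
  have : (0 < s * s ^ 4)%N by rewrite muln_gt0 expn_gt0 (leq_trans _ s2).
  by move: (s * s ^ 4)%N (s ^ 4)%N => a b; clear; lia.
have -> : (8 = 5 + 3)%N by [].
rewrite -expnS -addnA addnn -mul2n -mulSn expnD mulnC leq_mul2l; apply/orP; right.
by apply: leq_trans (_ : 8 ^ 3 <= _)%N; rewrite ?leq_exp2r.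
Qed.

Lemma card_ksubset_le n k : (#|{: ksubset n k}| <= 2 ^ n)%N.
Proof.
rewrite -cardsT -(card_imset _ val_inj) -[X in (2 ^ X)%N]card_ord -cardsT -card_powerset.
by apply/subset_leq_card/subsetP => S _; rewrite powersetE subsetT.
Qed.

(** The leading factor is 4^k (9/20)^(2k) = (81/100)^k, and 81/100 < 5/6. *)
Lemma near_decay (R : realFieldType) k N : (0 < k)%N -> (N <= 2 ^ (2 * k + 1))%N ->
  ((2 * k + 1)%:R * N%:R * (2 * (9 / 20) ^+ (2 * k - 2)) <= 60 * (k%:R * (5 / 6) ^+ k) :> R)%R.
Proof.
case: k => // j _.
have -> : (2 * j.+1 - 2 = 2 * j)%N by lia.
have -> : (2 * j.+1 + 1 = 2 * j + 3)%N by lia.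
rewrite expnD expnM mulnC => N_le.
have NR : (N%:R <= 8 * 4 ^+ j :> R)%R by rewrite -natrX -natrM ler_nat.
have nR : ((2 * j + 3)%:R <= 3 * j.+1%:R :> R)%R by rewrite -natrM ler_nat; lia.
have nN := ler_pM (ler0n R _) (ler0n R _) nR NR.
have q0 : (0 <= (9 / 20) ^+ (2 * j) :> R)%R by rewrite exprn_ge0 // divr_ge0 ?ler0n.
apply: le_trans (ler_wpM2r (mulr_ge0 (ler0n R 2) q0) nN) _.
have E : ((81 / 100) ^+ j = 4 ^+ j * (9 / 20) ^+ (2 * j) :> R)%R.
  by rewrite exprM -exprMn; congr (_ ^+ _)%R; field.
have h : ((81 / 100) ^+ j <= (5 / 6) ^+ j :> R)%R.
  by rewrite lerXn2r ?nnegrE ?divr_ge0 ?ler0n //; lra.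
have d0 : (0 <= (5 / 6) ^+ j :> R)%R by rewrite exprn_ge0 // divr_ge0 ?ler0n.
rewrite exprS; move: E h d0 (ler0n R j.+1).
move: (4 ^+ j)%R ((9 / 20) ^+ (2 * j))%R ((81 / 100) ^+ j)%R ((5 / 6) ^+ j)%R => a b c d.
move: (j.+1%:R : R)%R => K E h d0 K0; have := ler_wpM2l K0 h; rewrite {}E.
have := mulr_ge0 K0 d0.
have -> : (3 * K * (8 * a) * (2 * b) = 48 * (K * (a * b)))%R by ring.
have -> : (60 * (K * (5 / 6 * d)) = 50 * (K * d))%R by field.
by move: (K * (a * b))%R (K * d)%R => X Y; clear; lra.
Qed.

Lemma scale_twentieth (R : realFieldType) (w u v : R) :
  (w * 20^-1 * u <= v -> w * u <= 20 * v)%R.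
Proof.
by have -> : (w * 20^-1 * u = 20^-1 * (w * u))%R; [ring | move: (w * u)%R => z; lra].
Qed.

Lemma error_sum (R : realFieldType) (z v : R) :
  (0 <= z -> z <= 20 * v -> 2 * z + 4096 * z + 60 * z <= 5000 * (20 * v))%R.
Proof. by move=> z0 zv; lra. Qed.

(** With L >= 4^k / (2k) all three terms are O(k (5/6)^k), where 5/6 is the inverse of 4 times 3/10.
    Bernoulli's inequality absorbs the factor k, since (1 + 1/20) 5/6 = 7/8. *)
Lemma error_decay (R : realFieldType) k N : (1 < k)%N -> (N <= 2 ^ (2 * k + 1))%N ->
  (('C(2 * k, k)%:R * (3 / 10) ^+ k)^-1 + 2 * (1024 / 'C(2 * k, k)%:R)
    + (2 * k + 1)%:R * N%:R * (2 * (9 / 20) ^+ (2 * k - 2)) <= 5000 * (20 * (7 / 8) ^+ k) :> R)%R.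
Proof.
move=> k1 N_le; set L := 'C(2 * k, k); set y : R := ((5 / 6) ^+ k)%R.
have k_gt0 : (0 < k)%N by apply: ltnW.
have L_gt0 : (0 < L%:R :> R)%R by rewrite ltr0n bin_gt0; lia.
have kR : (2 <= k%:R :> R)%R by rewrite ler_nat.
have y0 : (0 <= y)%R by rewrite exprn_ge0 // divr_ge0 ?ler0n.
have Li : (L%:R^-1 <= 2 * k%:R * 4^-1 ^+ k :> R)%R.
  rewrite -div1r ler_pdivrMr // exprVn mulrAC ler_pdivlMr ?exprn_gt0 ?ltr0n // mul1r.
  by rewrite -natrX -!natrM ler_nat central_bin_ge.
have t1 : ((L%:R * (3 / 10) ^+ k)^-1 <= 2 * k%:R * y :> R)%R.
  rewrite invfM -exprVn; apply: le_trans (ler_wpM2r _ Li) _.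
    by rewrite exprn_ge0 // invr_ge0 divr_ge0 ?ler0n.
  have -> : (y = 4^-1 ^+ k * (3 / 10)^-1 ^+ k)%R.
    by rewrite /y -exprMn; congr (_ ^+ _)%R; field.
  by rewrite mulrA.
have t2 : (2 * (1024 / L%:R) <= 4096 * (k%:R * y) :> R)%R.
  have : (4^-1 ^+ k <= y :> R)%R.
    by rewrite lerXn2r ?nnegrE ?invr_ge0 ?divr_ge0 ?ler0n //; lra.
  move=> h; have := ler_wpM2l (ltW (lt_le_trans (ltr0Sn R 1) kR)) h; move: Li; lra.
have t3 := near_decay R k_gt0 N_le; rewrite -/y in t3.
have ky : (k%:R * y <= 20 * (7 / 8) ^+ k)%R.
  have c0 : (0 <= 20^-1 :> R)%R by rewrite invr_ge0 ler0n.
  have := ler_wpM2r y0 (bernoulli k c0).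
  have -> : ((1 + 20^-1) ^+ k * y = (7 / 8) ^+ k)%R.
    by rewrite /y -exprMn; congr (_ ^+ _)%R; field.
  exact: scale_twentieth.
have ky0 : (0 <= k%:R * y)%R by rewrite mulr_ge0 ?ler0n.
apply: le_trans (lerD (lerD t1 t2) t3) _; rewrite -mulrA.
exact: error_sum ky0 ky.
Qed.

Lemma many_vertices k : (20 <= k)%N -> (1024 * (k + 2) <= 'C(2 * k, k))%N.
Proof.
move=> k20; have k_gt0 : (0 < k)%N by apply: leq_trans k20.
rewrite -(leq_pmul2l (m := 2 * k)) ?muln_gt0 ?k_gt0 //.
apply: leq_trans (central_bin_ge k_gt0).
have E : (4 ^ k = 2 ^ k * 2 ^ k)%N by rewrite -expnMn.
have [j kj] : exists j, k = (20 + j)%N by exists (k - 20)%N; lia.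
have p : (j < 2 ^ j)%N by apply: ltn_expl.
have P : (2048 * k <= 2 ^ k)%N.
  rewrite {2}kj -[20]/(11 + 9)%N !expnD -mulnA -[(2 ^ 11)%N]/2048 leq_mul2l /=.
  rewrite -[(2 ^ 9)%N]/512 kj; move: p; move: (2 ^ j)%N => q; clear; lia.
rewrite E; apply: leq_trans (_ : 2048 * k * (k + 2) <= _)%N; first by clear; nia.
apply: (leq_mul P); apply: leq_trans P; move: k20; clear; lia.
Qed.

Lemma complement_arith (R : realFieldType) (a b c w : R) :
  (b <= c * w -> a + b = w -> (1 - c) * w <= a)%R.
Proof. by move=> bc E; rewrite mulrBl mul1r; lra. Qed.

Import numFieldNormedType.Exports.

Local Open Scope classical_set_scope.
Local Open Scope ring_scope.

Theorem theorem1p3 (R : realType) :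
  unif_prob R (edge_orders (2 * k + 1) k) (tau_alpha_eq_tau_super (2 * k + 1) k)
    @[k --> \oo] --> (1 : R).
Proof.
(* The two arguments are the entropy constants of the near and the far encodings. *)
pose C := maxn (49 * 122) (5 * ((4 * 2048 + 2) + 2049)).
have [K KP] := good_root R C.
set p := fun k : nat => unif_prob R _ _.
have p_le1 k : p k <= 1.
  rewrite /p /unif_prob; have [->|O_gt0] := posnP #|edge_orders (2 * k + 1) k|.
    by rewrite invr0 mulr0 ler01.
  rewrite ler_pdivrMr ?ltr0n // mul1r ler_nat.
  exact/subset_leq_card/finset.subsetIr.
have p_ge k : (maxn 300 K <= k)%N -> 1 - 5000 * (20 * (7 / 8) ^+ k) <= p k.
  rewrite geq_max => /andP[k300 /KP[s [s8 s4k powC]]].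
  have k20 : (20 <= k)%N by apply: leq_trans k300.
  have k1 : (1 < k)%N by apply: leq_trans k300.
  have bad := bad_probability (erefl (2 * k + 1)%N) k300 s8 s4k (many_vertices k20) powC
    (leq_maxl _ _) (leq_maxr _ _).
  have N_le := card_ksubset_le (2 * k + 1) k.
  have := le_trans bad (ler_wpM2r (ler0n R _) (error_decay R k1 N_le)).
  rewrite /p /unif_prob; set O := edge_orders _ _; set E := tau_alpha_eq_tau_super _ _.
  have O_gt0 : (0 < #|O|%:R :> R).
    by rewrite ltr0n /O edge_orders_bijections; apply/card_bijections_gt0/card_edge.
  move=> le; rewrite ler_pdivlMr //.
  have := cardsID E O; rewrite finset.setIC => /(congr1 (fun i => i%:R : R)).
  rewrite natrD => cE; exact: complement_arith le cE.
have cvg0 : (fun k : nat => 5000 * (20 * (7 / 8 : R) ^+ k)) @ \oo --> 5000 * (20 * (0 : R)).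
  apply: cvgM; first exact: cvg_cst.
  apply: cvgM; first exact: cvg_cst.
  by apply: cvg_expr; rewrite ger0_norm ?divr_ge0 ?ler0n //; lra.
apply: (@squeeze_cvgr _ _ _ _ (fun k => 1 - 5000 * (20 * (7 / 8) ^+ k)) (fun=> 1)).
- near=> k; rewrite p_le1 andbT; apply: p_ge; near: k; exact: nbhs_infty_ge.
- rewrite -[X in _ --> X]subr0 -[X in 1 - X](mulr0 (5000 : R)) -[X in 5000 * X](mulr0 (20 : R)).
  by apply: cvgB cvg0; apply: cvg_cst.
- exact: cvg_cst.
Unshelve. all: by end_near.
Qed.
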